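(* For all integers $r,t$ with $2\le t<r$, the limit $\lim_{n\to\infty} n^{-t} f^{(r)}(n;3r-2t,3)$ exists and $$\lim_{n\to\infty} n^{-t} f^{(r)}(n;3r-2t,3)=\frac{2}{t!\left(2\binom{r}{t}-1\right)}.$$
   Context: An $r$-graph is a finite $r$-uniform hypergraph (its edge set is a set of $r$-element subsets of its finite vertex set). For positive integers $r,s,k,n$, $f^{(r)}(n;s,k)$ denotes the maximum number of edges in an $r$-graph on $n$ vertices that contains no subgraph with exactly $k$ edges and at most $s$ vertices; equivalently, in which there are no $k$ distinct edges whose union has at most $s$ vertices. *)

(* Defs.v *)
From HB Require Import structures.
From mathcomp Require Import all_boot all_order all_algebra.

Set Implicit Arguments.
Unset Strict Implicit.
Unset Printing Implicit Defensive.

Section Hypergraphs.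
Variable V : finType.

(* A hypergraph on the vertex set [V] is given by its set of edges. *)
Definition uniform (r : nat) (E : {set {set V}}) : bool :=
  [forall e in E, #|e| == r].

(* [E] has no [k] distinct edges whose union has at most [s] vertices. *)
Definition sparse (s k : nat) (E : {set {set V}}) : bool :=
  [forall F : {set {set V}},
     (F \subset E) && (#|F| == k) ==> ~~ (#|cover F| <= s)].

End Hypergraphs.

(* The extremal number f^(r)(n; s, k).  For 0 < k the edgeless graph is
   admissible, so the maximum ranges over a nonempty family. *)
Definition extremal (r n s k : nat) : nat :=
  \max_(E : {set {set 'I_n}} | uniform r E && sparse s k E) #|E|.

(* Main.v *)
Require Import Defs.
From HB Require Import structures.
From mathcomp Require Import all_boot all_order all_algebra.
From mathcomp Require Import perm reals sequences exp.
From mathcomp Require Import ring lra.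
From mathcomp Require Import zify.

(** Upper bound: call an edge heavy if it shares more than t vertices with
    another edge; each (t-1)-set lies in at most two heavy edges, so there are
    O(n^(t-1)) of them.  Among the other edges every t-set lies in at most two,
    and every edge contains at most one t-set covered twice; counting covered
    t-sets gives (2 C(r,t) - 1) |E| <= 2 C(n,t) up to O(n^(t-1)).

    Lower bound: almost all t-sets are covered disjointly by pairs of r-sets
    meeting in exactly t vertices, each pair covering k = 2 C(r,t) - 1 of them.
    The pairs are selected by a weighted nibble, and two kinds of obstruction
    have to be avoided.
    - A pair and an edge of another pair.  Each t-set is coloured at random,
      positive with probability close to 1, and a pair is admissible only if the
      t-sets inside its 2r-t vertices that are positive are exactly the ones it
      covers.  Then a t-set shared with an edge of another pair is positive,
      hence covered by both pairs.
    - Three edges of three different pairs, pairwise meeting in fewer than t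
      vertices, on at most 3r-2t vertices.  In a random-like family of pairs
      these occur with the critical density.  Each vertex gets a random label
      with centred spike value s (E s = 0, E s^2, E s^3 > 0) and an r-set g gets
      weight 1 - eps * sum_(S in g, |S| > t) prod_(v in S) s_v.  Conditioning on
      t labels does not change the mean, so degrees stay regular, but on a bad
      triple, where each edge has more than t shared vertices, the first and
      second order terms vanish and the third one gives mean at most
      1 - eps^3.  The product over d independent labels pushes the density of
      bad triples down by (1 - eps^3)^d, and the few bad triples that remain
      are destroyed by deleting pairs. *)

Set Implicit Arguments.
Unset Strict Implicit.
Unset Printing Implicit Defensive.

Import Order.TTheory GRing.Theory Num.Theory.
Local Open Scope ring_scope.

(** * Expectations over finite product measures *)

Section ProductMeasure.
Variables (R : realFieldType) (J X : finType) (mu : J -> X -> R).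

Definition Ex (f : {ffun J -> X} -> R) : R :=
  \sum_(x : {ffun J -> X}) (\prod_j mu j (x j)) * f x.

Lemma Ex_prod (h : J -> X -> R) :
  Ex (fun x => \prod_j h j (x j)) = \prod_j \sum_a mu j a * h j a.
Proof.
rewrite /Ex bigA_distr_bigA /=.
by apply: eq_bigr => x _; rewrite big_split.
Qed.

Lemma eq_Ex f g : f =1 g -> Ex f = Ex g.
Proof. by move=> fg; apply: eq_bigr => x _; rewrite fg. Qed.

Lemma ExD f g : Ex (fun x => f x + g x) = Ex f + Ex g.
Proof. by rewrite -big_split; apply: eq_bigr => x _; rewrite mulrDr. Qed.

Lemma ExZ a f : Ex (fun x => a * f x) = a * Ex f.
Proof. by rewrite /Ex mulr_sumr; apply: eq_bigr => x _; rewrite mulrCA. Qed.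

Lemma ExN f : Ex (fun x => - f x) = - Ex f.
Proof. by rewrite -mulN1r -ExZ; apply: eq_Ex => x; rewrite mulN1r. Qed.

Lemma ExB f g : Ex (fun x => f x - g x) = Ex f - Ex g.
Proof. by rewrite ExD ExN. Qed.

Lemma Ex_sum (I : Type) (r : seq I) (P : pred I) (f : I -> {ffun J -> X} -> R) :
  Ex (fun x => \sum_(i <- r | P i) f i x) = \sum_(i <- r | P i) Ex (f i).
Proof.
rewrite /Ex exchange_big /=.
by apply: eq_bigr => x _; rewrite mulr_sumr.
Qed.

Hypothesis mu_ge0 : forall j a, 0 <= mu j a.
Hypothesis mu_sum1 : forall j, \sum_a mu j a = 1.

Lemma Ex_le f g : (forall x, f x <= g x) -> Ex f <= Ex g.
Proof.
move=> fg; apply: ler_sum => x _; apply: ler_wpM2l => //.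
by apply: prodr_ge0 => j _.
Qed.

Lemma Ex_cst a : Ex (fun=> a) = a.
Proof.
have -> : Ex (fun=> a) = a * Ex (fun=> \prod_(j : J) 1).
  by rewrite -ExZ; apply: eq_Ex => x; rewrite big1 // mulr1.
rewrite (Ex_prod (fun _ _ => 1)) big1 ?mulr1 // => j _.
by under eq_bigr => a' _ do rewrite mulr1.
Qed.

Lemma Ex_ge0 f : (forall x, 0 <= f x) -> 0 <= Ex f.
Proof. by move=> f0; rewrite -(Ex_cst 0); apply: Ex_le. Qed.

(** First moment method. The point found also lies in the support of the measure, which later
    ensures that every chosen edge has positive weight. If there were none, every weighted term of
    [f] would dominate that of [a]; equality of the sums would then make all probabilities
    vanish. *)
Lemma Ex_exists f a : Ex f <= a ->
  exists2 x, f x <= a & forall j, 0 < mu j (x j).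
Proof.
move=> fa.
have [x /andP[fx /forallP mx]|no] :=
  pickP (fun x : {ffun J -> X} => (f x <= a) && [forall j, 0 < mu j (x j)]).
  by exists x.
suff : Ex (fun=> a) < Ex f by rewrite Ex_cst ltNge fa.
have le1 (x : {ffun J -> X}) :
    (\prod_j mu j (x j)) * a <= (\prod_j mu j (x j)) * f x.
  have := no x; case: (leP (f x) a) => /= [_ /negbT|fx _]; last first.
    by apply: ler_wpM2l (ltW fx); apply: prodr_ge0.
  rewrite negb_forall => /existsP[j]; rewrite lt_def mu_ge0 andbT negbK => /eqP mj.
  by rewrite (bigD1 j) //= mj !mul0r.
rewrite lt_neqAle ler_sum // andbT; apply/eqP => eqE.
have {}eqE (x : {ffun J -> X}) :
    (\prod_j mu j (x j)) * f x - (\prod_j mu j (x j)) * a = 0.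
  apply: (psumr_eq0P (P := xpredT) (F := fun x : {ffun J -> X} =>
    (\prod_j mu j (x j)) * f x - (\prod_j mu j (x j)) * a)) => //.
    by move=> y _; rewrite subr_ge0.
  by rewrite sumrB; apply/eqP; rewrite subr_eq0 -[X in X == _]/(Ex f) -eqE.
have pos0 (x : {ffun J -> X}) : \prod_j mu j (x j) = 0.
  apply/eqP/contraT => nz.
  have nzj j : mu j (x j) != 0 by apply: contraNneq nz => mj; rewrite (bigD1 j) //= mj mul0r.
  move: (eqE x) (no x); rewrite -mulrBr => /eqP; rewrite mulf_eq0 (negPf nz) /= subr_eq0 => /eqP ->.
  rewrite lexx /= => /negbT; rewrite negb_forall => /existsP[j].
  by rewrite lt_def nzj mu_ge0.
have := Ex_cst 1; rewrite /Ex big1 => [/eqP|x _]; first by rewrite eq_sym oner_eq0.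
by rewrite pos0 mul0r.
Qed.

End ProductMeasure.

(** * A weighted nibble *)

Lemma natr_forall (R : pzSemiRingType) (I : finType) (P : pred I) :
  [forall i, P i]%:R = \prod_i (P i)%:R :> R.
Proof.
have -> : [forall i, P i] = \big[andb/true]_i P i by rewrite big_andE.
apply: (big_morph (fun b : bool => b%:R : R)) => // a b.
by rewrite -mulnb natrM.
Qed.

(** * Elementary inequalities for exp(-x) *)

Section Expo.
Variable R : realType.

Lemma expRN_le1 (x : R) : 0 <= x -> expR (- x) <= 1.
Proof. by move=> x0; rewrite -[leRHS]expR0 ler_expR oppr_le0. Qed.

(** As 1 - z <= exp(-z), exp(-x) (1 - z) <= exp(-x - z) <= exp(-y), and the missing term exp(-x) z
    is at most z. This turns an error in the exponent into an additive error. *)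
Lemma expRN_shift (x y z : R) : 0 <= x -> 0 <= z -> y - z <= x ->
  expR (- x) <= expR (- y) + z.
Proof.
move=> x0 z0 yzx.
have h1 : expR (- x) * expR (- z) <= expR (- y).
  by rewrite -expRD ler_expR; lra.
have h2 := expR_ge1Dx (- z); have h3 := expRN_le1 x0; have h4 := expR_ge0 (- x).
have : expR (- x) * (1 - z) <= expR (- x) * expR (- z) by apply: ler_wpM2l.
have : expR (- x) * z <= z by apply: ler_piMl.
lra.
Qed.

Lemma mul_expRN_le (a : R) : a * expR (- a) <= 1 - expR (- a).
Proof.
have h := expR_ge1Dx a.
have : (1 + a) * expR (- a) <= expR a * expR (- a).
  by apply: ler_wpM2r => //; exact: expR_ge0.
by rewrite -expRD subrr expR0; lra.
Qed.

Lemma onesubexpRN_le (a : R) : 1 - expR (- a) <= a.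
Proof. by have := expR_ge1Dx (- a); lra. Qed.

End Expo.

(** * Weighted degrees, codegrees and hitting weights *)

Section Weighted.
Variables (R : realType) (V I : finType) (e : I -> {set V}).

Definition deg (w : I -> R) (v : V) : R := \sum_(i | v \in e i) w i.
Definition codeg (w : I -> R) (u v : V) : R :=
  \sum_(i | (u \in e i) && (v \in e i)) w i.
Definition hit (w : I -> R) (U : {set V}) : R :=
  \sum_(i | ~~ [disjoint e i & U]) w i.

Variable w : I -> R.
Hypothesis w_ge0 : forall i, 0 <= w i.

Lemma deg_ge0 v : 0 <= deg w v.
Proof. exact: sumr_ge0. Qed.

Lemma codeg_ge0 u v : 0 <= codeg w u v.
Proof. exact: sumr_ge0. Qed.

Lemma hit_ge0 U : 0 <= hit w U.
Proof. exact: sumr_ge0. Qed.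

Lemma hit1 v : hit w [set v] = deg w v.
Proof. by apply: eq_bigl => i; rewrite disjoint_sym disjoints1 negbK. Qed.

Lemma sum_deg (U : {set V}) (f : V -> R) :
  \sum_(v in U) f v * deg w v = \sum_i w i * \sum_(v in e i :&: U) f v.
Proof.
rewrite /deg.
under eq_bigr => v _ do rewrite mulr_sumr big_mkcond.
rewrite exchange_big; apply: eq_bigr => i _.
rewrite mulr_sumr big_mkcond [RHS]big_mkcond; apply: eq_bigr => v _ /=.
by rewrite inE andbC; case: (v \in U); case: (v \in e i); rewrite //= mulrC.
Qed.

Lemma hit_le U : hit w U <= \sum_(v in U) deg w v.
Proof.
under eq_bigr => v _ do rewrite -[deg w v]mul1r.
rewrite sum_deg /hit big_mkcond; apply: ler_sum => i _.
case: ifPn => [|_]; last by rewrite mulr_ge0 // sumr_ge0.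
rewrite -setI_eq0 => /set0Pn[v vi].
by rewrite ler_peMr // (bigD1 v) //= lerDl sumr_ge0.
Qed.

(** Bonferroni: an edge with j >= 1 vertices in [U] is counted j times in the degree sum, and the
    excess j - 1 is at most its number of ordered pairs of distinct vertices of [U], which the
    codegrees count. *)
Lemma hit_ge (U : {set V}) (delta : R) : 0 <= delta -> (forall u v, u != v -> codeg w u v <= delta) ->
  \sum_(v in U) deg w v - #|U|%:R ^+ 2 * delta <= hit w U.
Proof.
move=> d0 codd; rewrite lerBlDr.
have le1 : \sum_(v in U) deg w v <=
    hit w U + \sum_(u in U) \sum_(v in U | v != u) codeg w u v.
  under eq_bigr => v _ do rewrite -[deg w v]mul1r.
  rewrite sum_deg /hit /codeg.
  under [X in _ + X]eq_bigr => u _ do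
    (under eq_bigr => v _ do rewrite big_mkcond; rewrite exchange_big).
  rewrite [X in _ + X]exchange_big /= [X in X + _]big_mkcond -big_split /=.
  apply: ler_sum => i _; case: ifPn => [|]; last first.
    rewrite negbK -setI_eq0 => /eqP ->; rewrite big_set0 mulr0 add0r.
    by do 2!(apply: sumr_ge0 => ? _); case: ifP.
  rewrite -setI_eq0 => /set0Pn[u]; rewrite inE => /andP[ui uU].
  rewrite (bigD1 u) /= ?inE ?ui //  mulrDr mulr1 lerD2l.
  rewrite [leRHS](bigD1 u) //= ler_wpDr //.
    by do 2!(apply: sumr_ge0 => ? _); case: ifP.
  rewrite mulr_sumr big_mkcond [leRHS]big_mkcond; apply: ler_sum => v _ /=.
  rewrite inE ui /= mulr1.
  by case: (v \in U); case: (v != u); case: (v \in e i).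
apply: le_trans le1 _; rewrite lerD2l.
rewrite expr2 -mulrA mulr_natl -sumr_const; apply: ler_sum => u uU.
rewrite mulr_natl -sumr_const [leRHS](bigD1 u) //=.
rewrite ler_wpDl //; apply: ler_sum => v /andP[_]; rewrite eq_sym; exact: codd.
Qed.

End Weighted.

(** For the indicator of a set of edges this counts the triples of [B] inside the set. Real values
    of [f] allow edges already chosen to be mixed with probability bounds for later choices. *)
Definition triple_sum (R : pzSemiRingType) (I : finType) (B : {set I * I * I})
    (f : I -> R) : R :=
  \sum_(tr in B) f tr.1.1 * f tr.1.2 * f tr.2.

(** * One round of the nibble *)

Section Step.
Variables (R : realType) (V I : finType) (e : I -> {set V}) (w : I -> R).
Variables (A : {set V}) (k : nat) (g K delta : R).
Hypothesis w_ge0 : forall i, 0 <= w i.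
Hypothesis w_supp : forall i, w i != 0 -> e i \subset A /\ #|e i| = k.
Hypothesis k_gt0 : (0 < k)%N.
Hypothesis deg_leK : forall v, deg e w v <= K.
Hypothesis codeg_le : forall u v, u != v -> codeg e w u v <= delta.
Hypothesis delta_ge0 : 0 <= delta.
Hypothesis g_gt0 : 0 < g.
Hypothesis g_le1 : g <= 1.
Hypothesis K_ge0 : 0 <= K.

(* Edge [i] is proposed with probability 1 - exp(-g w_i): then a vertex set [U] is
   missed by all proposed edges with probability exactly exp(-g hit(U)). *)
Definition bite_law (i : I) (b : bool) : R :=
  if b then 1 - expR (- (g * w i)) else expR (- (g * w i)).

Let gw_ge0 i : 0 <= g * w i.
Proof. by rewrite mulr_ge0 // ltW. Qed.

Lemma bite_law_ge0 i b : 0 <= bite_law i b.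
Proof. by case: b; rewrite /= ?expR_ge0 // subr_ge0 expRN_le1. Qed.

Lemma bite_law_sum1 i : \sum_b bite_law i b = 1.
Proof. by rewrite big_bool /= subrK. Qed.

Local Notation E := (Ex bite_law).

Definition missed (x : {ffun I -> bool}) (U : {set V}) : bool :=
  [forall i, ~~ [disjoint e i & U] ==> ~~ x i].

Lemma E_missed U : E (fun x => (missed x U)%:R) = expR (- (g * hit e w U)).
Proof.
rewrite (eq_Ex _ (g := fun x : {ffun I -> bool} =>
   \prod_i (~~ [disjoint e i & U] ==> ~~ x i)%:R)); last first.
  by move=> x; rewrite natr_forall.
rewrite (Ex_prod _ (fun i b => (~~ [disjoint e i & U] ==> ~~ b)%:R)).
rewrite /hit mulr_sumr -sumrN expR_sum [RHS]big_mkcond /=.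
apply: eq_bigr => i _; rewrite big_bool /=.
by case: [disjoint _ & _]; rewrite /= ?mulr1 ?mulr0 ?add0r // subrK.
Qed.

Lemma missedU x U1 U2 : missed x (U1 :|: U2) = missed x U1 && missed x U2.
Proof.
have hitU i : ~~ [disjoint e i & U1 :|: U2] =
    ~~ [disjoint e i & U1] || ~~ [disjoint e i & U2].
  by rewrite -!setI_eq0 setIUr setU_eq0 negb_and.
apply/forallP/andP => [h|[/forallP h1 /forallP h2] i].
  by split; apply/forallP => i; apply/implyP => di; move: (h i);
    rewrite hitU di ?orbT.
by rewrite hitU; apply/implyP => /orP[] d; [move: (h1 i)|move: (h2 i)]; rewrite d.
Qed.

Definition survivors (x : {ffun I -> bool}) : {set V} :=
  [set v in A | missed x [set v]].

Lemma sub_survivors x (U : {set V}) :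
  (U \subset survivors x) = (U \subset A) && missed x U.
Proof.
apply/idP/andP => [/subsetP US|[/subsetP UA /forallP mU]].
  split; first by apply/subsetP => v /US; rewrite inE => /andP[].
  apply/forallP => i; apply/implyP; rewrite -setI_eq0 => /set0Pn[v].
  rewrite inE => /andP[vi /US]; rewrite inE => /andP[_ /forallP/(_ i)].
  by rewrite disjoint_sym disjoints1 vi.
apply/subsetP => v vU; rewrite inE UA //=; apply/forallP => i.
rewrite disjoint_sym disjoints1 negbK; apply/implyP => vi.
move: (mU i); rewrite -setI_eq0; case: set0Pn => [//|[]].
by exists v; rewrite inE vi.
Qed.

(** The edges kept in this round. A proposed edge that meets another proposed edge is discarded, and
    its vertices are wasted. *)
Definition isolated (x : {ffun I -> bool}) : {set I} :=
  [set i | x i && [forall j, (j != i) && ~~ [disjoint e j & e i] ==> ~~ x j]].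

(** When w_i is nonzero, independence gives exactly (1 - exp(-a)) exp(-g (hit(e_i) - w_i)) with a =
    g w_i. Bounding 1 - exp(-a) below by a exp(-a) puts the missing w_i back into the exponent, and
    hit(e_i) <= k K. *)
Lemma E_isolated i :
  g * w i * (1 - g * (k%:R * K)) <= E (fun x => (i \in isolated x)%:R).
Proof.
case: (eqVneq (w i) 0) => [->|wi].
  rewrite mulr0 mul0r; apply: Ex_ge0 => //; [exact: bite_law_ge0|exact: bite_law_sum1].
have [eiA ei] := w_supp wi.
rewrite (eq_Ex _ (g := fun x : {ffun I -> bool} => \prod_j
   (if j == i then x j else ~~ [disjoint e j & e i] ==> ~~ x j)%:R)); last first.
  move=> x; rewrite inE -mulnb natrM natr_forall (bigD1 i) //= eqxx.
  rewrite [RHS](bigD1 i) //= !eqxx /= mul1r; congr (_ * _).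
  by apply: eq_bigr => j /negPf ->.
rewrite (Ex_prod _ (fun j b =>
  (if j == i then b else ~~ [disjoint e j & e i] ==> ~~ b)%:R)).
rewrite (bigD1 i) //= big_bool eqxx /= mulr1 mulr0 addr0.
have -> : \prod_(j | j != i) (\sum_b bite_law j b *
    (if j == i then b else ~~ [disjoint e j & e i] ==> ~~ b)%:R) =
    expR (- (g * (hit e w (e i) - w i))).
  rewrite /hit [X in g * (X - _)](bigD1 i) /=; last first.
    by rewrite -setI_eq0 setIid -card_gt0 ei.
  rewrite addrAC subrr add0r mulr_sumr -sumrN expR_sum.
  under [RHS]eq_bigl => j do rewrite andbC.
  rewrite [RHS]big_mkcondr /=; apply: eq_bigr => j /negPf ->; rewrite big_bool /=.
  by case: [disjoint _ & _]; rewrite /= ?mulr1 ?mulr0 ?add0r // subrK.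
have le1 : g * w i * expR (- (g * hit e w (e i))) <=
    (1 - expR (- (g * w i))) * expR (- (g * (hit e w (e i) - w i))).
  apply: (@le_trans _ _ (g * w i * expR (- (g * w i)) *
      expR (- (g * (hit e w (e i) - w i))))).
    by rewrite -[leRHS]mulrA -expRD -opprD -mulrDr addrC subrK.
  by rewrite ler_wpM2r ?expR_ge0 // mul_expRN_le.
apply: le_trans le1; apply: ler_wpM2l => //.
apply: le_trans (expR_ge1Dx _); rewrite lerD2l lerN2 ler_wpM2l ?(ltW g_gt0) //.
apply: le_trans (hit_le e w_ge0 _) _.
by rewrite -ei mulr_natl -sumr_const; apply: ler_sum.
Qed.

Let c : R := expR (g * k.-1%:R).

(* An edge through a surviving vertex survives with probability about
   exp(-g (k-1)); the factor [c] restores degrees close to 1. *)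
Definition bite_weight (x : {ffun I -> bool}) (i : I) : R :=
  c * w i * (missed x (e i))%:R.

Let c_ge0 : 0 <= c. Proof. exact: expR_ge0. Qed.

Lemma bite_weight_ge0 x i : 0 <= bite_weight x i.
Proof. by rewrite /bite_weight !mulr_ge0. Qed.

Lemma bite_weight_le x i : bite_weight x i <= c * w i.
Proof.
by rewrite /bite_weight; case: missed; rewrite ?mulr1 ?mulr0 ?mulr_ge0.
Qed.

Lemma bite_weight_supp x i : bite_weight x i != 0 ->
  e i \subset survivors x /\ #|e i| = k.
Proof.
rewrite /bite_weight sub_survivors.
by case: missed => /=; rewrite ?mulr0 ?eqxx // mulr1 mulf_eq0 negb_or andbT => /andP[_ /w_supp].
Qed.

Lemma bite_deg_le x v : deg e (bite_weight x) v <= c * deg e w v.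
Proof. by rewrite mulr_sumr; apply: ler_sum => i _; exact: bite_weight_le. Qed.

Lemma bite_codeg_le x u v :
  codeg e (bite_weight x) u v <= c * codeg e w u v.
Proof. by rewrite mulr_sumr; apply: ler_sum => i _; exact: bite_weight_le. Qed.

Definition irreg (v : V) : R := `|deg e w v - 1|.

Lemma irreg_ge0 v : 0 <= irreg v. Proof. exact: normr_ge0. Qed.

Lemma sum_irreg_ge0 (P : pred V) : 0 <= \sum_(v | P v) irreg v.
Proof. by apply: sumr_ge0 => v _; exact: irreg_ge0. Qed.

Let S := \sum_(v in A) irreg v.

Lemma E_survivors :
  E (fun x => #|survivors x|%:R) <= expR (- g) * #|A|%:R + g * S.
Proof.
rewrite (eq_Ex _ (g := fun x => \sum_(v in A) (missed x [set v])%:R)); last first.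
  move=> x; rewrite -sum1_card natr_sum big_mkcond [RHS]big_mkcond /=.
  by apply: eq_bigr => v _; rewrite inE; case: (v \in A); case: missed.
rewrite Ex_sum mulr_natr -sumr_const mulr_sumr -big_split /=.
apply: ler_sum => v _; rewrite E_missed hit1; apply: expRN_shift.
- by rewrite mulr_ge0 ?deg_ge0 // ltW.
- by rewrite mulr_ge0 ?normr_ge0 // ltW.
have -> : g - g * irreg v = g * (1 - irreg v) by ring.
rewrite ler_wpM2l ?(ltW g_gt0) // lerBlDl -lerBlDr.
by rewrite /irreg distrC ler_norm.
Qed.

(** With W the total weight, on average at most g k W vertices die, while the isolated edges cover
    at least g k W (1 - g k K). The first-order terms cancel, and k W <= K |A| bounds the rest by a
    multiple of g^2. *)
Lemma E_waste :
  E (fun x => #|A|%:R - #|survivors x|%:R - k%:R * #|isolated x|%:R)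
   <= g ^+ 2 * (k%:R * K ^+ 2) * #|A|%:R.
Proof.
set W := \sum_i w i.
have kW : \sum_(v in A) deg e w v = k%:R * W.
  under eq_bigr => v _ do rewrite -[deg e w v]mul1r.
  rewrite sum_deg mulr_sumr; apply: eq_bigr => i _.
  case: (eqVneq (w i) 0) => [->|/w_supp[eiA ei]]; first by rewrite mul0r mulr0.
  by rewrite (setIidPl eiA) sumr_const ei mulrC.
have le1 : E (fun x => #|A|%:R - #|survivors x|%:R) <= g * (k%:R * W).
  rewrite (eq_Ex _ (g := fun x => \sum_(v in A) (1 - (missed x [set v])%:R))); last first.
    move=> x; rewrite sumrB sumr_const; congr (_ - _).
    rewrite -sum1_card natr_sum big_mkcond [RHS]big_mkcond /=.
    by apply: eq_bigr => v _; rewrite inE; case: (v \in A); case: missed.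
  rewrite Ex_sum -kW mulr_sumr; apply: ler_sum => v _.
  rewrite ExB (Ex_cst bite_law_sum1) E_missed hit1; exact: onesubexpRN_le.
have le2 : g * W * (1 - g * (k%:R * K)) <= E (fun x => #|isolated x|%:R).
  rewrite (eq_Ex _ (g := fun x => \sum_i (i \in isolated x)%:R)); last first.
    by move=> x; rewrite -sum1_card natr_sum big_mkcond /=; apply: eq_bigr => i _; case: ifP.
  rewrite Ex_sum mulr_sumr mulr_suml; apply: ler_sum => i _; exact: E_isolated.
rewrite ExB ExZ.
have WK : k%:R * W <= K * #|A|%:R.
  by rewrite -kW mulr_natr -sumr_const; apply: ler_sum.
have k0 : 0 <= k%:R :> R := ler0n _ _.
have := ler_wpM2l k0 le2.
have : g ^+ 2 * (k%:R * K) * (k%:R * W) <= g ^+ 2 * (k%:R * K) * (K * #|A|%:R).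
  by rewrite ler_wpM2l // mulr_ge0 ?sqr_ge0 ?mulr_ge0.
move: le1; nra.
Qed.

Lemma expR_hit_le (U : {set V}) : U \subset A ->
  expR (- (g * hit e w U)) <=
    expR (- (g * #|U|%:R)) + g * (\sum_(u in U) irreg u + #|U|%:R ^+ 2 * delta).
Proof.
move=> UA; apply: expRN_shift.
- by rewrite mulr_ge0 ?hit_ge0 // ltW.
- by rewrite mulr_ge0 ?(ltW g_gt0) // addr_ge0 ?sum_irreg_ge0 // mulr_ge0 ?sqr_ge0.
rewrite -mulrBr ler_wpM2l ?(ltW g_gt0) //; apply: le_trans (hit_ge w_ge0 _ delta_ge0 codeg_le).
rewrite opprD addrA lerD2r -sumr_const -sumrB; apply: ler_sum => u _.
by rewrite lerBlDl -lerBlDr /irreg distrC ler_norm.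
Qed.

Lemma expR_hit_ge (U : {set V}) :
  expR (- (g * #|U|%:R)) <= expR (- (g * hit e w U)) + g * \sum_(u in U) irreg u.
Proof.
apply: expRN_shift; [by rewrite mulr_ge0 // ltW| |].
  by rewrite mulr_ge0 ?(ltW g_gt0) ?sum_irreg_ge0.
rewrite -mulrBr ler_wpM2l ?(ltW g_gt0) // lerBlDr; apply: le_trans (hit_le e w_ge0 _) _.
rewrite -sumr_const -big_split /=; apply: ler_sum => u _.
by rewrite -lerBlDl /irreg ler_norm.
Qed.

Let sg (i : I) : R := \sum_(u in e i) irreg u.

(** If the two edges share only [v], their union has 2k - 1 vertices. Otherwise the sum of
    indicators is at least 1 and dominates the left-hand side trivially. *)
Lemma expR_hit_pair v i j : w i != 0 -> w j != 0 -> v \in e i -> v \in e j ->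
  expR (- (g * hit e w (e i :|: e j))) <=
    expR (- (g * (k + k.-1)%:R)) + \sum_(u in e i | u != v) (u \in e j)%:R
    + g * (sg i + sg j + 4 * k%:R ^+ 2 * delta).
Proof.
move=> /w_supp[iA ik] /w_supp[jA jk] vi vj.
have UA : e i :|: e j \subset A by rewrite subUset iA.
apply: le_trans (expR_hit_le UA) _.
have cU : (#|e i :|: e j| + #|e i :&: e j| = k + k)%N by rewrite cardsUI ik jk.
set q := \sum_(u in e i | _) _.
have qE : q = #|(e i :&: e j) :\ v|%:R.
  rewrite /q -sum1_card natr_sum big_mkcond [RHS]big_mkcond; apply: eq_bigr => u _ /=.
  by rewrite !inE; case: (u \in e i); case: (u != v); case: (u \in e j).
have vIJ : v \in e i :&: e j by rewrite inE vi.
have cq := cardsD1 v (e i :&: e j); rewrite vIJ /= in cq.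
apply: lerD.
  case: (posnP #|(e i :&: e j) :\ v|) => [q0|q0].
    suff -> : #|e i :|: e j| = (k + k.-1)%N by rewrite lerDl qE.
    by move: cU; rewrite cq q0 -(prednK k_gt0) !addnS !addSn addn0 => -[].
  apply: (@le_trans _ _ 1).
    by apply: expRN_le1; rewrite mulr_ge0 // ltW.
  have q1 : 1 <= q by rewrite qE ler1n.
  by apply: le_trans q1 _; rewrite lerDr expR_ge0.
rewrite ler_wpM2l ?(ltW g_gt0) //; apply: lerD.
  rewrite /sg [leLHS]big_mkcond [X in _ <= X + _]big_mkcond [X in _ <= _ + X]big_mkcond.
  rewrite -big_split /=; apply: ler_sum => u _; rewrite inE.
  by case: (u \in e i); case: (u \in e j); rewrite /= ?addr0 ?add0r // lerDl irreg_ge0.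
rewrite ler_wpM2r // -natrX -natrX -natrM ler_nat.
rewrite -[4%N]/(2 ^ 2)%N -expnMn leq_sqr mul2n -addnn -cU; exact: leq_addr.
Qed.

Let T v : R := \sum_(i | v \in e i) w i * sg i.
Let d v := deg e w v.

(** Typical pairs of edges through [v] survive together with probability about exp(-g (2k - 1)), and
    c^2 exp(-g (2k - 1)) = exp(-g). Pairs sharing a further vertex are paid for by the codegree. *)
Lemma E_deg_sqr v :
  E (fun x => deg e (bite_weight x) v ^+ 2) <= expR (- g) * d v ^+ 2 +
     c ^+ 2 * (2 * g * K * T v + delta * (k%:R * K + 4 * k%:R ^+ 2 * g * K ^+ 2)).
Proof.
have EE : E (fun x => deg e (bite_weight x) v ^+ 2) =
    \sum_(i | v \in e i) \sum_(j | v \in e j)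
      c ^+ 2 * (w i * w j * expR (- (g * hit e w (e i :|: e j)))).
  rewrite (eq_Ex _ (g := fun x => \sum_(i | v \in e i) \sum_(j | v \in e j)
      c ^+ 2 * (w i * w j) * (missed x (e i :|: e j))%:R)); last first.
    move=> x; rewrite expr2 mulr_suml; apply: eq_bigr => i _.
    rewrite mulr_sumr; apply: eq_bigr => j _.
    rewrite missedU -mulnb natrM /bite_weight; ring.
  rewrite Ex_sum; apply: eq_bigr => i _; rewrite Ex_sum; apply: eq_bigr => j _.
  by rewrite ExZ E_missed !mulrA.
have sgE i j : v \in e i -> v \in e j ->
    w i * w j * expR (- (g * hit e w (e i :|: e j))) <=
    w i * w j * (expR (- (g * (k + k.-1)%:R)) +
      \sum_(u in e i | u != v) (u \in e j)%:R +
      g * (sg i + sg j + 4 * k%:R ^+ 2 * delta)).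
  move=> vi vj.
  case: (eqVneq (w i) 0) => [->|wi]; first by rewrite !mul0r.
  case: (eqVneq (w j) 0) => [->|wj]; first by rewrite !(mulr0, mul0r).
  by rewrite ler_wpM2l ?mulr_ge0 //; apply: expR_hit_pair.
have le1 : E (fun x => deg e (bite_weight x) v ^+ 2) <=
    c ^+ 2 * (expR (- (g * (k + k.-1)%:R)) * d v ^+ 2
      + \sum_(i | v \in e i) w i * \sum_(u in e i | u != v) codeg e w v u
      + g * (2 * d v * T v + 4 * k%:R ^+ 2 * delta * d v ^+ 2)).
  have -> : c ^+ 2 * (expR (- (g * (k + k.-1)%:R)) * d v ^+ 2
      + \sum_(i | v \in e i) w i * \sum_(u in e i | u != v) codeg e w v u
      + g * (2 * d v * T v + 4 * k%:R ^+ 2 * delta * d v ^+ 2)) =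
    \sum_(i | v \in e i) \sum_(j | v \in e j) c ^+ 2 * (w i * w j *
     (expR (- (g * (k + k.-1)%:R)) +
      \sum_(u in e i | u != v) (u \in e j)%:R +
      g * (sg i + sg j + 4 * k%:R ^+ 2 * delta))).
    transitivity (\sum_(i | v \in e i) c ^+ 2 *
       ((expR (- (g * (k + k.-1)%:R)) + g * (4 * k%:R ^+ 2 * delta) + g * sg i) * w i * d v
        + w i * \sum_(u in e i | u != v) codeg e w v u + g * w i * T v)).
      rewrite -mulr_sumr !big_split /=; congr (_ * _).
      rewrite -mulr_suml -[\sum_(i | v \in e i) g * w i * T v]mulr_suml -mulr_sumr -/(d v).
      have -> : \sum_(i | v \in e i) (expR (- (g * (k + k.-1)%:R)) +
          g * (4 * k%:R ^+ 2 * delta) + g * sg i) * w i =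
          (expR (- (g * (k + k.-1)%:R)) + g * (4 * k%:R ^+ 2 * delta)) * d v + g * T v.
        rewrite /d /deg /T !mulr_sumr -big_split /=; apply: eq_bigr => i _; ring.
      rewrite -[\sum_(i | v \in e i) w i]/(d v); ring.
    apply: eq_bigr => i vi; rewrite -mulr_sumr; congr (_ * _).
    have -> : \sum_(u in e i | u != v) codeg e w v u =
        \sum_(j | v \in e j) w j * \sum_(u in e i | u != v) (u \in e j)%:R.
      rewrite /codeg; under eq_bigr => u _ do rewrite big_mkcondr.
      rewrite exchange_big; apply: eq_bigr => j _; rewrite mulr_sumr.
      by apply: eq_bigr => u _; case: (u \in e j); rewrite ?mulr1 ?mulr0.
    move: (sg i) => sgi.
    rewrite /d /deg /T !mulr_sumr -!big_split /=; apply: eq_bigr => j _; ring.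
  rewrite EE; apply: ler_sum => i vi; apply: ler_sum => j vj.
  by rewrite ler_wpM2l ?sqr_ge0 // sgE.
apply: le_trans le1 _.
have cE : expR (- g) = c ^+ 2 * expR (- (g * (k + k.-1)%:R)).
  rewrite expr2 -!expRD; congr expR.
  have k1 : k%:R = 1 + k.-1%:R :> R by rewrite nat1r prednK.
  by rewrite natrD k1; ring.
have d0 : 0 <= d v := deg_ge0 e w_ge0 v.
have dK : d v <= K := deg_leK v.
have T0 : 0 <= T v.
  by apply: sumr_ge0 => i _; rewrite mulr_ge0 //; exact: sum_irreg_ge0.
have le2 : \sum_(i | v \in e i) w i * \sum_(u in e i | u != v) codeg e w v u <=
    delta * (k%:R * K).
  apply: (@le_trans _ _ (\sum_(i | v \in e i) w i * (delta * k%:R))).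
    apply: ler_sum => i vi.
    case: (eqVneq (w i) 0) => [->|/w_supp[eiA ei]]; first by rewrite !mul0r.
    rewrite ler_wpM2l // mulr_natr -ei -sumr_const big_mkcondr /=.
    by apply: ler_sum => u _; case: ifP => // /codeg_le; rewrite /codeg;
      under eq_bigl => i' do rewrite andbC.
  by rewrite -mulr_suml -/(d v) mulrC -mulrA ler_wpM2l // ler_wpM2l.
rewrite mulrDr mulrDr mulrA -cE -!addrA lerD2l -mulrDr ler_wpM2l ?sqr_ge0 //.
have le3 : d v * T v <= K * T v by rewrite ler_wpM2r.
have le4 : d v ^+ 2 <= K ^+ 2 by rewrite lerXn2r ?nnegrE.
have le5 := ler_wpM2l (ltW g_gt0) le3.
have gk : 0 <= 4 * k%:R ^+ 2 * g * delta by rewrite !mulr_ge0 ?sqr_ge0 // ltW.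
have le6 := ler_wpM2l gk le4.
move: le2 le5 le6; lra.
Qed.

(** The first moment carries the same factor as the second one: c exp(-g k) = exp(-g), the
    probability that a vertex of degree 1 survives. *)
Lemma E_deg_ge v : v \in A ->
  expR (- g) * d v - c * g * T v <= E (fun x => deg e (bite_weight x) v).
Proof.
move=> vA.
rewrite (eq_Ex _ (g := fun x => \sum_(i | v \in e i) c * w i * (missed x (e i))%:R)) //.
rewrite Ex_sum /d /deg /T mulr_sumr mulr_sumr -sumrB; apply: ler_sum => i vi.
rewrite ExZ E_missed.
case: (eqVneq (w i) 0) => [->|wi]; first by rewrite !(mulr0, mul0r) subr0.
have := expR_hit_ge (e i); rewrite (w_supp wi).2 => h.
have cE : expR (- g) = c * expR (- (g * k%:R)).
  by rewrite -expRD; congr expR; rewrite -(prednK k_gt0) /= -natr1; ring.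
have h2 := ler_wpM2l (mulr_ge0 c_ge0 (w_ge0 i)) h.
rewrite cE; move: h2; rewrite /sg; lra.
Qed.

Lemma sum_T : \sum_(v in A) T v <= k%:R * K * S.
Proof.
have -> : \sum_(v in A) T v = k%:R * \sum_i w i * sg i.
  rewrite /T; under eq_bigr => v _ do rewrite big_mkcond.
  rewrite exchange_big mulr_sumr; apply: eq_bigr => i _ /=.
  case: (eqVneq (w i) 0) => [wi|/w_supp[eiA ei]].
    by rewrite big1 ?wi ?mul0r ?mulr0 // => v _; case: ifP; rewrite ?mul0r.
  rewrite -big_mkcondr /= (eq_bigl (mem (e i))); last first.
    by move=> v; rewrite /= andbC; case: (boolP (v \in e i)) => // /(subsetP eiA) ->.
  by rewrite sumr_const ei mulr_natl.
rewrite -mulrA ler_wpM2l // /S mulr_sumr.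
have -> : \sum_i w i * sg i = \sum_(v in A) irreg v * d v.
  rewrite sum_deg; apply: eq_bigr => i _.
  case: (eqVneq (w i) 0) => [->|/w_supp[eiA _]]; first by rewrite !mul0r.
  by rewrite (setIidPl eiA).
apply: ler_sum => v _; rewrite mulrC; apply: ler_wpM2r => //; exact: irreg_ge0.
Qed.

Definition irreg_sqr (w' : I -> R) (A' : {set V}) : R :=
  \sum_(v in A') (deg e w' v - 1) ^+ 2.

(** A dead vertex has new degree 0, so the squared deviation over survivors is deg^2 - 2 deg +
    1_survives. Up to errors the three expectations are exp(-g) times d^2, -2 d and 1, which add up
    to exp(-g) (d - 1)^2: squared irregularity is not amplified. *)
Lemma E_irreg_sqr :
  E (fun x => irreg_sqr (bite_weight x) (survivors x)) <=
    irreg_sqr w A +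
    (2 * (expR k%:R ^+ 2 * K + expR k%:R) * (k%:R * K) + 1) * S +
    expR k%:R ^+ 2 * (k%:R * K + 4 * k%:R ^+ 2 * K ^+ 2) * (delta * #|A|%:R).
Proof.
(* A bound for [c] that is uniform in g <= 1. *)
set c0 := expR k%:R.
have cc0 : c <= c0.
  rewrite ler_expR; apply: (@le_trans _ _ (1 * k%:R)); last by rewrite mul1r.
  by apply: ler_pM; rewrite ?(ltW g_gt0) // ler_nat leq_pred.
have c00 : 0 <= c0 := expR_ge0 _.
have cc2 : c ^+ 2 <= c0 ^+ 2 by rewrite lerXn2r ?nnegrE.
rewrite (eq_Ex _ (g := fun x => \sum_(v in A) (deg e (bite_weight x) v ^+ 2
    - 2 * deg e (bite_weight x) v + (missed x [set v])%:R))); last first.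
  move=> x; rewrite /irreg_sqr big_mkcond [RHS]big_mkcond; apply: eq_bigr => v _ /=.
  rewrite inE; case: (v \in A) => //=; case: (boolP (missed x [set v])) => mv /=; first by ring.
  suff -> : deg e (bite_weight x) v = 0 by ring.
  rewrite /deg big1 // => i vi; rewrite /bite_weight.
  suff /negPf -> : ~~ missed x (e i) by rewrite mulr0.
  have eU : e i :|: [set v] = e i by apply/setUidPl; rewrite sub1set.
  by apply: contra mv; rewrite -eU missedU => /andP[].
rewrite Ex_sum.
have le1 v : v \in A ->
   E (fun x => deg e (bite_weight x) v ^+ 2
    - 2 * deg e (bite_weight x) v + (missed x [set v])%:R) <=
   (d v - 1) ^+ 2 + (2 * (c0 ^+ 2 * K + c0) * T v + irreg v
     + c0 ^+ 2 * (k%:R * K + 4 * k%:R ^+ 2 * K ^+ 2) * delta).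
  move=> vA; rewrite ExD ExB ExZ E_missed hit1.
  have h1 := E_deg_sqr v; have h2 := E_deg_ge vA.
  have h3 : expR (- (g * d v)) <= expR (- g) + g * irreg v.
    apply: expRN_shift; rewrite ?mulr_ge0 ?irreg_ge0 ?(ltW g_gt0) ?deg_ge0 //.
    have -> : g - g * irreg v = g * (1 - irreg v) by ring.
    rewrite ler_wpM2l ?(ltW g_gt0) // lerBlDl -lerBlDr.
    by rewrite /irreg distrC ler_norm.
  have T0 : 0 <= T v.
    by apply: sumr_ge0 => i _; rewrite mulr_ge0 //; exact: sum_irreg_ge0.
  have g0 := ltW g_gt0.
  have eg1 : expR (- g) <= 1 := expRN_le1 g0.
  have h4 : g * irreg v <= irreg v by rewrite ler_piMl // irreg_ge0.
  have h5 : c ^+ 2 * (2 * g * K * T v) <= 2 * (c0 ^+ 2 * K * T v).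
    have -> : c ^+ 2 * (2 * g * K * T v) = 2 * ((g * c ^+ 2) * (K * T v)) by ring.
    rewrite ler_wpM2l // -[leRHS]mulrA ler_wpM2r ?mulr_ge0 //.
    by apply: le_trans cc2; rewrite ler_piMl // sqr_ge0.
  have h6 : c * g * T v <= c0 * T v.
    by rewrite ler_wpM2r //; apply: le_trans cc0; rewrite ler_piMr.
  have h7 : c ^+ 2 * (delta * (k%:R * K + 4 * k%:R ^+ 2 * g * K ^+ 2)) <=
      c0 ^+ 2 * (k%:R * K + 4 * k%:R ^+ 2 * K ^+ 2) * delta.
    rewrite -[leRHS]mulrA [X in _ <= _ * X]mulrC; apply: ler_pM => //.
    - exact: sqr_ge0.
    - by rewrite mulr_ge0 // addr_ge0 ?mulr_ge0 ?sqr_ge0.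
    rewrite ler_wpM2l // lerD2l ler_wpM2r ?sqr_ge0 //.
    by rewrite ler_piMr // mulr_ge0 ?sqr_ge0.
  have h8 : expR (- g) * (d v - 1) ^+ 2 <= (d v - 1) ^+ 2.
    by rewrite ler_piMl ?sqr_ge0.
  rewrite -/(d v).
  move: h1 h2 h3 h4 h5 h6 h7 h8.
  have -> : expR (- g) * (d v - 1) ^+ 2 = expR (- g) * d v ^+ 2
     - 2 * (expR (- g) * d v) + expR (- g) by ring.
  rewrite [c ^+ 2 * (_ + _)]mulrDr.
  have -> : 2 * (c0 ^+ 2 * K + c0) * T v = 2 * (c0 ^+ 2 * K * T v) + 2 * (c0 * T v) by ring.
  lra.
apply: le_trans (ler_sum _ le1) _.
rewrite big_split /= -/(irreg_sqr w A) -addrA lerD2l !big_split /= -mulr_sumr -/S.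
rewrite sumr_const -mulr_natr.
have h := sum_T.
have f0 : 0 <= 2 * (c0 ^+ 2 * K + c0) by rewrite mulr_ge0 // addr_ge0 // mulr_ge0 ?sqr_ge0.
have := ler_wpM2l f0 h; lra.
Qed.

(* [z0] marks the edges chosen so far and [theta * w] bounds the probability that
   an available edge is chosen in the remaining rounds. *)
Lemma E_triples (B : {set I * I * I}) (z0 : I -> R) (theta : R) :
  (forall tr, tr \in B -> [/\ tr.1.1 != tr.1.2, tr.1.1 != tr.2 & tr.1.2 != tr.2]) ->
  (forall i, 0 <= z0 i) -> 0 <= theta ->
  E (fun x => triple_sum B (fun i =>
       z0 i + (i \in isolated x)%:R + theta * bite_weight x i)) <=
    triple_sum B (fun i => z0 i + (g + c * theta) * w i).
Proof.
move=> Bd z00 th0.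
pose z x i := z0 i + (i \in isolated x)%:R + theta * bite_weight x i.
pose z' i := z0 i + (g + c * theta) * w i.
change (E (fun x => triple_sum B (z x)) <= triple_sum B z').
rewrite /triple_sum.
rewrite Ex_sum; apply: ler_sum => -[[i j] l] /Bd /= [nij nil njl].
pose y m (b : bool) := z0 m + b%:R + theta * (c * w m).
have y0 m b : 0 <= y m b.
  by rewrite !addr_ge0 ?z00 // mulr_ge0 // mulr_ge0.
have z_ge0 x m : 0 <= z x m.
  by rewrite !addr_ge0 ?z00 // mulr_ge0 // bite_weight_ge0.
have zy x m : z x m <= y m (x m).
  rewrite /z /y; apply: lerD; last by rewrite ler_wpM2l ?bite_weight_le.
  by rewrite lerD2l ler_nat inE; case: (x m) => //=; exact: leq_b1.
have yE m : \sum_b bite_law m b * y m b <= z' m.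
  rewrite big_bool /y /z' /=.
  have := onesubexpRN_le (g * w m); lra.
have y_mean m : 0 <= \sum_b bite_law m b * y m b.
  by apply: sumr_ge0 => b _; rewrite mulr_ge0 ?bite_law_ge0.
pose Y m b := if (m == i) || (m == j) || (m == l) then y m b else 1.
apply: (@le_trans _ _ (E (fun x => \prod_m Y m (x m)))).
  apply: Ex_le => [|x]; first exact: bite_law_ge0.
  rewrite (bigD1 i) //= (bigD1 j) 1?eq_sym //= (bigD1 l) /=; last by rewrite !(eq_sym l) nil njl.
  rewrite big1 => [|m /andP[/andP[/negPf mi /negPf mj] /negPf ml]]; last by rewrite /Y mi mj ml.
  rewrite /Y !eqxx !orbT /= mulr1 mulrA.
  by apply: ler_pM; rewrite ?mulr_ge0 //; apply: ler_pM.
rewrite Ex_prod (bigD1 i) //= (bigD1 j) 1?eq_sym //= (bigD1 l) /=; last by rewrite !(eq_sym l) nil njl.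
rewrite [\prod_(m | _) _]big1 => [|m /andP[/andP[/negPf mi /negPf mj] /negPf ml]]; last first.
  rewrite /Y mi mj ml /=; under eq_bigr => b _ do rewrite mulr1.
  exact: bite_law_sum1.
rewrite /Y !eqxx !orbT /= mulr1 mulrA.
by apply: ler_pM; rewrite ?mulr_ge0 //; apply: ler_pM.
Qed.

End Step.

Ltac nonneg := repeat first [ assumption | exact: ler01 | exact: ler0n | exact: sqr_ge0
  | exact: expR_ge0 | exact: normr_ge0 | exact: ltW | apply: exprn_ge0 | apply: addr_ge0
  | apply: mulr_ge0 ].

(** * Iterating the rounds *)

Section Nibble.
Variable R : realType.

(** The recursion is that of [E_triples]: an edge is chosen now with probability at most g w, or
    later, with its weight increased by a factor of at most c. *)
Fixpoint nibble_scale (g c : R) (s : nat) : R :=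
  if s is s'.+1 then g + c * nibble_scale g c s' else 0.

Definition packing (V I : finType) (e : I -> {set V}) (w : I -> R)
    (A : {set V}) (M : {set I}) : Prop :=
  (forall i, i \in M -> 0 < w i /\ e i \subset A) /\
  (forall i j, i \in M -> j \in M -> i != j -> [disjoint e i & e j]).

Definition spread_triples (I : finType) (B : {set I * I * I}) : Prop :=
  forall tr, tr \in B ->
    [/\ tr.1.1 != tr.1.2, tr.1.1 != tr.2 & tr.1.2 != tr.2].

Lemma nibble_scale_ge0 g c s : 0 <= g -> 0 <= c -> 0 <= nibble_scale g c s.
Proof. by move=> g0 c0; elim: s => //= s IH; rewrite addr_ge0 // mulr_ge0. Qed.

(** The isolated edges are disjoint from every edge that lives on the survivors, because survivors
    are missed by all proposed edges. An edge of weight 0 is proposed with probability 0, so [xpos]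
    gives the kept edges positive weight. *)
Lemma packing_step (V I : finType) (e : I -> {set V}) (w : I -> R)
    (A : {set V}) (k : nat) (g : R) (x : {ffun I -> bool}) (M' : {set I}) :
  (0 < k)%N -> (forall i, 0 <= w i) ->
  (forall i, w i != 0 -> e i \subset A /\ #|e i| = k) ->
  (forall i, 0 < bite_law w g i (x i)) ->
  packing e (bite_weight e w k g x) (survivors e A x) M' ->
  packing e w A (isolated e x :|: M') /\ [disjoint isolated e x & M'].
Proof.
move=> k0 w0 ws xpos [M'A M'd].
have isoP i : i \in isolated e x -> [/\ x i, 0 < w i & e i \subset A].
  rewrite inE => /andP[xi _]; move: (xpos i); rewrite xi /= => pi.
  have wi : w i != 0.
    by apply/eqP => wi; move: pi; rewrite wi mulr0 oppr0 expR0 subrr ltxx.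
  by split=> //; [rewrite lt_def wi w0|have [] := ws _ wi].
have M'P i : i \in M' -> [/\ missed e x (e i), 0 < w i & e i \subset A].
  move=> /M'A[pi]; rewrite sub_survivors => /andP[iA mi]; split=> //.
  rewrite lt_def w0 andbT; apply/eqP => wi.
  by move: pi; rewrite /bite_weight wi mulr0 mul0r ltxx.
have dIM i j : i \in isolated e x -> j \in M' -> [disjoint e i & e j].
  move=> /isoP[xi _ _] /M'P[/forallP/(_ i)]; rewrite xi implybF negbK.
  by [].
split; last first.
  rewrite -setI_eq0; apply/eqP/setP => i; rewrite in_setI in_set0.
  apply/negP => /andP[iI iM]; have := dIM _ _ iI iM.
  rewrite -setI_eq0 setIid -cards_eq0.
  have [_ wi _] := isoP _ iI.
  by have [_ ->] := ws i (lt0r_neq0 wi); rewrite eqn0Ngt k0.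
split=> [i|i j].
  by rewrite inE => /orP[/isoP[]|/M'P[]].
rewrite !in_setU => /orP[iI|iM] /orP[jI|jM] nij.
- have [xi _ _] := isoP _ iI; move: jI; rewrite inE => /andP[_ /forallP/(_ i)].
  by rewrite nij xi /= implybF negbK.
- exact: dIM.
- by rewrite disjoint_sym; apply: dIM.
- exact: M'd.
Qed.

(** Induction on the number of rounds, with [z0] recording earlier choices. Weights grow by at most
    c per round, so bounding c^s times the initial degrees keeps all later degrees below K. The
    constant [b] is fixed before the hypergraph is given. Uncovered vertices and triples are summed
    into one quantity so that a single averaging controls both. *)
Lemma nibble_rounds (k : nat) (g K : R) (s : nat) :
  (0 < k)%N -> 0 < g -> g <= 1 -> 0 <= K ->
  let c := expR (g * k.-1%:R) in
  exists2 b : R, 0 <= b &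
  forall (V I : finType) (e : I -> {set V}) (w : I -> R) (A : {set V})
    (z0 : I -> R) (B : {set I * I * I}) (delta : R),
  (forall i, 0 <= w i) ->
  (forall i, w i != 0 -> e i \subset A /\ #|e i| = k) ->
  (forall v, c ^+ s * deg e w v <= K) ->
  (forall u v, u != v -> c ^+ s * codeg e w u v <= delta) -> 0 <= delta ->
  spread_triples B -> (forall i, 0 <= z0 i) ->
  exists2 M : {set I}, packing e w A M &
    #|A|%:R - k%:R * #|M|%:R + triple_sum B (fun i => z0 i + (i \in M)%:R) <=
    (expR (- (g * s%:R)) + s%:R * (g ^+ 2 * (k%:R * K ^+ 2 + 1))) * #|A|%:R
    + b * (irreg_sqr e w A + delta * #|A|%:R)
    + triple_sum B (fun i => z0 i + nibble_scale g c s * w i).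
Proof.
move=> k0 g0 g1 K0 c.
have c1 : 1 <= c by rewrite -expR0 ler_expR mulr_ge0 // ltW.
have c0 : 0 <= c := le_trans ler01 c1.
elim: s => [|s [b b0 IH]].
  exists 0 => // V I e w A z0 B delta w0 ws _ _ _ _ _; exists set0.
    by split=> [i|i j]; rewrite inE.
  rewrite cards0 !mulr0 subr0 oppr0 expR0 !mul0r !addr0 mul1r lerD2l.
  apply: ler_sum => tr _; rewrite /= !inE !mul0r !addr0. by [].
(* The summand 1 pays for the g^2 |A| lost below when linear irregularity is replaced by its
   square. *)
set q : R := k%:R * K ^+ 2 + 1.
set C1 := 2 * (expR k%:R ^+ 2 * K + expR k%:R) * (k%:R * K) + 1.
set C2 := expR k%:R ^+ 2 * (k%:R * K + 4 * k%:R ^+ 2 * K ^+ 2).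
have C10 : 0 <= C1 by rewrite /C1; nonneg.
have C20 : 0 <= C2 by rewrite /C2; nonneg.
set a := g + b * C1.
have a0 : 0 < a by rewrite ltr_pwDl // mulr_ge0.
(* For y >= 0 one has a y <= (a / eta) y^2 + a eta; this [eta] makes the last term the affordable
   g^2. *)
have [eta eta0 etaE] : exists2 eta, 0 < eta & g ^+ 2 = a * eta.
  exists (g ^+ 2 / a); first by rewrite divr_gt0 // exprn_gt0.
  by rewrite mulrC divfK // gt_eqF.
exists (b * (1 + C2) + a / eta).
  by apply: addr_ge0; [nonneg|apply: divr_ge0; exact: ltW].
move=> V I e w A z0 B delta w0 ws dK cd d0 Bs z00.
have dK' v : deg e w v <= K.
  apply: le_trans (dK v); apply: ler_peMl; [exact: deg_ge0|exact: exprn_ege1].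
have cd' u v : u != v -> codeg e w u v <= delta.
  move=> uv; apply: le_trans (cd u v uv).
  apply: ler_peMl; [exact: codeg_ge0|exact: exprn_ege1].
set Sg := \sum_(v in A) irreg e w v.
have Sle : a * Sg <= a / eta * irreg_sqr e w A + g ^+ 2 * #|A|%:R.
  rewrite etaE /irreg_sqr -!mulrA -mulrDr ler_wpM2l ?(ltW a0) //.
  rewrite mulr_natr -sumr_const mulr_sumr -big_split; apply: ler_sum => v _ /=.
  rewrite /irreg -[(_ - 1) ^+ 2]real_normK ?num_real //; move: `|_ - 1| => y.
  rewrite -subr_ge0.
  have -> : eta^-1 * y ^+ 2 + eta - y = eta^-1 * ((y - eta / 2) ^+ 2 + 3 / 4 * eta ^+ 2).
    by field; rewrite gt_eqF.
  apply: mulr_ge0; first by rewrite invr_ge0 ltW.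
  by have := sqr_ge0 (y - eta / 2); have := sqr_ge0 eta; lra.
set th := nibble_scale g c s.
have th0 : 0 <= th by apply: nibble_scale_ge0 => //; exact: ltW.
(* The waste of this round plus the bound that induction will give for the remaining [s] rounds,
   with |A| in place of the number of survivors in its error terms. *)
pose f x := (#|A|%:R - #|survivors e A x|%:R - k%:R * #|isolated e x|%:R)
  + expR (- (g * s%:R)) * #|survivors e A x|%:R
  + (s%:R * (g ^+ 2 * q) * #|A|%:R + b * delta * #|A|%:R)
  + b * irreg_sqr e (bite_weight e w k g x) (survivors e A x)
  + triple_sum B (fun i => z0 i + (i \in isolated e x)%:R + th * bite_weight e w k g x i).
have Ef : Ex (bite_law w g) f <=
    (expR (- (g * s.+1%:R)) + s.+1%:R * (g ^+ 2 * q)) * #|A|%:R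
    + (b * (1 + C2) + a / eta) * (irreg_sqr e w A + delta * #|A|%:R)
    + triple_sum B (fun i => z0 i + nibble_scale g c s.+1 * w i).
  have cstE y : Ex (bite_law w g) (fun=> y) = y by apply: Ex_cst => i; exact: bite_law_sum1.
  rewrite /f !ExD !ExZ !cstE.
  have h1 := E_waste w0 ws k0 dK' g0 K0; rewrite !ExD !cstE in h1.
  have h2 := E_survivors e A w0 g0.
  have h3 := E_irreg_sqr w0 ws k0 dK' cd' d0 g0 g1 K0.
  have h4 := E_triples e k w0 g0 Bs z00 th0.
  rewrite -/Sg in h2 h3; rewrite -/q -/C1 -/C2 in h1 h3.
  move: h4; rewrite -/c -/th -[nibble_scale g c s.+1]/(g + c * th) => h4.
  set Es := expR (- (g * s%:R)) in h2 *.
  have Es0 : 0 <= Es := expR_ge0 _.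
  have Es1 : Es <= 1 by apply: expRN_le1; rewrite mulr_ge0 // ltW.
  have -> : expR (- (g * s.+1%:R)) = Es * expR (- g).
    by rewrite -expRD -natr1; congr expR; ring.
  have Sg0 : 0 <= Sg by apply: sumr_ge0 => v _; exact: normr_ge0.
  have h2' := ler_wpM2l Es0 h2.
  have h3' := ler_wpM2l b0 h3.
  have h5 : Es * (g * Sg) <= g * Sg by rewrite ler_piMl // mulr_ge0 // ltW.
  have h6 : 0 <= a / eta * (delta * #|A|%:R).
    by apply: mulr_ge0; [apply: divr_ge0; exact: ltW|exact: mulr_ge0].
  have h7 : 0 <= b * C2 * irreg_sqr e w A.
    by apply: mulr_ge0; [exact: mulr_ge0|apply: sumr_ge0 => v _; exact: sqr_ge0].
  have h1' : g ^+ 2 * (k%:R * K ^+ 2) * #|A|%:R = g ^+ 2 * q * #|A|%:R - g ^+ 2 * #|A|%:R.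
    by rewrite /q; ring.
  rewrite h1' in h1.
  have aS : a * Sg = g * Sg + b * C1 * Sg by rewrite /a mulrDl.
  rewrite aS in Sle; rewrite -natr1.
  move: (a / eta) h6 Sle => ae h6 Sle.
  move: h1 h2' h3' h4 h5 h6 h7 Sle; lra.
have [x fx xpos] := Ex_exists (bite_law_ge0 w0 g0) (bite_law_sum1 w g) Ef.
have [|||||||M' pM' bM'] := IH V I e (bite_weight e w k g x) (survivors e A x)
  (fun i => z0 i + (i \in isolated e x)%:R) B delta.
- by move=> i; exact: bite_weight_ge0.
- move=> i; exact: bite_weight_supp.
- move=> v; apply: le_trans (dK v); rewrite exprSr -mulrA ler_wpM2l ?exprn_ge0 //.
  exact: bite_deg_le.
- move=> u v uv; apply: le_trans (cd u v uv); rewrite exprSr -mulrA ler_wpM2l ?exprn_ge0 //.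
  exact: bite_codeg_le.
- by [].
- by [].
- by move=> i; rewrite addr_ge0.
have [pM dM] := packing_step k0 w0 ws xpos pM'.
exists (isolated e x :|: M') => //; apply: le_trans fx.
have dIM0 i : (i \in isolated e x) && (i \in M') = false.
  by apply/negbTE/negP => /andP[iI iM]; move/pred0P/(_ i): dM; rewrite /= iI iM.
have -> : #|isolated e x :|: M'| = (#|isolated e x| + #|M'|)%N.
  by apply/eqP; rewrite (leq_card_setU _ _).2.
have -> : triple_sum B (fun i => z0 i + (i \in isolated e x :|: M')%:R) =
   triple_sum B (fun i => z0 i + (i \in isolated e x)%:R + (i \in M')%:R).
  have ind i : z0 i + (i \in isolated e x :|: M')%:R =
      z0 i + (i \in isolated e x)%:R + (i \in M')%:R.
    rewrite inE -addrA -natrD; congr (_ + _%:R); move: (dIM0 i).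
    by case: (i \in isolated e x); case: (i \in M').
  by apply: eq_bigr => tr _; rewrite !ind.
move: bM'; rewrite -/q -/th /f natrD.
have sA : #|survivors e A x|%:R <= #|A|%:R :> R.
  by rewrite ler_nat subset_leq_card //; apply/subsetP => v; rewrite inE => /andP[].
have h1 : s%:R * (g ^+ 2 * q) * #|survivors e A x|%:R <= s%:R * (g ^+ 2 * q) * #|A|%:R.
  by rewrite ler_wpM2l // /q; nonneg.
have h2 : b * delta * #|survivors e A x|%:R <= b * delta * #|A|%:R.
  by rewrite ler_wpM2l // mulr_ge0.
move: h1 h2; rewrite -/c; lra.
Qed.

End Nibble.

(** * Choice of the nibble parameters *)

Section NibbleTheorem.
Variable R : realType.

Lemma nibble_scale_le (g c : R) (s : nat) : 0 <= g -> 1 <= c ->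
  nibble_scale g c s <= s%:R * g * c ^+ s.
Proof.
move=> g0 c1; have c0 : 0 <= c := le_trans ler01 c1.
elim: s => [|s IH] /=; first by rewrite !mul0r.
have h1 := ler_wpM2l c0 IH.
have h2 : g <= g * c ^+ s.+1 by rewrite ler_peMr // exprn_ege1.
have h3 : c ^+ s.+1 = c * c ^+ s := exprS _ _.
rewrite -natr1; rewrite h3 in h2 *; move: h1 h2; lra.
Qed.

Definition nibble_guarantee (k : nat) (eps K b Theta : R) : Prop :=
  forall (V I : finType) (e : I -> {set V}) (w : I -> R) (A : {set V})
    (B : {set I * I * I}) (delta : R),
  (forall i, 0 <= w i) ->
  (forall i, w i != 0 -> e i \subset A /\ #|e i| = k) ->
  (forall v, deg e w v <= K) ->
  (forall u v, u != v -> codeg e w u v <= delta) -> 0 <= delta ->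
  spread_triples B ->
  exists2 M : {set I}, packing e w A M &
    #|A|%:R - k%:R * #|M|%:R + triple_sum B (fun i => (i \in M)%:R) <=
    eps * #|A|%:R + b * (irreg_sqr e w A + delta * #|A|%:R)
    + Theta * triple_sum B w.

(** The order of quantifiers is essential: [Theta] is fixed before the degree bound [K]. In the
    application [K] grows with the number d of label systems, and d has to be chosen in terms of
    [Theta]. *)
Theorem nibble (k : nat) (eps : R) : (0 < k)%N -> 0 < eps ->
  exists2 Theta : R, 0 <= Theta & forall K : R, 0 <= K ->
  exists2 b : R, 0 <= b & nibble_guarantee k eps K b Theta.
Proof.
move=> k0 eps0.
(* The total time g s of the process: a fraction of about exp(-T) <= eps / 2 of the vertices stays
   uncovered at the end. *)
set T := Num.bound (2 / eps).
have Teps : 2 / eps < T%:R.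
  by apply: (archi_boundP (divr_ge0 _ _)) => //; exact: ltW.
have T0 : (0 : R) < T%:R by apply: lt_trans Teps; rewrite divr_gt0.
have eT : expR (- T%:R) <= eps / 2.
  have h := expR_ge1Dx (T%:R : R).
  rewrite expRN -[leRHS]invf_div lef_pV2 ?posrE ?expR_gt0 ?divr_gt0 //.
  by move: h Teps; lra.
set cs := expR (T%:R * k.-1%:R : R).
have cs1 : 1 <= cs by rewrite -expR0 ler_expR mulr_ge0.
have cs0 : 0 <= cs := le_trans ler01 cs1.
exists ((T%:R * cs) ^+ 3); first by rewrite exprn_ge0 // mulr_ge0 // ltW.
move=> K K0.
set q : R := k%:R * (cs * K) ^+ 2 + 1.
have q0 : 0 <= q by rewrite /q; nonneg.
(* With g = 1 / Q and s = T Q the accumulated waste s g^2 q equals T q / Q, at most eps / 2. *)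
set Q := (Num.bound (2 * T%:R * q / eps)).+1.
have Qeps : T%:R * Q%:R^-1 * q <= eps / 2.
  have : 2 * T%:R * q / eps < Q%:R.
    apply: (@lt_trans _ _ (Num.bound (2 * T%:R * q / eps))%:R); last by rewrite ltr_nat.
    apply: archi_boundP; apply: divr_ge0; last exact: ltW.
    by apply: mulr_ge0 => //; apply: mulr_ge0.
  rewrite ltr_pdivrMr // => h.
  rewrite mulrAC ler_pdivrMr //; move: h; lra.
pose g : R := Q%:R^-1; pose s := (T * Q)%N.
have g0 : 0 < g by rewrite invr_gt0 ltr0n.
have g1 : g <= 1 by rewrite invf_le1 ?ltr0n // ler1n.
have gs : g * s%:R = T%:R by rewrite /g /s natrM mulrCA mulVf ?mulr1 // pnatr_eq0.
(* The total growth of weights depends on the time T only, not on the step size; hence [Theta] could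
   be fixed before [K]. *)
have csE : expR (g * k.-1%:R) ^+ s = cs.
  by rewrite -expRM_natr /cs -gs; congr expR; ring.
have c1 : 1 <= expR (g * k.-1%:R).
  by rewrite -[leLHS]expR0 ler_expR; apply: mulr_ge0; [exact: ltW|exact: ler0n].
have [b b0 nib] := nibble_rounds s k0 g0 g1 (mulr_ge0 cs0 K0).
exists (b * cs); first exact: mulr_ge0.
move=> V I e w A B delta w0 ws dK cd d0 Bs.
have [|||M pM bM] := nib V I e w A (fun=> 0) B (cs * delta) w0 ws _ _ (mulr_ge0 cs0 d0) Bs.
- by move=> v; rewrite csE ler_wpM2l.
- by move=> u v uv; rewrite csE ler_wpM2l // cd.
- by [].
exists M => //.
have th := nibble_scale_le s (ltW g0) c1.
rewrite csE [s%:R * g]mulrC gs in th.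
have th0 : 0 <= nibble_scale g (expR (g * k.-1%:R)) s.
  by apply: nibble_scale_ge0; [exact: ltW|exact: expR_ge0].
have le3 : triple_sum B (fun i => 0 + nibble_scale g (expR (g * k.-1%:R)) s * w i) <=
    (T%:R * cs) ^+ 3 * triple_sum B w.
  rewrite /triple_sum mulr_sumr; apply: ler_sum => tr _; rewrite !add0r.
  set th' := nibble_scale _ _ _ in th th0 *.
  have -> : th' * w tr.1.1 * (th' * w tr.1.2) * (th' * w tr.2) =
    th' ^+ 3 * (w tr.1.1 * w tr.1.2 * w tr.2) by ring.
  apply: ler_wpM2r; first by rewrite !mulr_ge0.
  by rewrite lerXn2r // nnegrE // mulr_ge0 // ltW.
have le1 : (expR (- (g * s%:R)) + s%:R * (g ^+ 2 * q)) * #|A|%:R <= eps * #|A|%:R.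
  rewrite ler_wpM2r // gs.
  have -> : s%:R * (g ^+ 2 * q) = T%:R * g * q by rewrite -gs; ring.
  by move: eT Qeps; rewrite -/g; lra.
have irr0 : 0 <= irreg_sqr e w A by apply: sumr_ge0 => v _; exact: sqr_ge0.
have le2 : b * (irreg_sqr e w A + cs * delta * #|A|%:R) <=
    b * cs * (irreg_sqr e w A + delta * #|A|%:R).
  by rewrite -[leRHS]mulrA ler_wpM2l // mulrDr mulrA lerD2r ler_peMl.
have -> : triple_sum B (fun i => (i \in M)%:R : R) =
    triple_sum B (fun i => 0 + (i \in M)%:R).
  by apply: eq_bigr => tr _; rewrite !add0r.
move: bM; rewrite -/q; move: le1 le2 le3; lra.
Qed.

End NibbleTheorem.

(** * Tilted weights from random vertex labels *)

Section UniformLabels.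
Variables (R : realFieldType) (U X : finType).
Hypothesis X_gt0 : (0 < #|X|)%N.

Definition unif (J : finType) : J -> X -> R := fun _ _ => #|X|%:R^-1.

Lemma unif_ge0 (J : finType) (j : J) a : 0 <= unif j a.
Proof. by rewrite invr_ge0. Qed.

Lemma unif_sum1 (J : finType) (j : J) : \sum_a unif j a = 1.
Proof.
by rewrite /unif sumr_const -[LHS]mulr_natr mulVf // pnatr_eq0 -lt0n.
Qed.

Local Notation E := (Ex (@unif U)).

Definition localized (D : {set U}) (F : {ffun U -> X} -> R) : Prop :=
  forall x y : {ffun U -> X}, {in D, x =1 y} -> F x = F y.

Lemma localizedS (D D' : {set U}) F :
  D \subset D' -> localized D F -> localized D' F.
Proof. by move=> /subsetP DD' lF x y xy; apply: lF => v /DD'; apply: xy. Qed.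

Lemma localizedM (D : {set U}) F G : localized D F -> localized D G ->
  localized D (fun x => F x * G x).
Proof. by move=> lF lG x y xy; rewrite (lF x y) // (lG x y). Qed.

Lemma localized_cst (D : {set U}) a : localized D (fun=> a).
Proof. by []. Qed.

(* Resampling the label of [v]: the pairs (x, l) and (x[v := l], x v) are
   exchanged by an involution. *)
Lemma E_resample (v : U) (h : X -> R) (D : {set U}) G :
  v \notin D -> localized D G -> \sum_a h a = 0 ->
  E (fun x => h (x v) * G x) = 0.
Proof.
move=> vD lG h0.
pose upd (x : {ffun U -> X}) a := [ffun u => if u == v then a else x u].
have GE x a : G (upd x a) = G x.
  by apply: lG => u uD; rewrite ffunE; case: eqP => // uv; rewrite -uv uD in vD.
suff S0 : \sum_(x : {ffun U -> X}) h (x v) * G x = 0.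
  rewrite /Ex /unif.
  by rewrite -mulr_sumr S0 mulr0.
have : \sum_(p : {ffun U -> X} * X) h (p.1 v) * G p.1 = 0.
  pose tau (p : {ffun U -> X} * X) := (upd p.1 p.2, p.1 v).
  have tauK : involutive tau.
    move=> [x a]; rewrite /tau /= ffunE eqxx; congr pair.
    by apply/ffunP => u; rewrite !ffunE; case: eqP => // ->.
  rewrite (reindex_inj (inv_inj tauK)) /=.
  under eq_bigr => p _ do rewrite ffunE eqxx GE.
  rewrite -(pair_big xpredT xpredT (fun (x : {ffun U -> X}) a => h a * G x)) /=.
  by rewrite big1 // => x _; rewrite -mulr_suml h0 mul0r.
rewrite -(pair_big xpredT xpredT (fun (x : {ffun U -> X}) (a : X) => h (x v) * G x)) /=.
under eq_bigr => x _ do rewrite sumr_const.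
rewrite sumrMnl => /eqP; rewrite mulrn_eq0.
by rewrite eqn0Ngt X_gt0 => /eqP.
Qed.

End UniformLabels.

(** * Spike labels and the tilt of an edge *)

Section Gadget.
Variables (R : realFieldType) (U : finType) (L t : nat).
Local Notation X := 'I_L.+3.
Local Notation E := (Ex (@unif R X U)).

(** Under a uniform label this is a skewed variable of mean 0: one rare large value against many
    values -1. Its second and third moments are at least 1. *)
Definition spike (a : X) : R := if a == ord0 then L.+2%:R else - 1.

Lemma spike_moment (m : nat) :
  \sum_a spike a ^+ m = L.+2%:R ^+ m + (- 1) ^+ m *+ L.+2.
Proof.
rewrite (bigD1 ord0) //= /spike eqxx; congr (_ + _).
rewrite (eq_bigr (fun=> (- 1) ^+ m)); last by move=> a /negPf ->.
by rewrite sumr_const cardC1 card_ord.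
Qed.

Lemma spike_mean : \sum_a spike a = 0.
Proof.
under eq_bigr => a _ do rewrite -[spike a]expr1.
by rewrite spike_moment !expr1 mulNrn subrr.
Qed.

Lemma spike_moment_ge0 (m : nat) : (m <= 3)%N -> 0 <= \sum_a L.+3%:R^-1 * spike a ^+ m.
Proof.
move=> m3; rewrite -mulr_sumr mulr_ge0 ?invr_ge0 // spike_moment.
have := ler0n R L.
case: m m3 => [|[|[|[|//]]]] _ h; rewrite -mulr_natr ?expr0 ?expr1 -!natr1; nra.
Qed.

Lemma spike_moment_ge1 (m : nat) : (m <= 3)%N -> m != 1 ->
  1 <= \sum_a L.+3%:R^-1 * spike a ^+ m.
Proof.
move=> m3 m1; rewrite -mulr_sumr mulrC ler_pdivlMr ?ltr0n // mul1r spike_moment.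
have := ler0n R L.
case: m m3 m1 => [|[|[|[|//]]]] // _ _ h; rewrite -mulr_natr ?expr0 -!natr1; nra.
Qed.

Definition phi (e : {set U}) (x : {ffun U -> X}) : R :=
  \sum_(S : {set U} | (S \subset e) && (t < #|S|)%N) \prod_(v in S) spike (x v).

Lemma localized_prod (S : {set U}) :
  localized S (fun x => \prod_(v in S) spike (x v)).
Proof. by move=> x y xy; apply: eq_bigr => v /xy ->. Qed.

Lemma localized_phi (e : {set U}) : localized e (phi e).
Proof.
move=> x y xy; apply: eq_bigr => S /andP[Se _].
by apply: localized_prod => v /(subsetP Se); apply: xy.
Qed.

(** A set S in the sum has more than t elements, so some v in S lies outside [D]. Its spike has mean
    0 and is independent of all other factors. *)
Lemma E_phi0 (e D : {set U}) F : localized D F -> (#|e :&: D| <= t)%N ->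
  E (fun x => phi e x * F x) = 0.
Proof.
move=> lF eD.
rewrite (eq_Ex _ (g := fun x => \sum_(S : {set U} | (S \subset e) && (t < #|S|)%N)
    (\prod_(v in S) spike (x v)) * F x)); last by move=> x; rewrite mulr_suml.
rewrite Ex_sum big1 // => S /andP[Se tS].
have /subsetPn[v vS vD] : ~~ (S \subset D).
  apply/negP => SD; have : (#|S| <= #|e :&: D|)%N by apply: subset_leq_card; rewrite subsetI Se.
  by rewrite leqNgt (leq_ltn_trans eD tS).
rewrite (eq_Ex _ (g := fun x => spike (x v) * ((\prod_(u in S :\ v) spike (x u)) * F x))).
  apply: (@E_resample R U X _ v spike ((S :\ v) :|: D)); rewrite ?card_ord //.
  - by rewrite !inE eqxx.
  - apply: localizedM; first exact: localizedS (subsetUl _ _) (@localized_prod _).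
    exact: localizedS (subsetUr _ _) lF.
  - exact: spike_mean.
move=> x; rewrite (bigD1 v) //= -mulrA; congr (_ * (_ * _)).
by apply: eq_bigl => u; rewrite !inE andbC.
Qed.

(** After expansion, each triple of sets S1, S2, S3 contributes a product of moments of order at
    most 3, hence a nonnegative number. Taking for S_i the part of g_i covered by the other two
    edges, no vertex has multiplicity 1, so this single triple already contributes at least 1. *)
Lemma E_phi3 (g1 g2 g3 : {set U}) :
  (t < #|g1 :&: (g2 :|: g3)|)%N -> (t < #|g2 :&: (g1 :|: g3)|)%N ->
  (t < #|g3 :&: (g1 :|: g2)|)%N ->
  1 <= E (fun x => phi g1 x * phi g2 x * phi g3 x).
Proof.
move=> h1 h2 h3.
pose mult (S1 S2 S3 : {set U}) (v : U) : nat := ((v \in S1) + (v \in S2) + (v \in S3))%N.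
have term (S1 S2 S3 : {set U}) : E (fun x => (\prod_(v in S1) spike (x v)) *
    (\prod_(v in S2) spike (x v)) * (\prod_(v in S3) spike (x v))) =
    \prod_v \sum_a L.+3%:R^-1 * spike a ^+ mult S1 S2 S3 v.
  rewrite (eq_Ex _ (g := fun x : {ffun U -> X} => \prod_v spike (x v) ^+ mult S1 S2 S3 v)).
    rewrite (Ex_prod _ (fun v a => spike a ^+ mult S1 S2 S3 v)).
    by apply: eq_bigr => v _; apply: eq_bigr => a _; rewrite /unif card_ord.
  move=> x; rewrite [X in X * _ * _]big_mkcond [X in _ * X * _]big_mkcond [X in _ * X]big_mkcond.
  rewrite -!big_split /=; apply: eq_bigr => v _.
  by rewrite /mult !exprD; case: (v \in S1); case: (v \in S2); case: (v \in S3).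
have mult3 (S1 S2 S3 : {set U}) v : (mult S1 S2 S3 v <= 3)%N.
  by rewrite /mult; case: (v \in S1); case: (v \in S2); case: (v \in S3).
have term0 (S1 S2 S3 : {set U}) : 0 <= \prod_v \sum_a L.+3%:R^-1 * spike a ^+ mult S1 S2 S3 v.
  by apply: prodr_ge0 => v _; apply: spike_moment_ge0.
set S1 := g1 :&: (g2 :|: g3); set S2 := g2 :&: (g1 :|: g3); set S3 := g3 :&: (g1 :|: g2).
apply: (@le_trans _ _ (\prod_v \sum_a L.+3%:R^-1 * spike a ^+ mult S1 S2 S3 v)).
  apply: (@le_trans _ _ (\prod_(v : U) 1)); first by rewrite big1.
  apply: ler_prod => v _; rewrite ler01 /=; apply: spike_moment_ge1 => //.
  rewrite /mult !inE.
  by case: (v \in g1); case: (v \in g2); case: (v \in g3).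
rewrite (eq_Ex _ (g := fun x =>
   \sum_(S1 : {set U} | (S1 \subset g1) && (t < #|S1|)%N)
   \sum_(S2 : {set U} | (S2 \subset g2) && (t < #|S2|)%N)
   \sum_(S3 : {set U} | (S3 \subset g3) && (t < #|S3|)%N)
   (\prod_(v in S1) spike (x v)) * (\prod_(v in S2) spike (x v)) *
   (\prod_(v in S3) spike (x v)))); last first.
  move=> x; rewrite /phi !mulr_suml; apply: eq_bigr => T1 _.
  rewrite [X in X * _]mulr_sumr mulr_suml; apply: eq_bigr => T2 _.
  by rewrite mulr_sumr.
rewrite Ex_sum (bigD1 S1) ?subsetIl //= ler_wpDr //.
  apply: sumr_ge0 => T1 _; rewrite Ex_sum; apply: sumr_ge0 => T2 _.
  by rewrite Ex_sum; apply: sumr_ge0 => T3 _; rewrite term.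
rewrite Ex_sum (bigD1 S2) ?subsetIl //= ler_wpDr //.
  apply: sumr_ge0 => T2 _.
  by rewrite Ex_sum; apply: sumr_ge0 => T3 _; rewrite term.
rewrite Ex_sum (bigD1 S3) ?subsetIl //= ler_wpDr //.
  by apply: sumr_ge0 => T3 _; rewrite term.
by rewrite term.
Qed.

Variable eps : R.
Hypothesis eps_ge0 : 0 <= eps.

Definition tilt (e : {set U}) (x : {ffun U -> X}) : R := 1 - eps * phi e x.

Lemma localized_tilt (e : {set U}) : localized e (tilt e).
Proof. by move=> x y xy; rewrite /tilt (localized_phi xy). Qed.

(** An edge meeting everything else in at most t vertices integrates out. All later computations
    with tilts reduce to repeated use of this. *)
Lemma E_peel (e D : {set U}) F : localized D F -> (#|e :&: D| <= t)%N ->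
  E (fun x => tilt e x * F x) = E F.
Proof.
move=> lF eD.
rewrite (eq_Ex _ (g := fun x => F x - eps * (phi e x * F x))).
  by rewrite ExB ExZ (E_phi0 lF eD) mulr0 subr0.
by move=> x; rewrite /tilt; ring.
Qed.

Lemma E_tilt3 (g1 g2 g3 : {set U}) :
  (#|g1 :&: g2| <= t)%N -> (#|g1 :&: g3| <= t)%N -> (#|g2 :&: g3| <= t)%N ->
  (t < #|g1 :&: (g2 :|: g3)|)%N -> (t < #|g2 :&: (g1 :|: g3)|)%N ->
  (t < #|g3 :&: (g1 :|: g2)|)%N ->
  E (fun x => tilt g1 x * tilt g2 x * tilt g3 x) <= 1 - eps ^+ 3.
Proof.
move=> i12 i13 i23 h1 h2 h3.
have one g : E (phi g) = 0.
  rewrite (eq_Ex _ (g := fun x => phi g x * 1)) => [|x]; last by rewrite mulr1.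
  apply: (E_phi0 (D := set0)); [exact: localized_cst|by rewrite setI0 cards0].
have two g g' : (#|g :&: g'| <= t)%N -> E (fun x => phi g x * phi g' x) = 0.
  by move=> ig; apply: E_phi0 ig; exact: localized_phi.
rewrite (eq_Ex _ (g := fun x => 1 - eps * phi g1 x - eps * phi g2 x - eps * phi g3 x
  + eps ^+ 2 * (phi g1 x * phi g2 x) + eps ^+ 2 * (phi g1 x * phi g3 x)
  + eps ^+ 2 * (phi g2 x * phi g3 x) - eps ^+ 3 * (phi g1 x * phi g2 x * phi g3 x))).
  rewrite !(ExB, ExD, ExZ) !one !two // !mulr0 !addr0 !subr0.
  rewrite Ex_cst; last by move=> j; apply: unif_sum1; rewrite card_ord.
  by rewrite lerD2l lerN2 ler_peMr ?exprn_ge0 // E_phi3.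
by move=> x; rewrite /tilt; ring.
Qed.

Lemma spike_norm a : `|spike a| <= L.+3%:R.
Proof.
rewrite /spike; case: eqP => _; first by rewrite normr_nat ler_nat.
by rewrite normrN1 ler1n.
Qed.

Lemma phi_norm (r : nat) (e : {set U}) x : #|e| = r ->
  `|phi e x| <= (2 * L.+3)%:R ^+ r.
Proof.
move=> er; apply: le_trans (ler_norm_sum _ _ _) _.
apply: (@le_trans _ _ (\sum_(S : {set U} | S \subset e) L.+3%:R ^+ r)).
  rewrite big_mkcond [leRHS]big_mkcond; apply: ler_sum => S _.
  case: (boolP (S \subset e)) => //= Se; case: ifP => _; last by rewrite exprn_ge0.
  rewrite normr_prod; apply: (@le_trans _ _ (\prod_(v in S) L.+3%:R)).
    by apply: ler_prod => v _; rewrite normr_ge0 spike_norm.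
  rewrite prodr_const; apply: ler_weXn2l; first by rewrite ler1n.
  by rewrite -er subset_leq_card.
rewrite (eq_bigl (mem (powerset e))) => [|S]; last by rewrite /= powersetE.
by rewrite sumr_const card_powerset er -[leLHS]mulr_natl natrX -exprMn -natrM.
Qed.

Lemma tilt_bounds (r : nat) (e : {set U}) x : #|e| = r ->
  eps * (2 * L.+3)%:R ^+ r <= 1 -> 0 <= tilt e x <= 2.
Proof.
move=> er h; have := phi_norm x er; rewrite ler_norml => /andP[h1 h2].
have := ler_wpM2l eps_ge0 h1; have := ler_wpM2l eps_ge0 h2.
by rewrite /tilt mulrN => h3 h4; apply/andP; split; lra.
Qed.

End Gadget.

(** * Pairs of r-sets meeting in t points *)

Section Copies.
Variables (r t : nat).
Hypothesis t_lt_r : (t < r)%N.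
Local Notation m := (2 * r - t)%N.

(** A pair of r-sets meeting in t points is encoded by an injection of its 2r - t vertices into [U].
    The sides are the first r and the last r positions; they overlap in positions r - t to r - 1. *)
Definition side (b : bool) : {set 'I_m} :=
  if b then [set i : 'I_m | (i < r)%N] else [set i : 'I_m | (r - t <= i)%N].

Lemma card_initial (p : nat) : (p <= m)%N -> #|[set i : 'I_m | (i < p)%N]| = p.
Proof.
move=> pm; rewrite -sum1_card; under eq_bigl => i do rewrite inE.
by rewrite -(big_ord_widen m (fun=> 1%N) pm) sum1_card card_ord.
Qed.

Lemma side_falseE : side false = ~: [set i : 'I_m | (i < r - t)%N].
Proof. by apply/setP => i; rewrite !inE -leqNgt. Qed.

Lemma card_side b : #|side b| = r.
Proof.
case: b; first by apply: card_initial; lia.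
by rewrite side_falseE cardsCs setCK card_ord card_initial; lia.
Qed.

Lemma card_sideI : #|side true :&: side false| = t.
Proof.
have := cardsID (side false) (side true); rewrite card_side.
have -> : side true :\: side false = [set i : 'I_m | (i < r - t)%N].
  by apply/setP => i; rewrite !inE -ltnNge; apply/idP/idP; lia.
by rewrite card_initial; lia.
Qed.

Lemma sideU : side true :|: side false = setT.
Proof. by apply/setP => i; rewrite !inE; apply/orP; case: (ltnP i r); [left|right; lia]. Qed.

Variable U : finType.

Lemma card_setU_overlap (g h W : {set U}) : #|h| = r -> #|g :&: h| = t ->
  g \subset W -> (#|h :|: W| <= #|W| + (r - t))%N.
Proof.
move=> ch cgh gW; have := cardsUI h W.
have : (t <= #|h :&: W|)%N by rewrite -cgh setIC; apply: subset_leq_card; apply: setIS.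
by rewrite ch; move: t_lt_r; lia.
Qed.

Implicit Types (psi : {ffun 'I_m -> U}) (T : {set U}).

Definition edge psi b : {set U} := psi @: side b.
Definition support psi : {set U} := edge psi true :|: edge psi false.
Definition shadow psi : {set {set U}} :=
  [set T : {set U} | (#|T| == t) && ((T \subset edge psi true) || (T \subset edge psi false))].

Lemma supportE psi : support psi = psi @: setT.
Proof. by rewrite /support /edge -imsetU sideU. Qed.

Lemma edge_support psi b : edge psi b \subset support psi.
Proof. by case: b; rewrite ?subsetUl ?subsetUr. Qed.

Lemma shadowP psi T :
  reflect (#|T| = t /\ exists b, T \subset edge psi b) (T \in shadow psi).
Proof.
rewrite inE; apply: (iffP andP) => [[/eqP Tt /orP[]]|[-> [b Tb]]].
- by split=> //; exists true.
- by split=> //; exists false.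
- by rewrite eqxx; split=> //; case: b Tb => ->; rewrite ?orbT.
Qed.

Lemma shadow_support psi T : T \in shadow psi -> T \subset support psi.
Proof. by move=> /shadowP[_ [b Tb]]; apply: subset_trans Tb (edge_support _ _). Qed.

Section Injective.
Variable psi : {ffun 'I_m -> U}.
Hypothesis psi_inj : injective psi.

Lemma card_edge b : #|edge psi b| = r.
Proof. by rewrite card_imset // card_side. Qed.

Lemma card_edgeI b : #|edge psi b :&: edge psi (~~ b)| = t.
Proof.
have -> : edge psi b :&: edge psi (~~ b) = edge psi true :&: edge psi false.
  by case: b => //=; rewrite setIC.
rewrite /edge -imsetI; last by move=> x y _ _; apply: psi_inj.
by rewrite card_imset // card_sideI.
Qed.

Lemma card_support : #|support psi| = m.
Proof. by rewrite supportE card_imset // cardsT card_ord. Qed.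

Lemma card_shadow : #|shadow psi| = (2 * 'C(r, t) - 1)%N.
Proof.
have -> : shadow psi = [set T : {set U} | T \subset edge psi true & #|T| == t] :|:
    [set T : {set U} | T \subset edge psi false & #|T| == t].
  by apply/setP => T; rewrite !inE andbC andb_orl.
have I1 : #|[set T : {set U} | T \subset edge psi true & #|T| == t] :&:
    [set T : {set U} | T \subset edge psi false & #|T| == t]| = 1%N.
  have -> : [set T : {set U} | T \subset edge psi true & #|T| == t] :&:
    [set T : {set U} | T \subset edge psi false & #|T| == t] =
    [set T : {set U} | T \subset edge psi true :&: edge psi false & #|T| == t].
    by apply/setP => T; rewrite !inE subsetI; case: (_ == t); rewrite ?andbT ?andbF.
  by rewrite cards_draws (card_edgeI true) binn.
have := cardsUI [set T : {set U} | T \subset edge psi true & #|T| == t]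
  [set T : {set U} | T \subset edge psi false & #|T| == t].
by rewrite I1 !cards_draws !card_edge addn1 mul2n -addnn => <-; rewrite subn1.
Qed.

End Injective.

Variables (R : realFieldType) (L : nat) (eps : R).
Hypothesis eps_ge0 : 0 <= eps.
Local Notation X := 'I_L.+3.
Local Notation E := (Ex (@unif R X U)).
Local Notation tilt := (@tilt R U L t eps).

Lemma localized_tiltS (e D : {set U}) : e \subset D -> localized D (tilt e).
Proof. by move=> eD; apply: localizedS eD _; exact: localized_tilt. Qed.

Definition pair_tilt psi (x : {ffun U -> X}) : R :=
  tilt (edge psi true) x * tilt (edge psi false) x.

Lemma pair_tiltE psi b x :
  pair_tilt psi x = tilt (edge psi b) x * tilt (edge psi (~~ b)) x.
Proof. by rewrite /pair_tilt; case: b => //=; rewrite mulrC. Qed.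

Lemma localized_pair_tilt psi : localized (support psi) (pair_tilt psi).
Proof.
by apply: localizedM; apply: localized_tiltS; apply: edge_support.
Qed.

(** The other edge of the pair meets [D] only inside edge [b], hence meets the union of [D] and edge
    [b] in exactly t vertices, and can be peeled off. *)
Lemma E_peel_half psi b (D : {set U}) F : injective psi ->
  localized D F -> edge psi (~~ b) :&: D \subset edge psi b ->
  E (fun x => pair_tilt psi x * F x) = E (fun x => tilt (edge psi b) x * F x).
Proof.
move=> pI lF sD.
rewrite (eq_Ex _ (g := fun x => tilt (edge psi (~~ b)) x * (tilt (edge psi b) x * F x))).
  apply: (E_peel eps (D := edge psi b :|: D)).
    apply: localizedM; first exact: localized_tiltS (subsetUl _ _).
    exact: localizedS (subsetUr _ _) lF.
  rewrite -(card_edgeI pI b); apply: subset_leq_card.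
  rewrite setIUr subUset setIC subxx /= subsetI sD subsetIl //.
by move=> x; rewrite (pair_tiltE psi b); ring.
Qed.

Lemma E_one : E (fun=> 1) = 1.
Proof. by apply: Ex_cst => j; apply: unif_sum1; rewrite card_ord. Qed.

Lemma E_pair_tilt psi : injective psi -> E (pair_tilt psi) = 1.
Proof.
move=> pI.
rewrite (eq_Ex _ (g := fun x => pair_tilt psi x * 1)) => [|x]; last by rewrite mulr1.
rewrite (E_peel_half (b := true) pI (@localized_cst R U X set0 1)); last by rewrite setI0 sub0set.
rewrite (E_peel _ (@localized_cst R U X set0 1)); last by rewrite setI0 cards0.
exact: E_one.
Qed.

Lemma E_pair_tilt2 psi psi' T : injective psi -> injective psi' ->
  T \in shadow psi -> T \in shadow psi' -> support psi :&: support psi' = T ->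
  E (fun x => pair_tilt psi x * pair_tilt psi' x) = 1.
Proof.
move=> pI pI' /shadowP[Tt [b Tb]] /shadowP[_ [b' Tb']] sT.
rewrite (E_peel_half (b := b) pI (@localized_pair_tilt psi')); last first.
  apply: subset_trans Tb; rewrite -sT; apply: setSI; exact: edge_support.
rewrite (E_peel _ (@localized_pair_tilt psi')); last first.
  rewrite -Tt; apply: subset_leq_card; rewrite -sT; apply: setSI; exact: edge_support.
exact: E_pair_tilt.
Qed.

Definition bad_edges (g1 g2 g3 : {set U}) : bool :=
  [&& (#|g1 :|: g2 :|: g3| <= 3 * r - 2 * t)%N, (#|g1 :&: g2| < t)%N,
      (#|g1 :&: g3| < t)%N & (#|g2 :&: g3| < t)%N].

(** Two of the edges span more than 2r - t vertices. As all three span at most 3r - 2t, the third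
    has more than t vertices in that span. *)
Lemma bad_edges_overlap (g1 g2 g3 : {set U}) :
  #|g1| = r -> #|g2| = r -> #|g3| = r -> bad_edges g1 g2 g3 ->
  [/\ (t < #|g1 :&: (g2 :|: g3)|)%N, (t < #|g2 :&: (g1 :|: g3)|)%N &
      (t < #|g3 :&: (g1 :|: g2)|)%N].
Proof.
move=> c1 c2 c3 /and4P[u i12 i13 i23].
have key (a b c : {set U}) : #|a| = r -> #|b| = r -> #|c| = r ->
    (#|b :&: c| < t)%N -> (#|a :|: (b :|: c)| <= 3 * r - 2 * t)%N ->
    (t < #|a :&: (b :|: c)|)%N.
  move=> ca cb cc ibc ua; have := cardsUI a (b :|: c); have := cardsUI b c.
  by move: ibc ua; rewrite ca cb cc; lia.
split; apply: key => //.
- by rewrite setUA.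
- by rewrite setUCA setUA.
- by rewrite setUC.
Qed.

(** The bad edges span at most 3r - 2t vertices and each partner adds at most r - t. A total of 6r -
    5t forces equality everywhere, so each partner meets the rest only inside its own edge. Peeling
    the three partners leaves the tilts of the bad edges. *)
Lemma E_pair_tilt3 psi1 psi2 psi3 b1 b2 b3 :
  injective psi1 -> injective psi2 -> injective psi3 ->
  bad_edges (edge psi1 b1) (edge psi2 b2) (edge psi3 b3) ->
  (6 * r - 5 * t <= #|support psi1 :|: support psi2 :|: support psi3|)%N ->
  E (fun x => pair_tilt psi1 x * (pair_tilt psi2 x * pair_tilt psi3 x)) <= 1 - eps ^+ 3.
Proof.
move=> pI1 pI2 pI3 bad big.
set g1 := edge psi1 b1 in bad *; set g2 := edge psi2 b2 in bad *.
set g3 := edge psi3 b3 in bad *.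
set h1 := edge psi1 (~~ b1); set h2 := edge psi2 (~~ b2); set h3 := edge psi3 (~~ b3).
have sE psi b : support psi = edge psi b :|: edge psi (~~ b).
  by rewrite /support; case: b => //=; rewrite setUC.
rewrite (sE _ b1) (sE _ b2) (sE _ b3) -/g1 -/g2 -/g3 -/h1 -/h2 -/h3 in big.
have /and4P[u i12 i13 i23] := bad.
have [o1 o2 o3] := bad_edges_overlap (card_edge pI1 b1) (card_edge pI2 b2) (card_edge pI3 b3) bad.
set G := g1 :|: g2 :|: g3 in u.
have hG := @card_setU_overlap.
(* Outside the partner [h] there are at most 5r - 4t vertices, so [h] brings at least r - t new ones
   and meets [W] in at most t, namely in the t vertices shared with [g]. *)
have key (g h W : {set U}) : #|h| = r -> #|g :&: h| = t -> g \subset W ->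
    h :|: W = g1 :|: h1 :|: (g2 :|: h2) :|: (g3 :|: h3) ->
    (#|W| <= 5 * r - 4 * t)%N -> h :&: W \subset g.
  move=> ch cgh gW hW cW.
  suff -> : h :&: W = g :&: h by exact: subsetIl.
  apply/esym/eqP; rewrite eqEcard cgh subsetI subsetIr subIset ?gW //=.
  have := cardsUI h W; rewrite hW ch; move: big cW; lia.
have [ch1 ch2 ch3] : [/\ #|h1| = r, #|h2| = r & #|h3| = r] by rewrite !card_edge.
have [c1 c2 c3] : [/\ #|g1 :&: h1| = t, #|g2 :&: h2| = t & #|g3 :&: h3| = t] by rewrite !card_edgeI.
have sub1 : g1 \subset G by rewrite /G -setUA subsetUl.
have sub2 : g2 \subset G by rewrite /G setUAC subsetUr.
have sub3 : g3 \subset G by rewrite /G subsetUr.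
have two (g h g' h' : {set U}) : #|h| = r -> #|g :&: h| = t -> #|h'| = r -> #|g' :&: h'| = t ->
    g \subset G -> g' \subset G -> (#|h :|: (h' :|: G)| <= 5 * r - 4 * t)%N.
  move=> ch cg ch' cg' gG gG'.
  have := hG g h (h' :|: G) ch cg (subset_trans gG (subsetUr _ _)).
  by have := hG g' h' G ch' cg' gG'; move: u t_lt_r; lia.
have k1 : h1 :&: (h2 :|: (h3 :|: G)) \subset g1.
  apply: key => //; first by apply: subset_trans sub1 _; rewrite setUA subsetUr.
    by apply/setP => v; rewrite !inE; do !case: (v \in _).
  exact: (two g2 h2 g3 h3).
have k2 : h2 :&: (h1 :|: (h3 :|: G)) \subset g2.
  apply: key => //; first by apply: subset_trans sub2 _; rewrite setUA subsetUr.
    by apply/setP => v; rewrite !inE; do !case: (v \in _).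
  exact: (two g1 h1 g3 h3).
have k3 : h3 :&: (h1 :|: (h2 :|: G)) \subset g3.
  apply: key => //; first by apply: subset_trans sub3 _; rewrite setUA subsetUr.
    by apply/setP => v; rewrite !inE; do !case: (v \in _).
  exact: (two g1 h1 g2 h2).
have lp psi (D : {set U}) : support psi \subset D -> localized D (pair_tilt psi).
  by move=> sD; apply: localizedS sD _; exact: localized_pair_tilt.
rewrite (E_peel_half (b := b1) (D := support psi2 :|: support psi3) pI1); last first.
- apply: subset_trans k1; apply: setIS; rewrite (sE _ b2) (sE _ b3) -/g2 -/g3 -/h2 -/h3.
  by apply/subsetP => v; rewrite !inE; do !case: (v \in _).
- by apply: localizedM; apply: lp; rewrite ?subsetUl ?subsetUr.
rewrite (eq_Ex _ (g := fun x => pair_tilt psi2 x * (tilt g1 x * pair_tilt psi3 x))); last first.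
  by move=> x; rewrite -/g1; ring.
rewrite (E_peel_half (b := b2) (D := g1 :|: support psi3) pI2); last first.
- apply: subset_trans k2; apply: setIS; rewrite (sE _ b3) -/g3 -/h3.
  by apply/subsetP => v; rewrite !inE; do !case: (v \in _).
- apply: localizedM; first by apply: localized_tiltS; rewrite subsetUl.
  by apply: lp; rewrite subsetUr.
rewrite (eq_Ex _ (g := fun x => pair_tilt psi3 x * (tilt g1 x * tilt g2 x))); last first.
  by move=> x; rewrite -/g2; ring.
rewrite (E_peel_half (b := b3) (D := g1 :|: g2) pI3); last first.
- apply: subset_trans k3; apply: setIS.
  by apply/subsetP => v; rewrite !inE; do !case: (v \in _).
- by apply: localizedM; apply: localized_tiltS; rewrite ?subsetUl ?subsetUr.
rewrite (eq_Ex _ (g := fun x => tilt g1 x * tilt g2 x * tilt g3 x)); last first.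
  by move=> x; rewrite -/g3; ring.
by apply: E_tilt3 => //; apply: ltnW.
Qed.

End Copies.

(** * Random signs of the t-sets *)

Section Consistency.
Variables (r t : nat).
Hypothesis t_lt_r : (t < r)%N.
Local Notation m := (2 * r - t)%N.
Variables (U : finType) (R : realFieldType) (L : nat).
Local Notation X := 'I_L.+3.
Local Notation E := (Ex (@unif R X {set U})).
Implicit Types (psi : {ffun 'I_m -> U}) (T : {set U}).

(** Colour 0 means negative, every other colour positive, so a t-set is positive with probability (L
    + 2) / (L + 3). The condition fixes the sign of every t-set of the support, including those that
    the pair does not cover. *)
Definition consistent (chi : {ffun {set U} -> X}) psi : bool :=
  [forall T : {set U}, (#|T| == t) && (T \subset support psi) ==>
     ((chi T != ord0) == (T \in shadow psi))].

Definition prob_pos : R := L.+2%:R / L.+3%:R.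
Definition prob_neg : R := L.+3%:R^-1.
Definition prob_consistent : R :=
  prob_pos ^+ (2 * 'C(r, t) - 1) * prob_neg ^+ ('C(m, t) - (2 * 'C(r, t) - 1)).

Lemma prob_pos_gt0 : 0 < prob_pos. Proof. by rewrite divr_gt0 ?ltr0n. Qed.
Lemma prob_neg_gt0 : 0 < prob_neg. Proof. by rewrite invr_gt0 ltr0n. Qed.
Lemma prob_consistent_gt0 : 0 < prob_consistent.
Proof. by rewrite mulr_gt0 // exprn_gt0 ?prob_pos_gt0 ?prob_neg_gt0. Qed.

Lemma prob_posE : prob_pos = 1 - prob_neg.
Proof.
rewrite /prob_pos /prob_neg; apply: (mulIf (x := L.+3%:R)); first by rewrite pnatr_eq0.
by rewrite divfK ?pnatr_eq0 // mulrBl mulVf ?pnatr_eq0 // mul1r -[L.+3%:R]natr1 addrK.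
Qed.

Lemma mean_nonzero : \sum_(a : X) unif R a a * (a != ord0)%:R = prob_pos.
Proof.
rewrite /unif card_ord -mulr_sumr mulrC (bigD1 ord0) //= add0r.
rewrite (eq_bigr (fun=> 1)) => [|a ->//].
by rewrite sumr_const cardC1 card_ord.
Qed.

Lemma mean_zero : \sum_(a : X) unif R a a * (a == ord0)%:R = prob_neg.
Proof.
rewrite /unif card_ord -mulr_sumr (bigD1 ord0) //= big1 ?addr0 ?mulr1 //.
by move=> a /negPf ->.
Qed.

Let test psi T (a : X) : R :=
  ((#|T| == t) && (T \subset support psi) ==> ((a != ord0) == (T \in shadow psi)))%:R.

Let weight psi T : R := if (#|T| == t) && (T \subset support psi)
  then if T \in shadow psi then prob_pos else prob_neg else 1.

Let weightE psi T : \sum_a unif R T a * test psi T a = weight psi T.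
Proof.
rewrite /test /weight; case: ifP => _ /=; last first.
  under eq_bigr => a _ do rewrite mulr1.
  by apply: unif_sum1; rewrite card_ord.
case: (T \in shadow psi); [rewrite -mean_nonzero|rewrite -mean_zero];
  by apply: eq_bigr => a _; rewrite /unif; case: (a == ord0).
Qed.

Lemma natr_consistent chi psi : (consistent chi psi)%:R = \prod_T test psi T (chi T).
Proof. by rewrite natr_forall. Qed.

Lemma E_consistent_prod psi :
  E (fun chi => (consistent chi psi)%:R) = \prod_T weight psi T.
Proof.
rewrite (eq_Ex _ (fun chi => natr_consistent chi psi)) (Ex_prod _ (test psi)).
by apply: eq_bigr => T _; exact: weightE.
Qed.

Lemma E_consistent psi : injective psi ->
  E (fun chi => (consistent chi psi)%:R) = prob_consistent.
Proof.
move=> pI; rewrite E_consistent_prod /weight -big_mkcond /=.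
pose D := [set T : {set U} | T \subset support psi & #|T| == t].
have cD : #|D| = 'C(m, t) by rewrite cards_draws card_support.
have sD : shadow psi \subset D.
  by apply/subsetP => T Ts; rewrite inE (shadow_support Ts); case/shadowP: Ts => ->; rewrite eqxx.
rewrite (eq_bigl (mem D)) => [|T]; last by rewrite /= inE andbC.
rewrite (big_setID (shadow psi)) /= (setIidPr sD) /prob_consistent; congr (_ * _).
  rewrite (eq_bigr (fun=> prob_pos)) => [|T ->//].
  by rewrite prodr_const card_shadow.
rewrite (eq_bigr (fun=> prob_neg)) => [|T]; last by rewrite inE => /andP[/negPf ->].
by rewrite prodr_const cardsD (setIidPr sD) cD card_shadow.
Qed.

(** The two consistency events inspect disjoint families of t-sets except for T, whose positivity is
    requested by both but paid for once. This accounts for the factor [prob_pos]. *)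
Lemma E_consistent2 psi psi' T : injective psi -> injective psi' ->
  T \in shadow psi -> T \in shadow psi' -> support psi :&: support psi' = T ->
  prob_pos * E (fun chi => (consistent chi psi)%:R * (consistent chi psi')%:R) =
    prob_consistent ^+ 2.
Proof.
move=> pI pI' Ts Ts' sT.
have /shadowP[Tt _] := Ts.
rewrite expr2 -{1}(E_consistent pI) -(E_consistent pI') !E_consistent_prod.
rewrite (eq_Ex _ (g := fun chi => \prod_S (test psi S (chi S) * test psi' S (chi S)))); last first.
  by move=> chi; rewrite !natr_consistent big_split.
rewrite (Ex_prod _ (fun S a => test psi S a * test psi' S a)).
rewrite (bigD1 T) //= [X in _ = X * _](bigD1 T) //= [X in _ = _ * X](bigD1 T) //=.
have wT : weight psi T = prob_pos.
  by rewrite /weight Tt eqxx (shadow_support Ts) /= Ts.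
have wT' : weight psi' T = prob_pos.
  by rewrite /weight Tt eqxx (shadow_support Ts') /= Ts'.
have -> : \sum_a unif R T a * (test psi T a * test psi' T a) = prob_pos.
  rewrite -mean_nonzero; apply: eq_bigr => a _.
  rewrite /test Tt eqxx (shadow_support Ts) (shadow_support Ts') Ts Ts' /unif /=.
  by case: (a == ord0); rewrite /= ?mulr0 ?mulr1.
rewrite wT wT'.
have -> : \prod_(S | S != T) (\sum_a unif R S a * (test psi S a * test psi' S a)) =
    \prod_(S | S != T) (weight psi S * weight psi' S); last first.
  by rewrite big_split /=; ring.
apply: eq_bigr => S ST.
have [c|c] := boolP ((#|S| == t) && (S \subset support psi)); last first.
  rewrite /weight (negPf c) mul1r -[RHS]/(weight psi' S) -weightE.
  by apply: eq_bigr => a _; rewrite {1}/test (negPf c) /= mul1r.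
have c' : (#|S| == t) && (S \subset support psi') = false.
  apply/negP => /andP[_ S']; case/andP: c => /eqP St S1; case/negP: ST.
  by rewrite eqEcard St Tt leqnn andbT -sT subsetI S1.
rewrite [weight psi' S]/weight c' mulr1 -weightE.
by apply: eq_bigr => a _; rewrite [test psi' S a]/test c' /= mulr1.
Qed.

Lemma consistent_pos chi psi T : consistent chi psi -> T \in shadow psi -> chi T != ord0.
Proof.
move=> /forallP/(_ T) h Ts; have /shadowP[Tt _] := Ts; move: h.
by rewrite Tt eqxx (shadow_support Ts) /= Ts => /eqP ->.
Qed.

Lemma consistent_shadow chi psi T : consistent chi psi -> #|T| = t ->
  T \subset support psi -> chi T != ord0 -> T \in shadow psi.
Proof.
move=> /forallP/(_ T) h Tt Ts cT; move: h.
by rewrite Tt Ts cT eqxx /= => /eqP <-.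
Qed.

End Consistency.

(** * Counting injections by symmetry *)

Section Counting.
Variables (m : nat) (U : finType).
Local Notation n := #|U|.
Implicit Types (psi : {ffun 'I_m -> U}) (S T : {set U}).

Definition injections : {set {ffun 'I_m -> U}} :=
  [set psi : {ffun 'I_m -> U} | injectiveb psi].

Lemma card_injections : #|injections| = (n ^_ m)%N.
Proof. by rewrite card_inj_ffuns card_ord. Qed.

(** List each set followed by its complement and match the two lists position by position. *)
Lemma perm_transport S T : #|S| = #|T| -> exists s : {perm U}, s @: S = T.
Proof.
move=> ST.
pose l A : seq U := enum (A : {set U}) ++ enum (~: A).
have l_uniq A : uniq (l A).
  rewrite cat_uniq !enum_uniq andbT /=; apply/hasPn => x.
  by rewrite !mem_enum inE.
have l_mem A x : x \in l A by rewrite mem_cat !mem_enum inE orbN.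
have l_size A : size (l A) = n.
  by rewrite size_cat -!cardE cardsC.
pose f x := nth x (l T) (index x (l S)).
have idx x : (index x (l S) < size (l T))%N by rewrite l_size -(l_size S) index_mem.
have fI : injective f.
  move=> x y; rewrite /f (set_nth_default y x (idx x)) => /eqP.
  rewrite nth_uniq // => /eqP ixy.
  by rewrite -(nth_index x (l_mem S x)) ixy nth_index.
exists (perm fI); apply/eqP; rewrite eqEcard card_imset; last exact: perm_inj.
rewrite ST leqnn andbT; apply/subsetP => _ /imsetP[x xS ->].
rewrite permE /f /l index_cat mem_enum xS nth_cat -cardE -ST cardE.
by rewrite index_mem mem_enum xS -mem_enum mem_nth // -cardE -ST cardE index_mem mem_enum.
Qed.

Definition relabel (s : {perm U}) psi : {ffun 'I_m -> U} := [ffun i => s (psi i)].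

Lemma relabel_inj s : injective (relabel s).
Proof.
move=> p q /ffunP pq; apply/ffunP => i.
by have := pq i; rewrite !ffunE => /perm_inj.
Qed.

Lemma imset_relabel s psi (D : {set 'I_m}) : relabel s psi @: D = s @: (psi @: D).
Proof. by rewrite -imset_comp; apply: eq_imset => i; rewrite /= ffunE. Qed.

Lemma imset_perm_sub (s : {perm U}) S T : (s @: S \subset s @: T) = (S \subset T).
Proof.
apply/idP/idP; last exact: imsetS.
move=> /subsetP h; apply/subsetP => x xS.
by have /imsetP[y yT /perm_inj ->] := h _ (imset_f s xS).
Qed.

Variable P : {ffun 'I_m -> U} -> {set U} -> bool.
Hypothesis P_equiv : forall s psi T, P (relabel s psi) (s @: T) = P psi T.

Definition copy_count T : nat := #|[set psi in injections | P psi T]|.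

Lemma copy_count_sym S T : #|S| = #|T| -> copy_count S = copy_count T.
Proof.
suff le (A B : {set U}) : #|A| = #|B| -> (copy_count A <= copy_count B)%N.
  by move=> ST; apply/eqP; rewrite eqn_leq !le.
move=> /perm_transport[s sAB]; rewrite /copy_count.
rewrite -(card_imset _ (@relabel_inj s)); apply: subset_leq_card.
apply/subsetP => _ /imsetP[psi + ->]; rewrite !inE -sAB P_equiv => /andP[/injectiveP pI ->].
by rewrite andbT; apply/injectiveP => i j; rewrite !ffunE => /perm_inj /pI.
Qed.

(** Double counting of incident injections and j-sets: all j-sets have equal counts by
    [copy_count_sym], and each injection has [c] incident j-sets. *)
Lemma copy_count_total j c T : #|T| = j ->
  (forall psi, injective psi -> #|[set S : {set U} | (#|S| == j) && P psi S]| = c) ->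
  (copy_count T * 'C(n, j) = c * n ^_ m)%N.
Proof.
move=> Tj Pc.
transitivity (\sum_(S : {set U} | #|S| == j) copy_count S)%N.
  rewrite (eq_bigr (fun=> copy_count T)) => [|S /eqP Sj]; last by apply: copy_count_sym; rewrite Tj.
  rewrite (eq_bigl (mem [set S : {set U} | #|S| == j])) => [|S]; last by rewrite /= inE.
  by rewrite sum_nat_const card_draws mulnC.
rewrite /copy_count.
under eq_bigr => S _ do rewrite -sum1_card.
rewrite (exchange_big_dep (mem injections)) /=; last by move=> S psi _; rewrite inE => /andP[].
rewrite mulnC -card_injections -sum_nat_const; apply: eq_bigr => psi pI.
rewrite sum1_card -(Pc psi); last by move: pI; rewrite inE => /injectiveP.
by rewrite inE in pI; apply: eq_card => S; rewrite unfold_in !inE pI.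
Qed.

End Counting.

(** * Triples of maps with a small joint image *)

Section SmallTriples.
Variables (m M : nat) (U : finType).
Local Notation F := {ffun 'I_m -> U}.
Hypothesis m_gt0 : (0 < m)%N.

(** A triple is recovered from a list of M vertices containing the joint image and from three maps
    to positions in that list. For M = 0 the family is empty, since m > 0. *)
Lemma card_small_triples :
  (#|[set p : F * F * F |
      #|p.1.1 @: setT :|: p.1.2 @: setT :|: p.2 @: setT| <= M]|
   <= #|U| ^ M * M ^ (3 * m))%N.
Proof.
case: M => [|M'].
  have -> : [set p : F * F * F |
     (#|p.1.1 @: setT :|: p.1.2 @: setT :|: p.2 @: setT| <= 0)%N] = set0; last by rewrite cards0.
  apply/setP => p; rewrite !inE; apply/negbTE; rewrite -ltnNge card_gt0.
  apply/set0Pn; exists (p.2 (Ordinal m_gt0)); rewrite !inE; apply/orP; right.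
  exact: imset_f.
pose G := ({ffun 'I_m -> 'I_M'.+1} * {ffun 'I_m -> 'I_M'.+1} * {ffun 'I_m -> 'I_M'.+1})%type.
pose cmp (Y : {ffun 'I_M'.+1 -> U}) (c : {ffun 'I_m -> 'I_M'.+1}) : F := [ffun i => Y (c i)].
pose f (q : {ffun 'I_M'.+1 -> U} * G) : F * F * F :=
  (cmp q.1 q.2.1.1, cmp q.1 q.2.1.2, cmp q.1 q.2.2).
apply: (@leq_trans #|f @: setT|).
  apply: subset_leq_card; apply/subsetP => -[[p1 p2] p3]; rewrite inE /=.
  set W := _ :|: _ => WM.
  pose Y : {ffun 'I_M'.+1 -> U} := [ffun j : 'I_M'.+1 => nth (p1 (Ordinal m_gt0)) (enum W) j].
  pose code (p : F) : {ffun 'I_m -> 'I_M'.+1} := [ffun i => inord (index (p i) (enum W))].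
  have codeK (p : F) : p @: setT \subset W -> cmp Y (code p) = p.
    move=> /subsetP pW; apply/ffunP => i; rewrite !ffunE.
    have piW : p i \in W by apply: pW; apply: imset_f.
    rewrite inordK ?nth_index ?mem_enum //.
    by apply: leq_trans WM; rewrite cardE index_mem mem_enum.
  apply/imsetP; exists (Y, (code p1, code p2, code p3)) => //.
  by rewrite /f /= !codeK // /W ?subsetUr // -setUA ?subsetUl // subsetU // subsetUl orbT.
apply: leq_trans (leq_imset_card _ _) _.
rewrite cardsT !card_prod !card_ffun !card_ord leq_mul2l; apply/orP; right.
by rewrite -!expnD; apply: leq_pexp2l; rewrite //; lia.
Qed.

End SmallTriples.

(** * The random weighted family of pairs *)

Section RandomWeights.
Variables (r t : nat).
Hypotheses (t_gt0 : (0 < t)%N) (t_lt_r : (t < r)%N).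
Local Notation m := (2 * r - t)%N.
Variables (U : finType) (R : realType) (L d : nat) (eps : R).
Local Notation n := #|U|.
Hypothesis m_le_n : (m <= n)%N.
Hypothesis eps_ge0 : 0 <= eps.
Hypothesis eps_small : eps * (2 * L.+3)%:R ^+ r <= 1.
Local Notation X := 'I_L.+3.
Local Notation F := {ffun 'I_m -> U}.
Local Notation chis := {ffun {set U} -> X}.
Local Notation labels := {ffun 'I_d -> {ffun U -> X}}.
Local Notation k := (2 * 'C(r, t) - 1)%N.
Local Notation pos := (@prob_pos R L).
Local Notation q := (@prob_consistent r t R L).
Local Notation ptilt := (@pair_tilt r t U R L eps).

Definition label_law (_ : 'I_d) (y : {ffun U -> X}) : R := \prod_v unif R v (y v).
(** Independent signs and labels: the outer average is over the signs of all sets, the inner one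
    over d independent labellings of the vertices. *)
Definition EE (f : chis -> labels -> R) : R :=
  Ex (@unif R X {set U}) (fun chi => Ex label_law (f chi)).

Lemma X_gt0 : (0 < #|X|)%N. Proof. by rewrite card_ord. Qed.

Lemma label_law_ge0 a y : 0 <= label_law a y.
Proof. by apply: prodr_ge0 => v _; exact: unif_ge0. Qed.

Lemma label_law_sum1 a : \sum_y label_law a y = 1.
Proof.
rewrite -[RHS](E_one U R L); apply: eq_bigr => y _.
by rewrite mulr1.
Qed.

Lemma EE_le f g : (forall chi x, f chi x <= g chi x) -> EE f <= EE g.
Proof.
move=> fg; apply: Ex_le => [|chi]; first exact: unif_ge0.
by apply: Ex_le => //; exact: label_law_ge0.
Qed.

Lemma EE_cst a : EE (fun _ _ => a) = a.
Proof.
rewrite /EE (eq_Ex _ (g := fun=> a)) => [|chi].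
  by apply: Ex_cst => j; apply: unif_sum1; exact: X_gt0.
by apply: Ex_cst => j; exact: label_law_sum1.
Qed.

Lemma EED f g : EE (fun chi x => f chi x + g chi x) = EE f + EE g.
Proof. by rewrite -ExD; apply: eq_Ex => chi; rewrite ExD. Qed.

Lemma EEZ a f : EE (fun chi x => a * f chi x) = a * EE f.
Proof. by rewrite -ExZ; apply: eq_Ex => chi; rewrite ExZ. Qed.

Lemma EE_sum (I : Type) (s : seq I) (P : pred I) (f : I -> chis -> labels -> R) :
  EE (fun chi x => \sum_(i <- s | P i) f i chi x) = \sum_(i <- s | P i) EE (f i).
Proof. by rewrite -Ex_sum; apply: eq_Ex => chi; rewrite Ex_sum. Qed.

Lemma EE_eq f g : (forall chi x, f chi x = g chi x) -> EE f = EE g.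
Proof. by move=> fg; apply: eq_Ex => chi; apply: eq_Ex => x. Qed.

Lemma EE_split (f : chis -> R) (g : labels -> R) :
  EE (fun chi x => f chi * g x) = Ex (@unif R X {set U}) f * Ex label_law g.
Proof.
rewrite mulrC -ExZ; apply: eq_Ex => chi; rewrite ExZ mulrC //.
Qed.

Lemma EE_exists f a : EE f <= a -> exists chi x, f chi x <= a.
Proof.
move=> h; have [||chi hchi _] := Ex_exists _ _ h.
- by move=> j b; exact: unif_ge0.
- by move=> j; apply: unif_sum1; exact: X_gt0.
have [x hx _] := Ex_exists label_law_ge0 label_law_sum1 hchi.
by exists chi, x.
Qed.

Lemma E_label_prod (f : {ffun U -> X} -> R) :
  Ex label_law (fun x => \prod_a f (x a)) = Ex (@unif R X U) f ^+ d.
Proof.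
rewrite (Ex_prod label_law (fun _ => f)).
by rewrite (eq_bigr (fun=> Ex (@unif R X U) f)) // prodr_const card_ord.
Qed.

(* Each of the n ^_ m injections covers k t-sets, and by symmetry every t-set is
   covered equally often. *)
Definition copies_per_set : R := k%:R * (n ^_ m)%:R / 'C(n, t)%:R.
Definition copies_per_larger_set : R := 'C(m, t.+1)%:R * (n ^_ m)%:R / 'C(n, t.+1)%:R.
(* Normalisation: the expected degree of a t-set, given that it is positive, is 1. *)
Definition mass : R := copies_per_set * q / pos.

Let t_lt_n : (t < n)%N. Proof. by apply: leq_trans m_le_n; clear -t_gt0 t_lt_r; lia. Qed.

Lemma k_gt0 : (0 < k)%N.
Proof.
have : (0 < 'C(r, t))%N by rewrite bin_gt0 ltnW.
by case: 'C(r, t) => // c _; rewrite mulnS.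
Qed.

Lemma copies_per_set_gt0 : 0 < copies_per_set.
Proof.
rewrite divr_gt0 ?mulr_gt0 ?ltr0n ?k_gt0 //; first by rewrite ffact_gt0.
by rewrite bin_gt0 ltnW.
Qed.

Lemma mass_gt0 : 0 < mass.
Proof.
apply: divr_gt0; last exact: prob_pos_gt0.
by apply: mulr_gt0; [exact: copies_per_set_gt0|exact: prob_consistent_gt0].
Qed.

Lemma shadow_relabel (s : {perm U}) (psi : F) (T : {set U}) :
  (s @: T \in shadow (relabel s psi)) = (T \in shadow psi).
Proof.
rewrite !inE card_imset; last exact: perm_inj.
by rewrite /edge !imset_relabel !imset_perm_sub.
Qed.

Lemma support_relabel (s : {perm U}) (psi : F) (T : {set U}) :
  (s @: T \subset support (relabel s psi)) = (T \subset support psi).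
Proof. by rewrite !supportE // imset_relabel imset_perm_sub. Qed.

Lemma count_shadow (T : {set U}) : #|T| = t ->
  (#|[set psi in injections m U | T \in shadow psi]|)%:R = copies_per_set.
Proof.
move=> Tt.
have h := copy_count_total shadow_relabel (c := k) Tt.
have C0 : 'C(n, t)%:R != 0 :> R by rewrite pnatr_eq0 -lt0n bin_gt0 ltnW.
apply: (mulIf C0); rewrite divfK // -!natrM -h // => psi pI.
rewrite -(card_shadow t_lt_r pI); apply: eq_card => S; rewrite !inE.
by case: (_ == t).
Qed.

Lemma count_support (T : {set U}) : #|T| = t.+1 ->
  (#|[set psi in injections m U | T \subset support psi]|)%:R = copies_per_larger_set.
Proof.
move=> Tt.
have h := copy_count_total support_relabel (c := 'C(m, t.+1)) Tt.
have C0 : 'C(n, t.+1)%:R != 0 :> R by rewrite pnatr_eq0 -lt0n bin_gt0.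
apply: (mulIf C0); rewrite divfK // -!natrM -h // => psi pI.
rewrite -(card_support t_lt_r pI) -cards_draws; apply: eq_card => S; rewrite !inE.
by rewrite andbC.
Qed.

Definition copy_weight (chi : chis) (x : labels) (psi : F) : R :=
  (psi \in injections m U)%:R * (consistent chi psi)%:R * (\prod_a ptilt psi (x a)) / mass.

Lemma pair_tilt_bounds (psi : F) (y : {ffun U -> X}) : injective psi -> 0 <= ptilt psi y <= 4.
Proof.
move=> pI.
have /andP[h1 h2] := tilt_bounds t eps_ge0 y (card_edge t_lt_r pI true) eps_small.
have /andP[h3 h4] := tilt_bounds t eps_ge0 y (card_edge t_lt_r pI false) eps_small.
rewrite /pair_tilt mulr_ge0 //=; have -> : 4 = 2 * 2 :> R by ring.
exact: ler_pM.
Qed.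

Lemma prod_tilt_bounds (psi : F) (x : labels) : injective psi ->
  0 <= \prod_a ptilt psi (x a) <= 4 ^+ d.
Proof.
move=> pI; apply/andP; split.
  by apply: prodr_ge0 => a _; have /andP[] := pair_tilt_bounds (x a) pI.
apply: (@le_trans _ _ (\prod_(a : 'I_d) 4)); last by rewrite prodr_const card_ord.
by apply: ler_prod => a _; exact: pair_tilt_bounds.
Qed.

Lemma copy_weight_bounds chi x psi : 0 <= copy_weight chi x psi <= 4 ^+ d / mass.
Proof.
rewrite /copy_weight inE; case: injectiveP => [pI|_]; last first.
  by rewrite !mul0r lexx /= divr_ge0 ?exprn_ge0 // ltW // mass_gt0.
have /andP[h1 h2] := prod_tilt_bounds x pI.
have i0 : 0 <= mass^-1 by rewrite invr_ge0 ltW // mass_gt0.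
case: consistent; rewrite ?mul1r ?mul0r ?mulr0 ?mul0r.
  by rewrite mulr_ge0 //= ler_wpM2r.
by rewrite lexx /= mulr_ge0 // exprn_ge0.
Qed.

Lemma copy_weight_ge0 chi x psi : 0 <= copy_weight chi x psi.
Proof. by have /andP[] := copy_weight_bounds chi x psi. Qed.

Lemma copy_weight_le chi x psi :
  copy_weight chi x psi <= 4 ^+ d / mass * (psi \in injections m U)%:R.
Proof.
rewrite /copy_weight; case: (boolP (psi \in _)) => [pI|_]; last by rewrite !mul0r mulr0.
have /andP[_] := copy_weight_bounds chi x psi.
by rewrite /copy_weight pI mulr1.
Qed.

Definition positive_sets (chi : chis) : {set {set U}} :=
  [set T : {set U} | (#|T| == t) && (chi T != ord0)].

Lemma copy_weight_supp chi x psi : copy_weight chi x psi != 0 ->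
  [/\ injective psi, consistent chi psi, shadow psi \subset positive_sets chi & #|shadow psi| = k].
Proof.
rewrite /copy_weight inE; case: injectiveP => [pI|_]; last by rewrite !mul0r eqxx.
case: (boolP (consistent chi psi)) => [c _|_]; last by rewrite mulr0 !mul0r eqxx.
split=> //; last exact: card_shadow.
apply/subsetP => T Ts; rewrite inE (consistent_pos c Ts) andbT.
by case/shadowP: Ts => ->.
Qed.

(** The number of copies through a t-set cancels against the same factor in [mass], so this crude
    bound does not depend on n. *)
Lemma copy_deg_le chi x (T : {set U}) :
  deg (@shadow r t U) (copy_weight chi x) T <= 4 ^+ d * pos / q.
Proof.
have q0 := prob_consistent_gt0 r t R L; have p0 := prob_pos_gt0 R L.
case: (eqVneq #|T| t) => [Tt|Tt]; last first.
  rewrite /deg big_pred0 => [|psi]; first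
    by apply: divr_ge0; [apply: mulr_ge0; [exact: exprn_ge0|exact: ltW]|exact: ltW].
  by apply/negbTE; apply: contra Tt => /shadowP[->].
apply: (@le_trans _ _ (4 ^+ d / mass * copies_per_set)).
  rewrite -(count_shadow Tt) -sum1_card natr_sum mulr_sumr /deg big_mkcond [leRHS]big_mkcond.
  apply: ler_sum => psi _; rewrite inE; have := copy_weight_le chi x psi.
  by case: (psi \in injections _ _) => /=; case: ifP; rewrite ?mulr0.
rewrite le_eqVlt; apply/orP; left; apply/eqP; rewrite /mass.
by field; rewrite !gt_eqF ?copies_per_set_gt0.
Qed.

Lemma sum_weight_le chi x (P : pred F) :
  \sum_(psi | P psi) copy_weight chi x psi <=
    4 ^+ d / mass * (#|[set psi in injections m U | P psi]|)%:R.
Proof.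
rewrite -sum1_card natr_sum mulr_sumr big_mkcond [leRHS]big_mkcond.
apply: ler_sum => psi _; rewrite inE; have := copy_weight_le chi x psi.
by case: (psi \in injections _ _) => /=; case: ifP; rewrite ?mulr0.
Qed.

(** A copy covering two distinct t-sets has a fixed set of t + 1 vertices in its support, and such
    copies are fewer by a factor of order n. *)
Lemma copy_codeg_le chi x (S T : {set U}) : S != T ->
  codeg (@shadow r t U) (copy_weight chi x) S T <= 4 ^+ d / mass * copies_per_larger_set.
Proof.
move=> ST.
have mp := mass_gt0.
have rhs0 : 0 <= 4 ^+ d / mass * copies_per_larger_set.
  apply: mulr_ge0; first by apply: divr_ge0; [exact: exprn_ge0|exact: ltW].
  by apply: divr_ge0 => //; apply: mulr_ge0.
case: (boolP ((#|S| == t) && (#|T| == t))) => [/andP[/eqP St /eqP Tt]|nt]; last first.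
  rewrite /codeg big_pred0 // => psi; apply/negbTE; apply: contra nt.
  by move=> /andP[/shadowP[-> _] /shadowP[-> _]]; rewrite eqxx.
have /subsetPn[u uT uS] : ~~ (T \subset S).
  by apply: contra ST => TS; rewrite eq_sym eqEcard TS St Tt leqnn.
have W : #|u |: S| = t.+1 by rewrite cardsU1 uS St.
rewrite -(count_support W); apply: le_trans (sum_weight_le chi x _) _.
apply: ler_wpM2l; first by apply: divr_ge0; [exact: exprn_ge0|exact: ltW].
rewrite ler_nat; apply: subset_leq_card.
apply/subsetP => psi /setIdP[pI /andP[Ss Ts]]; apply/setIdP; split=> //.
by rewrite subUset sub1set (subsetP (shadow_support Ts)) //= (shadow_support Ss).
Qed.

Lemma EE_weight (psi : F) : injective psi ->
  EE (fun chi x => copy_weight chi x psi) = q / mass.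
Proof.
move=> pI.
rewrite (EE_eq (g := fun chi x => mass^-1 * ((consistent chi psi)%:R * \prod_a ptilt psi (x a)))).
  rewrite EEZ EE_split E_consistent // E_label_prod E_pair_tilt //.
  by rewrite expr1n mulr1 mulrC.
move=> chi x; rewrite /copy_weight.
have -> : psi \in injections m U by rewrite inE; apply/injectiveP.
by rewrite mul1r mulrC.
Qed.

Lemma EE_weight2 (psi psi' : F) (T : {set U}) : injective psi -> injective psi' ->
  T \in shadow psi -> T \in shadow psi' -> support psi :&: support psi' = T ->
  EE (fun chi x => copy_weight chi x psi * copy_weight chi x psi') = q ^+ 2 / pos / mass ^+ 2.
Proof.
move=> pI pI' Ts Ts' sT.
rewrite (EE_eq (g := fun chi x => mass^-1 ^+ 2 *
  (((consistent chi psi)%:R * (consistent chi psi')%:R) *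
    \prod_a (ptilt psi (x a) * ptilt psi' (x a))))).
  rewrite EEZ EE_split -(E_consistent2 t_lt_r R L pI pI' Ts Ts' sT).
  rewrite (E_label_prod (fun y => ptilt psi y * ptilt psi' y)).
  rewrite (E_pair_tilt2 t_lt_r L eps pI pI' Ts Ts' sT) expr1n mulr1.
  by rewrite [pos * _]mulrC mulfK ?gt_eqF ?prob_pos_gt0 // exprVn mulrC.
move=> chi x; rewrite /copy_weight.
have -> : psi \in injections m U by rewrite inE; apply/injectiveP.
have -> : psi' \in injections m U by rewrite inE; apply/injectiveP.
rewrite !mul1r [X in _ = _ * (_ * X)]big_split.
by move: (\prod_a _) (\prod_a _) => y y'; rewrite expr2 /=; ring.
Qed.

Lemma E_positive (T : {set U}) :
  EE (fun chi _ => (chi T != ord0)%:R) = pos.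
Proof.
rewrite (EE_eq (g := fun chi _ => (chi T != ord0)%:R * 1)) => [|chi x]; last by rewrite mulr1.
rewrite (EE_split (fun chi => (chi T != ord0)%:R) (fun=> 1)).
rewrite (Ex_cst label_law_sum1) mulr1.
rewrite (eq_Ex _ (g := fun chi : chis =>
   \prod_S (if S == T then (chi S != ord0)%:R else 1))); last first.
  by move=> chi; rewrite -big_mkcond /= big_pred1_eq.
rewrite (Ex_prod _ (fun S a => if S == T then (a != ord0)%:R else 1)).
rewrite (bigD1 T) //= [X in _ * X]big1 ?mulr1 => [|S /negPf ->].
  by rewrite eqxx -mean_nonzero; apply: eq_bigr.
by under eq_bigr => a _ do rewrite mulr1; apply: unif_sum1; exact: X_gt0.
Qed.

Let irreg_bound : R :=
  m%:R * (copies_per_larger_set / copies_per_set) * (4 ^+ d * pos / q) ^+ 2.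

(** Two copies through T that share nothing else contribute q^2 / (pos mass^2). Multiplied by
    [copies_per_set] squared this is exactly [pos], by the choice of [mass]. Pairs of copies with a
    further common vertex are rare and receive the pointwise bound; they produce [irreg_bound]. *)
Lemma EE_deg_sqr (T : {set U}) : #|T| = t ->
  EE (fun chi x => deg (@shadow r t U) (copy_weight chi x) T ^+ 2) <= pos + irreg_bound.
Proof.
move=> Tt.
have mp := mass_gt0; have q0 := prob_consistent_gt0 r t R L; have p0 := prob_pos_gt0 R L.
have cp := copies_per_set_gt0.
pose D := [set psi in injections m U | T \in shadow psi].
have cD : #|D|%:R = copies_per_set := count_shadow Tt.
have degE chi x : deg (@shadow r t U) (copy_weight chi x) T = \sum_(psi in D) copy_weight chi x psi.
  rewrite /deg big_mkcond [RHS]big_mkcond; apply: eq_bigr => psi _; rewrite [psi \in D]in_set.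
  case: (boolP (psi \in injections m U)) => //= pI.
  by rewrite /copy_weight (negPf pI) !mul0r; case: ifP.
have DP psi : psi \in D -> injective psi /\ T \in shadow psi.
  by move=> /setIdP[]; rewrite [psi \in _]inE => /injectiveP.
rewrite (EE_eq (g := fun chi x => \sum_(psi in D) \sum_(psi' in D)
    copy_weight chi x psi * copy_weight chi x psi')); last first.
  move=> chi x; rewrite degE expr2 mulr_suml; apply: eq_bigr => psi _.
  by rewrite mulr_sumr.
set a := q ^+ 2 / pos / mass ^+ 2; set b := (4 ^+ d / mass) ^+ 2.
have le1 psi psi' : psi \in D -> psi' \in D ->
    EE (fun chi x => copy_weight chi x psi * copy_weight chi x psi') <=
    a + b * \sum_(u in support psi :\: T) (u \in support psi')%:R.
  move=> /DP[pI Ts] /DP[pI' Ts'].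
  have a0 : 0 <= a by rewrite /a; apply: divr_ge0; [apply: divr_ge0; [exact: sqr_ge0|exact: ltW]|exact: sqr_ge0].
  have s0 : 0 <= \sum_(u in support psi :\: T) (u \in support psi')%:R :> R by apply: sumr_ge0.
  case: (boolP [exists u in support psi :\: T, u \in support psi']) => [|no].
    move=> /existsP[u /andP[uT us]].
    apply: (@le_trans _ _ b); last first.
      rewrite -[leLHS]add0r; apply: lerD => //; rewrite ler_peMr ?sqr_ge0 //.
      rewrite (bigD1 u) //= us lerDl; exact: sumr_ge0.
    rewrite -(EE_cst b); apply: EE_le => chi x; rewrite /b expr2.
    have /andP[h1 h2] := copy_weight_bounds chi x psi.
    have /andP[h3 h4] := copy_weight_bounds chi x psi'.
    exact: ler_pM.
  rewrite (EE_weight2 pI pI' Ts Ts'); first by rewrite lerDl mulr_ge0 ?sqr_ge0.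
  apply/eqP; rewrite eqEsubset subsetI !shadow_support // !andbT.
  apply/subsetP => u; rewrite inE => /andP[us us']; apply: contraNT no => uT.
  by apply/existsP; exists u; rewrite inE uT us us'.
rewrite EE_sum; under eq_bigr => psi _ do rewrite EE_sum.
apply: (@le_trans _ _ (\sum_(psi in D) (copies_per_set * a + b * (m%:R * copies_per_larger_set)))).
  apply: ler_sum => psi pD; have [pI Ts] := DP _ pD.
  apply: le_trans (ler_sum _ (fun psi' pD' => le1 psi psi' pD pD')) _.
  rewrite big_split /= sumr_const -[X in X + _ <= _]mulr_natl cD lerD2l -mulr_sumr.
  rewrite ler_wpM2l ?sqr_ge0 // exchange_big /=.
  apply: (@le_trans _ _ (\sum_(u in support psi :\: T) copies_per_larger_set)).
    apply: ler_sum => u; rewrite inE => /andP[uT us].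
    have W : #|u |: T| = t.+1 by rewrite cardsU1 uT Tt.
    rewrite -(count_support W) -sum1_card natr_sum big_mkcond [leRHS]big_mkcond.
    apply: ler_sum => psi' _; case: (boolP (psi' \in D)) => [/setIdP[pI' Ts']|_]; last by case: ifP.
    case: (boolP (u \in support psi')) => us'; last by case: ifP.
    rewrite ifT //; apply/setIdP; split=> //.
    by rewrite subUset sub1set us' shadow_support.
  rewrite sumr_const -[leLHS]mulr_natl ler_wpM2r //; last first.
    by rewrite ler_nat -(card_support t_lt_r pI) subset_leq_card // subsetDl.
  by apply: divr_ge0 => //; apply: mulr_ge0.
rewrite sumr_const -[leLHS]mulr_natl cD le_eqVlt; apply/orP; left; apply/eqP.
by rewrite /a /b /irreg_bound /mass; field; rewrite !gt_eqF.
Qed.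

(** A negative t-set has degree 0, so the squared deviation over positive sets is deg^2 - 2 deg +
    1_positive. The main terms pos - 2 pos + pos cancel. *)
Lemma EE_irreg :
  EE (fun chi x => irreg_sqr (@shadow r t U) (copy_weight chi x) (positive_sets chi)) <=
    'C(n, t)%:R * irreg_bound.
Proof.
rewrite (EE_eq (g := fun chi x => \sum_(T in [set T : {set U} | #|T| == t])
   (deg (@shadow r t U) (copy_weight chi x) T ^+ 2
    + (- 2) * deg (@shadow r t U) (copy_weight chi x) T + (chi T != ord0)%:R))); last first.
  move=> chi x; rewrite /irreg_sqr big_mkcond [RHS]big_mkcond; apply: eq_bigr => T _.
  rewrite !inE; case: (#|T| == t) => //=; case: (boolP (chi T != ord0)) => cT /=; first by ring.
  suff -> : deg (@shadow r t U) (copy_weight chi x) T = 0 by ring.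
  rewrite /deg big1 // => psi Ts; apply/eqP; apply: contraNT cT.
  by move=> /copy_weight_supp[_ c _ _]; exact: consistent_pos c Ts.
rewrite EE_sum -(card_draws U t) mulr_natl -sumr_const; apply: ler_sum => T; rewrite inE => /eqP Tt.
rewrite !EED EEZ E_positive.
have -> : EE (fun chi x => deg (@shadow r t U) (copy_weight chi x) T) = pos.
  rewrite /deg EE_sum.
  transitivity (\sum_(psi in [set psi in injections m U | T \in shadow psi]) (q / mass)).
    rewrite big_mkcond [RHS]big_mkcond; apply: eq_bigr => psi _; rewrite inE [in RHS]inE.
    case: injectiveP => [pI|pI] /=; first by rewrite EE_weight.
    case: ifP => // _; rewrite -[RHS](EE_cst 0); apply: EE_eq => chi x.
    by rewrite /copy_weight inE; case: injectiveP => // _; rewrite !mul0r.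
  rewrite sumr_const -mulr_natl (count_shadow Tt) /mass.
  have q0 := prob_consistent_gt0 r t R L; have p0 := prob_pos_gt0 R L.
  have cp := copies_per_set_gt0.
  by field; rewrite !gt_eqF.
by have := EE_deg_sqr Tt; lra.
Qed.

Local Notation M := (6 * r - 5 * t)%N.

Definition conflicts : {set F * F * F} :=
  [set p : F * F * F | [&& p.1.1 != p.1.2, p.1.1 != p.2, p.1.2 != p.2,
     p.1.1 \in injections m U, p.1.2 \in injections m U, p.2 \in injections m U &
     [exists b1, exists b2, exists b3,
        bad_edges r t (edge p.1.1 b1) (edge p.1.2 b2) (edge p.2 b3)]]].

Lemma conflictsP (p : F * F * F) : p \in conflicts ->
  [/\ injective p.1.1, injective p.1.2, injective p.2 &
   exists b1 b2 b3, bad_edges r t (edge p.1.1 b1) (edge p.1.2 b2) (edge p.2 b3)].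
Proof.
rewrite in_set => /and5P[_ _ _ p1 /and3P[p2 p3 /existsP[b1 /existsP[b2 /existsP[b3 bad]]]]].
move: p1 p2 p3; rewrite !in_set => /injectiveP p1 /injectiveP p2 /injectiveP p3.
by split=> //; exists b1, b2, b3.
Qed.

Lemma conflicts_spread : spread_triples conflicts.
Proof. by move=> p; rewrite in_set => /and5P[-> -> -> _ _]. Qed.

Lemma support_sideE (psi : F) b : support psi = edge psi b :|: edge psi (~~ b).
Proof. by rewrite /support; case: b => //=; rewrite setUC. Qed.

(** The three bad edges span at most 3r - 2t vertices and each of the three partners adds at most r
    - t. *)
Lemma card_conflict (p : F * F * F) : p \in conflicts ->
  (#|support p.1.1 :|: support p.1.2 :|: support p.2| <= M)%N.
Proof.
move=> /conflictsP[p1 p2 p3 [b1 [b2 [b3 /and4P[u _ _ _]]]]].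
rewrite (support_sideE _ b1) (support_sideE _ b2) (support_sideE _ b3).
move: (card_edge t_lt_r p1 (~~ b1)) (card_edgeI t_lt_r p1 b1)
  (card_edge t_lt_r p2 (~~ b2)) (card_edgeI t_lt_r p2 b2)
  (card_edge t_lt_r p3 (~~ b3)) (card_edgeI t_lt_r p3 b3) u.
move: (edge p.1.1 b1) (edge p.1.1 (~~ b1)) (edge p.1.2 b2) (edge p.1.2 (~~ b2))
  (edge p.2 b3) (edge p.2 (~~ b3)) => g1 h1 g2 h2 g3 h3 c1 i1 c2 i2 c3 i3 u.
set G := g1 :|: g2 :|: g3 in u.
have -> : g1 :|: h1 :|: (g2 :|: h2) :|: (g3 :|: h3) = h1 :|: (h2 :|: (h3 :|: G)).
  by apply/setP => v; rewrite !inE; do !case: (v \in _).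
have sub1 : g1 \subset h2 :|: (h3 :|: G).
  by apply/subsetP => v; rewrite !inE => ->; rewrite !orbT.
have sub2 : g2 \subset h3 :|: G by apply/subsetP => v; rewrite !inE => ->; rewrite !orbT.
have sub3 : g3 \subset G by apply/subsetP => v; rewrite !inE => ->; rewrite !orbT.
have := card_setU_overlap t_lt_r c1 i1 sub1.
have := card_setU_overlap t_lt_r c2 i2 sub2.
have := card_setU_overlap t_lt_r c3 i3 sub3.
by move: u t_lt_r; lia.
Qed.

Lemma eps_le1 : eps <= 1.
Proof.
apply: le_trans eps_small; rewrite ler_peMr // exprn_ege1 // ler1n //.
Qed.

(** Conflicts on exactly [M] vertices gain a factor 1 - eps^3 from each of the d labellings. Those
    on fewer vertices get the pointwise bound 4^d per copy; they are rarer by a factor n. *)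
Lemma EE_weight3 (p : F * F * F) : p \in conflicts ->
  EE (fun chi x => copy_weight chi x p.1.1 * copy_weight chi x p.1.2 * copy_weight chi x p.2)
  <= ((1 - eps ^+ 3) ^+ d + 64 ^+ d *
      (#|support p.1.1 :|: support p.1.2 :|: support p.2| <= M.-1)%:R) / mass ^+ 3.
Proof.
move=> pC; have [p1 p2 p3 [b1 [b2 [b3 bad]]]] := conflictsP pC.
have mp := mass_gt0.
have i0 : 0 <= (mass ^+ 3)^-1 by rewrite invr_ge0 exprn_ge0 // ltW.
have e0 : 0 <= 1 - eps ^+ 3 by rewrite subr_ge0 exprn_ile1 ?eps_le1.
case: (leqP #|support p.1.1 :|: support p.1.2 :|: support p.2| M.-1) => [small|large].
  apply: (@le_trans _ _ (64 ^+ d / mass ^+ 3)); last first.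
    by rewrite mulr1 ler_wpM2r // lerDr exprn_ge0.
  rewrite -(EE_cst (64 ^+ d / mass ^+ 3)); apply: EE_le => chi x.
  have -> : 64 ^+ d / mass ^+ 3 = 4 ^+ d / mass * (4 ^+ d / mass) * (4 ^+ d / mass) :> R.
    have -> : 64 = 4 * 4 * 4 :> R by ring.
    by move: (mass) (mp) => z zp; rewrite !exprMn; field; rewrite gt_eqF.
  have /andP[h1 h1'] := copy_weight_bounds chi x p.1.1.
  have /andP[h2 h2'] := copy_weight_bounds chi x p.1.2.
  have /andP[h3 h3'] := copy_weight_bounds chi x p.2.
  by apply: ler_pM => //; [exact: mulr_ge0|exact: ler_pM].
rewrite mulr0 addr0.
pose f (y : {ffun U -> X}) := ptilt p.1.1 y * (ptilt p.1.2 y * ptilt p.2 y).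
have f0 y : 0 <= f y.
  have /andP[h1 _] := pair_tilt_bounds y p1; have /andP[h2 _] := pair_tilt_bounds y p2.
  have /andP[h3 _] := pair_tilt_bounds y p3.
  by apply: mulr_ge0 => //; apply: mulr_ge0.
apply: (@le_trans _ _ (EE (fun chi x => (mass ^+ 3)^-1 * (1 * \prod_a f (x a))))).
  apply: EE_le => chi x; rewrite /copy_weight.
  have -> : p.1.1 \in injections m U by rewrite in_set; apply/injectiveP.
  have -> : p.1.2 \in injections m U by rewrite in_set; apply/injectiveP.
  have -> : p.2 \in injections m U by rewrite in_set; apply/injectiveP.
  have fE : \prod_a f (x a) =
      (\prod_a ptilt p.1.1 (x a)) * ((\prod_a ptilt p.1.2 (x a)) * (\prod_a ptilt p.2 (x a))).
    by rewrite -!big_split.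
  have F0 : 0 <= \prod_a f (x a) by apply: prodr_ge0.
  have -> (c1 c2 c3 : R) : 1%:R * c1 * (\prod_a ptilt p.1.1 (x a)) / mass *
     (1%:R * c2 * (\prod_a ptilt p.1.2 (x a)) / mass) *
     (1%:R * c3 * (\prod_a ptilt p.2 (x a)) / mass) =
     (mass ^+ 3)^-1 * ((c1 * c2 * c3) * \prod_a f (x a)).
    rewrite fE; move: (\prod_a _) (\prod_a _) (\prod_a _) => y1 y2 y3.
    by field; rewrite gt_eqF.
  rewrite ler_wpM2l // ler_wpM2r // -!natrM !mulnb.
  by case: (_ && _); rewrite ?ler01 ?lexx.
rewrite EEZ (EE_split (fun=> 1) (fun x => \prod_a f (x a))).
rewrite Ex_cst => [|j]; last by apply: unif_sum1; exact: X_gt0.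
rewrite mul1r E_label_prod mulrC ler_wpM2r //.
have Ef0 : 0 <= Ex (@unif R X U) f.
  apply: Ex_ge0 => // [j a|j]; first exact: unif_ge0.
  by apply: unif_sum1; exact: X_gt0.
rewrite lerXn2r ?nnegrE //.
by apply: (E_pair_tilt3 t_lt_r L eps_ge0 p1 p2 p3 bad); move: large; lia.
Qed.

Lemma EE_conflicts :
  EE (fun chi x => triple_sum conflicts (copy_weight chi x)) <=
    (M ^ (3 * m))%:R * (n%:R ^+ M * (1 - eps ^+ 3) ^+ d + n%:R ^+ M.-1 * 64 ^+ d)
      / mass ^+ 3.
Proof.
have mp := mass_gt0.
have i0 : 0 <= (mass ^+ 3)^-1 by rewrite invr_ge0 exprn_ge0 // ltW.
have e0 : 0 <= 1 - eps ^+ 3 by rewrite subr_ge0 exprn_ile1 ?eps_le1.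
have m0 : (0 < m)%N by move: t_lt_r; lia.
rewrite EE_sum; apply: le_trans (ler_sum _ EE_weight3) _.
rewrite -mulr_suml ler_wpM2r // big_split /= mulrDr; apply: lerD.
  rewrite sumr_const -[leLHS]mulr_natl mulrA ler_wpM2r ?exprn_ge0 //.
  rewrite -natrX -natrM ler_nat [X in (_ <= X)%N]mulnC; apply: leq_trans (card_small_triples M U m0).
  apply: subset_leq_card; apply/subsetP => p pC; rewrite in_set.
  by have := card_conflict pC; rewrite !supportE.
rewrite -mulr_sumr mulrC mulrA ler_wpM2r ?exprn_ge0 //.
pose S := [set p : F * F * F | (#|p.1.1 @: setT :|: p.1.2 @: setT :|: p.2 @: setT| <= M.-1)%N].
apply: (@le_trans _ _ #|S|%:R).
  rewrite -sum1_card natr_sum big_mkcond [leRHS]big_mkcond; apply: ler_sum => p _.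
  rewrite [p \in S]in_set !supportE //.
  by case: (p \in conflicts); case: (_ <= _)%N.
rewrite -natrX -natrM ler_nat [X in (_ <= X)%N]mulnC; apply: leq_trans (card_small_triples M.-1 U m0) _.
by rewrite leq_mul2l leq_exp2r ?leq_pred ?orbT // muln_gt0.
Qed.

End RandomWeights.

(** * From packings to sparse graphs *)

Section GraphOfPacking.

Lemma exists_subset (T : finType) (A : {set T}) (j : nat) : (j <= #|A|)%N ->
  exists2 B : {set T}, B \subset A & #|B| = j.
Proof.
move=> jA; have : (0 < #|[set B : {set T} | B \subset A & #|B| == j]|)%N.
  by rewrite cards_draws bin_gt0.
by rewrite card_gt0 => /set0Pn[B]; rewrite inE => /andP[BA /eqP Bj]; exists B.
Qed.

Lemma three_elements (T : finType) (A : {set T}) : #|A| = 3 ->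
  exists a b c, [/\ a != b, a != c, b != c & A = [set a; b; c]].
Proof.
move=> A3.
have /card_gt0P[a aA] : (0 < #|A|)%N by rewrite A3.
have := cardsD1 a A; rewrite aA A3 => -[/esym A2].
have /eqP/cards2P[b [c [bc Abc]]] := A2.
have : b \in A :\ a by rewrite Abc set21.
have : c \in A :\ a by rewrite Abc set22.
rewrite !inE => /andP[ca _] /andP[ba _].
exists a, b, c; split=> //; [by rewrite eq_sym|by rewrite eq_sym|].
by rewrite -(setD1K aA) Abc setUA.
Qed.

Variables (r t : nat).
Hypotheses (t_gt0 : (0 < t)%N) (t_lt_r : (t < r)%N).
Local Notation m := (2 * r - t)%N.
Local Notation k := (2 * 'C(r, t) - 1)%N.
Variables (U : finType) (L : nat).
Local Notation F := {ffun 'I_m -> U}.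
Variables (chi : {ffun {set U} -> 'I_L.+3}) (M : {set F}).
Hypothesis M_inj : forall psi, psi \in M -> injective psi.
Hypothesis M_cons : forall psi, psi \in M -> consistent chi psi.
Hypothesis M_disj : forall psi psi', psi \in M -> psi' \in M -> psi != psi' ->
  [disjoint shadow psi & shadow psi'].

Lemma no_common_shadow psi psi' (T : {set U}) : psi \in M -> psi' \in M -> psi != psi' ->
  T \in shadow psi -> T \in shadow psi' -> False.
Proof.
move=> pM pM' pp Ts Ts'; have /pred0P/(_ T) := M_disj pM pM' pp.
by rewrite /= Ts Ts'.
Qed.

Lemma packing_size : (k * #|M| <= 'C(#|U|, t))%N.
Proof.
rewrite mulnC -sum_nat_const.
apply: (@leq_trans (\sum_(psi in M) \sum_(T in [set T : {set U} | #|T| == t] | T \in shadow psi) 1)%N).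
  apply: leq_sum => psi pM; rewrite -(card_shadow t_lt_r (M_inj pM)) -sum1_card.
  rewrite big_mkcond [X in (_ <= X)%N]big_mkcond; apply: leq_sum => T _.
  case: (boolP (T \in shadow psi)) => // Ts; rewrite andbT in_set.
  by case/shadowP: Ts => ->; rewrite eqxx.
rewrite (exchange_big_dep (mem [set T : {set U} | #|T| == t])) /=; last by move=> psi T _ /andP[].
rewrite -(card_draws U t) -sum1_card; apply: leq_sum => T _.
rewrite sum1_card; apply/card_le1_eqP => psi psi'.
rewrite !unfold_in => /andP[pM /andP[_ Ts]] /andP[pM' /andP[_ Ts']].
by apply/eqP/contraT => pp; case: (no_common_shadow pM' pM pp Ts' Ts).
Qed.

Lemma edges_overlap psi psi' b b' : psi \in M -> psi' \in M -> psi != psi' ->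
  (#|edge psi b :&: edge psi' b'| < t)%N.
Proof.
move=> pM pM' pp; rewrite ltnNge; apply/negP => /exists_subset[T].
rewrite subsetI => /andP[Tb Tb'] Tt.
by apply: (no_common_shadow pM pM' pp (T := T)); apply/shadowP; split=> //; [exists b|exists b'].
Qed.

(** Otherwise the edge shares t vertices with the support of the pair. A t-set T among them is
    covered by the second pair, hence positive, and consistency makes the first pair cover it too,
    against disjointness of the shadows. *)
Lemma pair_and_edge psi psi' b b' : psi \in M -> psi' \in M -> psi != psi' ->
  (3 * r - 2 * t < #|edge psi b :|: edge psi (~~ b) :|: edge psi' b'|)%N.
Proof.
move=> pM pM' pp; rewrite ltnNge; apply/negP => small.
have sE : edge psi b :|: edge psi (~~ b) = support psi.
  by rewrite /support; case: b {small} => //=; rewrite setUC.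
rewrite sE in small.
have : (t <= #|support psi :&: edge psi' b'|)%N.
  have := cardsUI (support psi) (edge psi' b').
  rewrite (card_support t_lt_r (M_inj pM)) (card_edge t_lt_r (M_inj pM')).
  by move: small t_lt_r; lia.
move=> /exists_subset[T]; rewrite subsetI => /andP[Ts Tb'] Tt.
have Ts' : T \in shadow psi' by apply/shadowP; split=> //; exists b'.
apply: (no_common_shadow pM pM' pp _ Ts').
exact: consistent_shadow (M_cons pM) Tt Ts (consistent_pos (M_cons pM') Ts').
Qed.

Definition bad_triples : {set F * F * F} :=
  [set p in conflicts r t U | [&& p.1.1 \in M, p.1.2 \in M & p.2 \in M]].

(** Dropping the first pair of every bad triple costs at most two edges per triple. Three edges of
    the remaining graph then either include both edges of one pair, excluded by [pair_and_edge], or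
    come from three pairs and would form a bad triple. *)
Lemma graph_of_packing : exists G : {set {set U}},
  [/\ uniform r G, sparse (3 * r - 2 * t) 3 G & (2 * #|M| <= #|G| + 2 * #|bad_triples|)%N].
Proof.
pose M1 := M :\: [set p.1.1 | p in bad_triples].
have M1M psi : psi \in M1 -> psi \in M by rewrite in_setD => /andP[].
pose f (p : F * bool) := edge p.1 p.2.
pose G := f @: setX M1 [set: bool].
have GP g : g \in G -> exists2 psi, psi \in M1 & exists b, g = edge psi b.
  by move=> /imsetP[[psi b]]; rewrite in_setX /= => /andP[pM _] ->; exists psi => //; exists b.
have edge_neq psi b b' : psi \in M -> edge psi b = edge psi b' -> b = b'.
  move=> pM ebb; apply/eqP/contraT => bb.
  have b'E : b' = ~~ b by case: b b' bb {ebb} => [] [].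
  have := card_edgeI t_lt_r (M_inj pM) b; rewrite -b'E -ebb setIid.
  by rewrite (card_edge t_lt_r (M_inj pM)) => rt; move: t_lt_r; rewrite rt ltnn.
have edge_inj psi psi' b b' : psi \in M -> psi' \in M -> edge psi b = edge psi' b' -> psi = psi'.
  move=> pM pM' e; apply/eqP/contraT => pp.
  have := edges_overlap b b' pM pM' pp; rewrite -e setIid (card_edge t_lt_r (M_inj pM)).
  by rewrite ltnNge ltnW.
exists G; split.
- apply/forallP => g; apply/implyP => /GP[psi pM [b ->]].
  by rewrite (card_edge t_lt_r (M_inj (M1M _ pM))).
- apply/forallP => A; apply/implyP => /andP[/subsetP AG /eqP A3]; apply/negP => small.
  have [g1 [g2 [g3 [n12 n13 n23 AE]]]] := three_elements A3.
  have cE : cover A = g1 :|: g2 :|: g3.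
    by rewrite /cover AE !bigcup_setU !big_set1.
  rewrite cE in small.
  have [|psi1 p1 [b1 e1]] := GP g1; first by apply: AG; rewrite AE !inE eqxx.
  have [|psi2 p2 [b2 e2]] := GP g2; first by apply: AG; rewrite AE !inE eqxx orbT.
  have [|psi3 p3 [b3 e3]] := GP g3; first by apply: AG; rewrite AE !inE eqxx orbT.
  have m1 := M1M _ p1; have m2 := M1M _ p2; have m3 := M1M _ p3.
  have same psi psi' psi'' b b' b'' : psi \in M -> psi'' \in M -> psi = psi' ->
      edge psi b != edge psi' b' -> edge psi b != edge psi'' b'' ->
      edge psi' b' != edge psi'' b'' ->
      (#|edge psi b :|: edge psi' b' :|: edge psi'' b''| <= 3 * r - 2 * t)%N -> False.
    move=> pM pM'' <- ne ne1 ne2.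
    have b'E : b' = ~~ b by case: b b' ne {ne1 ne2} => [] []; rewrite ?eqxx.
    rewrite b'E leqNgt pair_and_edge //; apply/eqP => pp.
    move: ne1 ne2; rewrite -pp b'E {ne b'E}.
    by case: b b'' => [] [] /=; rewrite eqxx.
  subst g1 g2 g3.
  have [p12|p12] := eqVneq psi1 psi2; first by apply: (same psi1 psi2 psi3 b1 b2 b3).
  have [p13|p13] := eqVneq psi1 psi3.
    by apply: (same psi1 psi3 psi2 b1 b3 b2) => //; rewrite ?[edge psi3 _ == _]eq_sym // setUAC.
  have [p23|p23] := eqVneq psi2 psi3.
    apply: (same psi2 psi3 psi1 b2 b3 b1) => //; rewrite 1?eq_sym //.
    by rewrite setUC setUA.
  have bad : bad_edges r t (edge psi1 b1) (edge psi2 b2) (edge psi3 b3).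
    by apply/and4P; split=> //; apply: edges_overlap.
  have : psi1 \notin M1; last by rewrite p1.
  rewrite in_setD negb_and negbK m1 orbF; apply/imsetP.
  exists (psi1, psi2, psi3) => //; apply/setIdP; rewrite /= m1 m2 m3; split=> //.
  rewrite in_set /= p12 p13 p23 !in_set /=.
  have Mi psi : psi \in M -> injectiveb psi by move=> /M_inj pI; apply/injectiveP.
  rewrite !Mi //=.
  by apply/existsP; exists b1; apply/existsP; exists b2; apply/existsP; exists b3.
- have -> : #|G| = (2 * #|M1|)%N.
    rewrite card_in_imset; first by rewrite cardsX cardsT card_bool mulnC.
    move=> [psi b] [psi' b']; rewrite !in_setX !in_setT !andbT /= => /M1M pM /M1M pM' e.
    have pp := edge_inj _ _ _ _ pM pM' e; rewrite /f /= -pp in e.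
    by rewrite pp (edge_neq _ _ _ pM e).
  rewrite -mulnDr leq_mul2l /=.
  rewrite -(cardsID [set p.1.1 | p in bad_triples] M) addnC leq_add2l.
  apply: leq_trans (leq_imset_card (fun p => p.1.1) bad_triples).
  by apply: subset_leq_card; apply: subsetIr.
Qed.

End GraphOfPacking.

(** * Lower bound for the extremal number *)

Section LowerBound.
Variable R : realType.

Lemma ffact_ge (n m : nat) : (2 * m <= n)%N -> (n ^ m <= 2 ^ m * n ^_ m)%N.
Proof.
elim: m => [|m IH] mn //.
rewrite ffactnSr !expnS; have := IH (leq_trans _ mn); rewrite leq_mul2l leqnSn orbT => /(_ isT) h.
have n2 : (n <= 2 * (n - m))%N by move: mn; lia.
apply: leq_trans (leq_mul n2 h) _; rewrite leq_eqVlt; apply/orP; left; apply/eqP; lia.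
Qed.

Lemma ffact_le_exp (n m : nat) : (n ^_ m <= n ^ m)%N.
Proof.
elim: m => [|m IH] //.
by rewrite ffactnSr expnSr; apply: leq_mul => //; exact: leq_subr.
Qed.

Lemma bin_le_exp (n m : nat) : ('C(n, m) <= n ^ m)%N.
Proof.
apply: leq_trans (ffact_le_exp n m); rewrite -bin_ffact.
by apply: leq_pmulr; exact: fact_gt0.
Qed.

Lemma exists_small_exp (y e : R) : 0 <= y -> y < 1 -> 0 < e -> exists d : nat, y ^+ d <= e.
Proof.
move=> y0 y1 e0.
set z := 1 - y; have z0 : 0 < z by rewrite subr_gt0.
pose d := Num.bound (e^-1 / z).
have dz : e^-1 / z < d%:R by apply: archi_boundP; rewrite divr_ge0 ?invr_ge0 // ltW.
exists d; apply: (@le_trans _ _ (expR (- (d%:R * z)))).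
  have -> : - (d%:R * z) = - z * d%:R by ring.
  rewrite expRM_natr lerXn2r ?nnegrE ?expR_ge0 //.
  by apply: le_trans (expR_ge1Dx _); rewrite /z; lra.
rewrite expRN -[e]invrK lef_pV2 ?posrE ?expR_gt0 ?invr_gt0 //.
rewrite ltr_pdivrMr // in dz.
by have := expR_ge1Dx (d%:R * z); move: dz; lra.
Qed.

Section FixedParameters.
Variables (r t : nat).
Hypotheses (t_gt0 : (0 < t)%N) (t_lt_r : (t < r)%N).
Local Notation m := (2 * r - t)%N.
Local Notation k := (2 * 'C(r, t) - 1)%N.
Local Notation M := (6 * r - 5 * t)%N.
Variables (n L d : nat) (eps e1 Theta b : R).
Local Notation U := 'I_n.
Local Notation pos := (@prob_pos R L).
Local Notation q := (@prob_consistent r t R L).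
Local Notation K := (4 ^+ d * pos / q).
Hypothesis n_large : (2 * m <= n)%N.
Hypothesis eps_ge0 : 0 <= eps.
Hypothesis eps_small : eps * (2 * L.+3)%:R ^+ r <= 1.
Hypotheses (e1_ge0 : 0 <= e1) (Theta_ge0 : 0 <= Theta) (b_ge0 : 0 <= b).
Hypothesis nib : nibble_guarantee k e1 K b Theta.

Let rho : R := copies_per_larger_set r t U R / copies_per_set r t U R.
Let conflict_bound : R :=
  (M ^ (3 * m))%:R * (n%:R ^+ M * (1 - eps ^+ 3) ^+ d + n%:R ^+ M.-1 * 64 ^+ d)
      / mass r t U R L ^+ 3.
(** In order: negative t-sets, t-sets left by the nibble, irregularity together with codegree, and
    conflicts. *)
Let loss : R := 'C(n, t)%:R * (prob_neg R L + e1 + b * ((m%:R * K ^+ 2 + K) * rho))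
  + Theta * conflict_bound.

Let m_le_n : (m <= #|U|)%N. Proof. by rewrite card_ord; move: n_large; lia. Qed.

Lemma random_graph : exists G : {set {set U}},
  [/\ uniform r G, sparse (3 * r - 2 * t) 3 G &
   2 * 'C(n, t)%:R - (2 + 2 * k%:R) * loss <= k%:R * #|G|%:R].
Proof.
have pos0 := prob_pos_gt0 R L; have q0 := prob_consistent_gt0 r t R L.
have cp0 := copies_per_set_gt0 t_gt0 t_lt_r R m_le_n.
have mp := mass_gt0 t_gt0 t_lt_r R L m_le_n.
have rho0 : 0 <= rho.
  by apply: divr_ge0; [apply: divr_ge0 => //; apply: mulr_ge0|exact: ltW].
have K0 : 0 <= K by apply: divr_ge0; [apply: mulr_ge0; [exact: exprn_ge0|exact: ltW]|exact: ltW].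
pose A (chi : {ffun {set U} -> 'I_L.+3}) := positive_sets t chi.
pose w chi x := @copy_weight r t U R L d eps chi x.
(* By the nibble, this bounds the number of t-sets missed by the packing plus its number of bad
   triples; |A| is replaced by C(n, t) in the error terms. *)
pose f chi x := ('C(n, t)%:R + (e1 * 'C(n, t)%:R + b * (K * rho * 'C(n, t)%:R)))
  + ((- 1) * #|A chi|%:R + b * irreg_sqr (@shadow r t U) (w chi x) (A chi)
  + Theta * triple_sum (conflicts r t U) (w chi x)).
have Ef : EE f <= loss.
  rewrite /f !EED !EEZ EE_cst.
  have h1 := EE_irreg t_gt0 t_lt_r d m_le_n eps_ge0 eps_small.
  have h2 := EE_conflicts t_gt0 t_lt_r d m_le_n eps_ge0 eps_small.
  have h3 : EE (fun (chi : {ffun {set U} -> 'I_L.+3}) (x : {ffun 'I_d -> {ffun U -> 'I_L.+3}}) =>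
      #|A chi|%:R) = 'C(n, t)%:R * pos.
    rewrite (EE_eq (g := fun chi x => \sum_(T in [set T : {set U} | #|T| == t]) (chi T != ord0)%:R)).
      rewrite EE_sum; under eq_bigr => T _ do rewrite E_positive.
      by rewrite sumr_const card_draws card_ord mulr_natl.
    move=> chi x; rewrite -sum1_card natr_sum big_mkcond [RHS]big_mkcond; apply: eq_bigr => T _.
    by rewrite !in_set; case: (#|T| == t); case: (chi T != ord0).
  have h1' := ler_wpM2l b_ge0 h1; have h2' := ler_wpM2l Theta_ge0 h2.
  rewrite card_ord in h1' h2'.
  have h4 : 'C(n, t)%:R * pos = 'C(n, t)%:R - 'C(n, t)%:R * prob_neg R L.
    by rewrite prob_posE; ring.
  rewrite h3 h4; move: h1' h2'; rewrite -/rho -/conflict_bound /loss.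
  move: (K) (EE _) (EE _) => K' E1 E2; lra.
have [chi [x fx]] := EE_exists Ef.
have AC : #|A chi|%:R <= 'C(n, t)%:R :> R.
  rewrite ler_nat -[X in 'C(X, _)]card_ord -card_draws; apply: subset_leq_card.
  by apply/subsetP => T; rewrite !in_set => /andP[].
have [||||||N [Nw Nd] bN] := nib (e := @shadow r t U) (w := w chi x) (A := A chi)
  (B := conflicts r t U) (delta := K * rho).
- by move=> psi; apply: copy_weight_ge0.
- by move=> psi /(copy_weight_supp t_lt_r)[_ _].
- by move=> T; apply: copy_deg_le.
- move=> S T ST; apply: le_trans (copy_codeg_le t_gt0 t_lt_r m_le_n eps_ge0 eps_small chi x ST) _.
  rewrite le_eqVlt; apply/orP; left; apply/eqP.
  by rewrite /rho /mass; field; rewrite !gt_eqF.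
- exact: mulr_ge0.
- exact: conflicts_spread.
have Nsupp psi : psi \in N -> injective psi /\ consistent chi psi.
  by move=> /Nw[/lt0r_neq0/(copy_weight_supp t_lt_r)[]].
have Ninj psi : psi \in N -> injective psi by move=> /Nsupp[].
have [G [Gu Gs GN]] := graph_of_packing t_gt0 t_lt_r Ninj (fun psi h => (Nsupp psi h).2) Nd.
exists G; split=> //.
have NC := packing_size t_lt_r Ninj Nd; rewrite card_ord in NC.
have NC' : k%:R * #|N|%:R <= 'C(n, t)%:R :> R by rewrite -natrM ler_nat.
have GN' : 2 * #|N|%:R <= #|G|%:R + 2 * #|bad_triples N|%:R :> R.
  by rewrite -!natrM -natrD ler_nat.
have badE : triple_sum (conflicts r t U) (fun psi => (psi \in N)%:R) = #|bad_triples N|%:R :> R.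
  rewrite /triple_sum -sum1_card natr_sum big_mkcond [RHS]big_mkcond; apply: eq_bigr => p _ /=.
  rewrite [p \in bad_triples N]in_set; case: (p \in conflicts r t U) => //=.
  by rewrite -!natrM !mulnb -andbA; case: (_ && _).
rewrite badE in bN.
have bad0 : 0 <= #|bad_triples N|%:R :> R by [].
have e1A := ler_wpM2l e1_ge0 AC.
have bA : b * (K * rho * #|A chi|%:R) <= b * (K * rho * 'C(n, t)%:R).
  by rewrite ler_wpM2l // ler_wpM2l // mulr_ge0.
have tot : 'C(n, t)%:R - k%:R * #|N|%:R + #|bad_triples N|%:R <= loss.
  by move: fx bN e1A bA; rewrite /f /w; lra.
have k0 : 0 <= k%:R :> R by [].
have kG := ler_wpM2l k0 GN'.
(* As k |N| <= C(n, t), the loss bounds the bad triples alone. Missed t-sets then cost 2 loss and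
   deletions 2 k loss, whence the factor 2 + 2 k. *)
have bl : #|bad_triples N|%:R <= loss by move: tot NC'; lra.
have kbl := ler_wpM2l k0 bl.
move: kG kbl tot; lra.
Qed.

End FixedParameters.

(** * Choosing the parameters and letting n grow *)

Section Asymptotics.
Variables (r t : nat).
Hypotheses (t_gt0 : (0 < t)%N) (t_lt_r : (t < r)%N).
Local Notation m := (2 * r - t)%N.
Local Notation k := (2 * 'C(r, t) - 1)%N.
Local Notation M := (6 * r - 5 * t)%N.

Lemma mass_ge (n L : nat) : (2 * m <= n)%N ->
  k%:R * prob_consistent r t R L / (prob_pos R L * 2 ^+ m) * n%:R ^+ (m - t)
    <= mass r t 'I_n R L.
Proof.
move=> mn; have pos0 := prob_pos_gt0 R L; have q0 := prob_consistent_gt0 r t R L.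
have tn : (t <= n)%N by apply: leq_trans mn; clear -t_lt_r; lia.
have m_le : (m <= n)%N by apply: leq_trans mn; rewrite leq_pmull.
have C0 : 0 < 'C(n, t)%:R :> R by rewrite ltr0n bin_gt0.
rewrite /mass /copies_per_set card_ord.
have -> : k%:R * (n ^_ m)%:R / 'C(n, t)%:R * prob_consistent r t R L / prob_pos R L =
   k%:R * prob_consistent r t R L / prob_pos R L * ((n ^_ m)%:R / 'C(n, t)%:R) by ring.
have -> : k%:R * prob_consistent r t R L / (prob_pos R L * 2 ^+ m) * n%:R ^+ (m - t) =
   k%:R * prob_consistent r t R L / prob_pos R L * (n%:R ^+ (m - t) / 2 ^+ m) :> R.
  by field; rewrite !gt_eqF ?exprn_gt0.
rewrite ler_wpM2l //.
  by apply: divr_ge0; [apply: mulr_ge0 => //; exact: ltW|exact: ltW].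
rewrite ler_pdivlMr // mulrAC ler_pdivrMr ?exprn_gt0 //.
rewrite -!natrX -!natrM ler_nat.
apply: (@leq_trans (n ^ (m - t) * n ^ t)); first by rewrite leq_mul2l bin_le_exp orbT.
rewrite -expnD subnK; last by clear -t_lt_r; lia.
by rewrite [X in (_ <= X)%N]mulnC ffact_ge.
Qed.

Lemma ratio_le (n : nat) : (2 * m <= n)%N ->
  copies_per_larger_set r t 'I_n R / copies_per_set r t 'I_n R <=
    2 * 'C(m, t.+1)%:R * t.+1%:R / n%:R.
Proof.
move=> mn.
have tn : (2 * t < n)%N by apply: leq_trans mn; clear -t_lt_r; lia.
have n0 : (0 : R) < n%:R by rewrite ltr0n (leq_ltn_trans _ tn).
have m_le : (m <= n)%N by apply: leq_trans mn; rewrite leq_pmull.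
have C0 : 0 < 'C(n, t)%:R :> R by rewrite ltr0n bin_gt0; clear -tn; lia.
have C1 : 0 < 'C(n, t.+1)%:R :> R by rewrite ltr0n bin_gt0; clear -tn; lia.
have f0 : 0 < (n ^_ m)%:R :> R by rewrite ltr0n ffact_gt0.
have k0 : (1 <= k%:R :> R) by rewrite ler1n k_gt0.
have kp : 0 < k%:R :> R by apply: lt_le_trans k0.
rewrite /copies_per_larger_set /copies_per_set card_ord.
have -> : 'C(m, t.+1)%:R * (n ^_ m)%:R / 'C(n, t.+1)%:R / (k%:R * (n ^_ m)%:R / 'C(n, t)%:R) =
  'C(m, t.+1)%:R / k%:R * ('C(n, t)%:R / 'C(n, t.+1)%:R) :> R.
  by field; rewrite !gt_eqF.
have h1 : 'C(m, t.+1)%:R / k%:R <= 'C(m, t.+1)%:R :> R.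
  by rewrite ler_pdivrMr // ler_peMr.
have h2 : 'C(n, t)%:R / 'C(n, t.+1)%:R <= 2 * t.+1%:R / n%:R :> R.
  rewrite ler_pdivrMr // mulrAC ler_pdivlMr // -mulrA -!natrM ler_nat mul_bin_left.
  by rewrite [(_ * n)%N]mulnC mulnA leq_mul2r; apply/orP; right; clear -tn; lia.
have -> : 2 * 'C(m, t.+1)%:R * t.+1%:R / n%:R = 'C(m, t.+1)%:R * (2 * t.+1%:R / n%:R) :> R by ring.
apply: ler_pM => //; first by apply: divr_ge0.
by apply: divr_ge0.
Qed.

(** The parameters are chosen in the order [e1], [Theta], [L], [eps], [d], [K], [b], and finally n
    large; each may depend on the earlier ones only. *)
Lemma extremal_lower (e : R) : 0 < e ->
  exists n0, forall n, (n0 <= n)%N ->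
    2 * 'C(n, t)%:R - e * n%:R ^+ t <= k%:R * (extremal r n (3 * r - 2 * t) 3)%:R.
Proof.
move=> e0.
have k1 : 0 <= k%:R :> R by [].
(* The loss will be at most 5 e1 n^t, three shares from the t-sets and two from the conflicts, and
   it enters with the factor 2 + 2 k. *)
pose e1 : R := e / (10 + 10 * k%:R).
have e1p : 0 < e1 by rewrite divr_gt0 // ltr_pwDl // mulr_ge0.
have e1E : (2 + 2 * k%:R) * (5 * e1) = e.
  by rewrite /e1; field; rewrite gt_eqF // ltr_pwDl // mulr_ge0.
have [Theta Th0 nibK] := nibble (k_gt0 t_lt_r) e1p.
pose L := Num.bound e1^-1.
have neg_le : prob_neg R L <= e1.
  have : e1^-1 < L%:R by apply: archi_boundP; rewrite invr_ge0 ltW.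
  rewrite /prob_neg -[leRHS]invrK => h; rewrite lef_pV2 ?posrE ?ltr0n ?invr_gt0 //.
  by apply: ltW; apply: lt_le_trans h _; rewrite ler_nat -addn3 leq_addr.
pose eps : R := ((2 * L.+3)%:R ^+ r)^-1.
have pr : 0 < (2 * L.+3)%:R ^+ r :> R by rewrite exprn_gt0 // ltr0n.
have eps0 : 0 < eps by rewrite invr_gt0.
have eps_small : eps * (2 * L.+3)%:R ^+ r <= 1 by rewrite mulVf // gt_eqF.
have pos0 := prob_pos_gt0 R L; have q0 := prob_consistent_gt0 r t R L.
pose c1 : R := k%:R * prob_consistent r t R L / (prob_pos R L * 2 ^+ m).
have kp : 0 < k%:R :> R by rewrite ltr0n k_gt0.
have c1p : 0 < c1 by apply: divr_gt0; apply: mulr_gt0 => //; exact: exprn_gt0.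
pose C1 : R := Theta * (M ^ (3 * m))%:R / c1 ^+ 3.
have C10 : 0 <= C1 by apply: divr_ge0; [exact: mulr_ge0|exact/exprn_ge0/ltW].
(* [C1] contains [Theta] but not d, so enough labellings bring the leading conflict term below
   e1. *)
have [d dE] : exists d : nat, (1 - eps ^+ 3) ^+ d <= e1 / (C1 + 1).
  apply: exists_small_exp.
  - rewrite subr_ge0 exprn_ile1 ?(ltW eps0) //; apply: le_trans eps_small.
    by rewrite ler_peMr ?(ltW eps0) // exprn_ege1 // ler1n.
  - by rewrite ltrBlDr ltrDl exprn_gt0.
  - by rewrite divr_gt0 // ltr_wpDl.
have dE' : C1 * (1 - eps ^+ 3) ^+ d <= e1.
  have h := ler_wpM2l C10 dE; apply: le_trans h _.
  rewrite mulrCA ler_piMr ?(ltW e1p) // ler_pdivrMr ?ltr_wpDl // mul1r; lra.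
pose K : R := 4 ^+ d * prob_pos R L / prob_consistent r t R L.
have K0 : 0 <= K by apply: divr_ge0; [apply: mulr_ge0; [exact: exprn_ge0|exact: ltW]|exact: ltW].
have [b b0 nib] := nibK K K0.
pose C2 : R := b * ((m%:R * K ^+ 2 + K) * (2 * 'C(m, t.+1)%:R * t.+1%:R)).
have X0 : 0 <= m%:R * K ^+ 2 + K by apply: addr_ge0 => //; apply: mulr_ge0 => //; exact: sqr_ge0.
have C20 : 0 <= C2 by apply: mulr_ge0 => //; apply: mulr_ge0 => //; apply: mulr_ge0 => //; exact: mulr_ge0.
pose C3 : R := C1 * 64 ^+ d.
have C30 : 0 <= C3 by apply: mulr_ge0 => //; exact: exprn_ge0.
exists (2 * m + Num.bound (C2 / e1) + Num.bound (C3 / e1))%N => n n_ge.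
have n_large : (2 * m <= n)%N by apply: leq_trans n_ge; rewrite -addnA leq_addr.
have n0 : (0 : R) < n%:R.
  by rewrite ltr0n; apply: leq_trans n_large; clear -t_lt_r; lia.
have small (C : R) : 0 <= C -> (Num.bound (C / e1) <= n)%N -> C / n%:R <= e1.
  move=> C0 bn; rewrite ler_pdivrMr // mulrC -ler_pdivrMr //; apply: ltW.
  apply: (@lt_le_trans _ _ (Num.bound (C / e1))%:R); last by rewrite ler_nat.
  by apply: archi_boundP; apply: divr_ge0 => //; exact: ltW.
have C2n : C2 / n%:R <= e1.
  by apply: small => //; apply: leq_trans n_ge; rewrite addnAC leq_addl.
have C3n : C3 / n%:R <= e1.
  by apply: small => //; apply: leq_trans n_ge; rewrite leq_addl.
have [G [Gu Gs GC]] := random_graph t_gt0 t_lt_r n_large (ltW eps0) eps_small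
  (ltW e1p) Th0 b0 nib.
have Gext : #|G|%:R <= (extremal r n (3 * r - 2 * t) 3)%:R :> R.
  by rewrite ler_nat /extremal; apply: (leq_bigmax_cond (F := fun E : {set {set 'I_n}} => #|E|)); rewrite Gu Gs.
apply: le_trans (ler_wpM2l k1 Gext); apply: le_trans GC.
rewrite lerD2l lerN2 -e1E -[leRHS]mulrA; apply: ler_wpM2l; first by rewrite addr_ge0 // mulr_ge0.
set N := n%:R ^+ t : R.
have N0 : 0 <= N by exact: exprn_ge0.
have CN : 'C(n, t)%:R <= N by rewrite /N -natrX ler_nat bin_le_exp.
have part1 : 'C(n, t)%:R * (prob_neg R L + e1 + b * ((m%:R * K ^+ 2 + K) *
    (copies_per_larger_set r t 'I_n R / copies_per_set r t 'I_n R))) <= N * (3 * e1).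
  have rho_le := ratio_le n_large.
  have h : b * ((m%:R * K ^+ 2 + K) *
    (copies_per_larger_set r t 'I_n R / copies_per_set r t 'I_n R)) <= e1.
    apply: le_trans C2n; rewrite /C2 -!mulrA ler_wpM2l // ler_wpM2l // !mulrA //.
  apply: (@le_trans _ _ ('C(n, t)%:R * (3 * e1))); last by rewrite ler_wpM2r // mulr_ge0 // ltW.
  by rewrite ler_wpM2l //; move: neg_le h; lra.
have part2 : Theta * ((M ^ (3 * m))%:R * (n%:R ^+ M * (1 - eps ^+ 3) ^+ d + n%:R ^+ M.-1 * 64 ^+ d)
      / mass r t 'I_n R L ^+ 3) <= N * (2 * e1).
  set y := (1 - eps ^+ 3) ^+ d in dE' *.
  have y0 : 0 <= y.
    apply: exprn_ge0; rewrite subr_ge0 exprn_ile1 ?(ltW eps0) //; apply: le_trans eps_small.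
    by rewrite ler_peMr ?(ltW eps0) // exprn_ege1 // ler1n.
  have mg := mass_ge L n_large; rewrite -/c1 in mg.
  set ms := mass _ _ _ _ _ in mg *.
  set Z := n%:R ^+ (m - t) : R in mg.
  have Z0 : 0 < Z by rewrite exprn_gt0.
  (* M = t + 3 (m - t): about n^M conflicts, each weighted by the inverse cube of a mass of order
     n^(m - t), give exactly the critical order n^t. *)
  have ZM : n%:R ^+ M = N * Z ^+ 3 :> R.
    rewrite /N /Z -exprM -exprD; congr (_ ^+ _); clear -t_lt_r; lia.
  have ZM1 : n%:R ^+ M.-1 = N * Z ^+ 3 / n%:R :> R.
    rewrite -ZM -[X in _ = _ ^+ X / _](prednK (n := M)); last by clear -t_lt_r; lia.
    by rewrite exprSr mulfK // gt_eqF.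
  have m3 : c1 ^+ 3 * Z ^+ 3 <= ms ^+ 3.
    rewrite -exprMn lerXn2r ?nnegrE //; last by apply: le_trans mg; rewrite mulr_ge0 ?ltW.
    by rewrite mulr_ge0 ?ltW.
  have cz : 0 < c1 ^+ 3 * Z ^+ 3 by rewrite mulr_gt0 ?exprn_gt0.
  apply: (@le_trans _ _ (Theta * ((M ^ (3 * m))%:R *
     (N * Z ^+ 3 * y + N * Z ^+ 3 / n%:R * 64 ^+ d) / (c1 ^+ 3 * Z ^+ 3)))).
    rewrite ZM ZM1 ler_wpM2l // ler_wpM2l //; last by rewrite lef_pV2 ?posrE // (lt_le_trans cz).
    by nonneg; rewrite ?invr_ge0; nonneg.
  have -> : Theta * ((M ^ (3 * m))%:R *
     (N * Z ^+ 3 * y + N * Z ^+ 3 / n%:R * 64 ^+ d) / (c1 ^+ 3 * Z ^+ 3)) =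
     N * (C1 * y + C3 / n%:R).
    by rewrite /C3 /C1; field; rewrite !gt_eqF.
  by rewrite ler_wpM2l //; move: dE' C3n; lra.
move: part1 part2; rewrite -/K; lra.
Qed.

End Asymptotics.
End LowerBound.

(** * The upper bound and the limit *)

Section UpperBound.
Variables (r t : nat).
Hypotheses (t_gt0 : (0 < t)%N) (t_lt_r : (t < r)%N).
Variable U : finType.
Local Notation n := #|U|.

Lemma double_count (A : {set {set U}}) (j : nat) :
  (forall e, e \in A -> #|e| = r) ->
  (\sum_(T in [set T : {set U} | #|T| == j]) #|[set e in A | T \subset e]|
    = #|A| * 'C(r, j))%N.
Proof.
move=> Ar.
under eq_bigr => T _ do rewrite -sum1_card.
rewrite (exchange_big_dep (mem A)) /=; last by move=> T e _ /setIdP[].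
rewrite -sum_nat_const; apply: eq_bigr => e eA.
rewrite sum1_card -(Ar e eA) -cards_draws; apply: eq_card => T.
by rewrite unfold_in !in_set eA andbC.
Qed.

Variable E : {set {set U}}.
Hypothesis E_unif : uniform r E.
Hypothesis E_sparse : sparse (3 * r - 2 * t) 3 E.

Let E_card e : e \in E -> #|e| = r.
Proof. by move=> eE; apply/eqP; move/forallP/(_ e)/implyP: E_unif; apply. Qed.

Lemma sparse_triple a b c : a \in E -> b \in E -> c \in E ->
  a != b -> a != c -> b != c -> (3 * r - 2 * t < #|a :|: b :|: c|)%N.
Proof.
move=> aE bE cE ab ac bc; have /forallP/(_ [set a; b; c]) := E_sparse.
have -> : #|[set a; b; c]| == 3.
  by rewrite setUC cardsU1 cards2 !inE ![c == _]eq_sym (negPf ac) (negPf bc) ab.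
rewrite !subUset !sub1set aE bE cE /=.
by rewrite -ltnNge /cover !bigcup_setU !big_set1.
Qed.

Lemma sparse_overlap a b c : a \in E -> b \in E -> c \in E ->
  a != b -> a != c -> b != c -> (#|a :&: b| + #|(a :|: b) :&: c| < 2 * t)%N.
Proof.
move=> aE bE cE ab ac bc; have := sparse_triple aE bE cE ab ac bc.
have := cardsUI a b; have := cardsUI (a :|: b) c.
by rewrite (E_card aE) (E_card bE) (E_card cE); clear -t_lt_r; lia.
Qed.

Definition heavy : {set {set U}} :=
  [set e in E | [exists f in E, (f != e) && (t < #|e :&: f|)%N]].

(** Suppose three heavy edges contain the same (t-1)-set, and let the first meet f in at least t + 1
    vertices. One of the other two differs from f; with it the overlaps reach (t + 1) + (t - 1) =
    2t, contradicting [sparse_overlap]. *)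
Lemma card_heavy : (#|heavy| <= 2 * 'C(n, t.-1))%N.
Proof.
have hE e : e \in heavy -> e \in E by move=> /setIdP[].
have Cr : (0 < 'C(r, t.-1))%N by rewrite bin_gt0; clear -t_lt_r; lia.
apply: (@leq_trans (#|heavy| * 'C(r, t.-1))); first exact: leq_pmulr.
rewrite -double_count; last by move=> e /hE /E_card.
rewrite mulnC -card_draws -sum_nat_const; apply: leq_sum => S; rewrite in_set => /eqP St.
rewrite leqNgt; apply/negP => /card_gt2P[e1 [e2 [e3 [[h1 h2 h3] [n12 n23 n31]]]]].
have {h1}[h1 s1] := setIdP h1; have {h2}[h2 s2] := setIdP h2; have {h3}[h3 s3] := setIdP h3.
have /setIdP[e1E /existsP[f /andP[fE /andP[fe1 big]]]] := h1.
have key e : e \in E -> S \subset e -> e1 != e -> f != e -> False.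
  move=> eE Se ne nf; have := sparse_overlap e1E fE eE _ ne nf.
  rewrite eq_sym => /(_ fe1).
  have : (t.-1 <= #|(e1 :|: f) :&: e|)%N.
    by rewrite -St; apply: subset_leq_card; rewrite subsetI Se subsetU ?s1.
  by move: big t_gt0; clear; lia.
have [fe2|fe2] := eqVneq f e2; last by apply: (key e2) => //; exact: hE.
by apply: (key e3) => //; [exact: hE|rewrite eq_sym|rewrite fe2].
Qed.

Definition light : {set {set U}} := E :\: heavy.

Lemma card_light : (#|light| * (2 * 'C(r, t) - 1) <= 2 * 'C(n, t))%N.
Proof.
have lE e : e \in light -> e \in E by rewrite in_setD => /andP[].
have light_overlap e f : e \in light -> f \in E -> f != e -> (#|e :&: f| <= t)%N.
  rewrite in_setD => /andP[nh eE] fE fe; rewrite leqNgt; apply: contra nh => big.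
  by apply/setIdP; split=> //; apply/existsP; exists f; rewrite fE fe.
pose D (T : {set U}) := [set e in light | T \subset e].
pose Ts := [set T : {set U} | #|T| == t].
(* Three edges through one t-set would have overlaps t + t. *)
have D2 T : T \in Ts -> (#|D T| <= 2)%N.
  rewrite in_set => /eqP Tt; rewrite leqNgt; apply/negP.
  move=> /card_gt2P[e1 [e2 [e3 [[/setIdP[h1 s1] /setIdP[h2 s2] /setIdP[h3 s3]] [n12 n23 n31]]]]].
  have := sparse_overlap (lE _ h1) (lE _ h2) (lE _ h3) n12 _ n23; rewrite eq_sym => /(_ n31).
  have : (t <= #|e1 :&: e2|)%N by rewrite -Tt; apply: subset_leq_card; rewrite subsetI s1.
  have : (t <= #|(e1 :|: e2) :&: e3|)%N.
    by rewrite -Tt; apply: subset_leq_card; rewrite subsetI s3 subsetU ?s1.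
  by clear; lia.
pose N2 := [set T in Ts | #|D T| == 2].
have sumD : (\sum_(T in Ts) #|D T| = #|light| * 'C(r, t))%N.
  by apply: double_count => e /lE /E_card.
have le1 : (#|light| * 'C(r, t) <= 'C(n, t) + #|N2|)%N.
  rewrite -sumD -card_draws -[#|N2|]sum1_card -[#|[set _ | _]|]sum1_card.
  rewrite -/Ts [X in (_ <= _ + X)%N]big_mkcond [X in (_ <= X + _)%N]big_mkcond -big_split /=.
  rewrite big_mkcond; apply: leq_sum => T _.
  case: (boolP (T \in Ts)) => // TT; rewrite [T \in N2]in_set TT.
  by have := D2 T TT; case: #|D T| => [|[|[|]]].
(* A light edge contains at most one doubly covered t-set. Given two such sets, either they have the
   same second edge, which overlaps the first in more than t vertices, or two different ones, and
   the three edges have overlaps at least t + t. *)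
have le2 : (2 * #|N2| <= #|light|)%N.
  have -> : (2 * #|N2| = \sum_(T in N2) #|D T|)%N.
    rewrite mulnC -sum_nat_const; apply: eq_bigr => T.
    by rewrite in_set => /andP[_ /eqP].
  under eq_bigr => T _ do rewrite -sum1_card.
  rewrite (exchange_big_dep (mem light)) /=; last by move=> T e _ /setIdP[].
  rewrite -[X in (_ <= X)%N]sum1_card; apply: leq_sum => e el; rewrite sum1_card.
  apply/card_le1_eqP => T1 T2; rewrite !unfold_in => /andP[T1N /setIdP[_ s1]] /andP[T2N /setIdP[_ s2]].
  apply/eqP/contraT => T21.
  have partner T : T \in N2 -> T \subset e -> exists2 f, f \in light & f != e /\ T \subset f.
    rewrite in_set => /andP[_ /cards2P[a [b [ab Dab]]]] Te.
    have /setIdP[al Ta] : a \in D T by rewrite Dab set21.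
    have /setIdP[bl Tb] : b \in D T by rewrite Dab set22.
    have : e \in D T by apply/setIdP.
    rewrite Dab in_set2 => /orP[/eqP ->|/eqP ->]; first by exists b => //; rewrite eq_sym.
    by exists a.
  have cN T : T \in N2 -> #|T| = t by rewrite !in_set => /andP[/eqP].
  have [f fl [fe s1f]] := partner _ T1N s1; have [f' fl' [fe' s2f]] := partner _ T2N s2.
  have [ff|ff] := eqVneq f f'.
    have := light_overlap _ _ el (lE _ fl) fe; rewrite leqNgt => /negP[].
    have U12 : T1 :|: T2 \subset e :&: f by rewrite subUset !subsetI s1 s2 s1f ff s2f.
    apply: leq_trans (subset_leq_card U12).
    rewrite -(cN _ T1N); apply: proper_card; rewrite properE subsetUl subUset subxx /=.
    by apply: contra T21 => T2T1; rewrite eqEcard T2T1 (cN _ T1N) (cN _ T2N) leqnn.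
  have ef : e != f by rewrite eq_sym.
  have ef' : e != f' by rewrite eq_sym.
  have := sparse_overlap (lE _ el) (lE _ fl) (lE _ fl') ef ef' ff.
  have : (t <= #|e :&: f|)%N by rewrite -(cN _ T1N); apply: subset_leq_card; rewrite subsetI s1.
  have : (t <= #|(e :|: f) :&: f'|)%N.
    by rewrite -(cN _ T2N); apply: subset_leq_card; rewrite subsetI s2f subsetU ?s2.
  by clear; lia.
rewrite mulnBr muln1 leq_subLR mulnCA.
by apply: leq_trans (leq_mul (leqnn 2) le1) _; rewrite mulnDr addnC leq_add2r.
Qed.

Lemma card_sparse : (#|E| * (2 * 'C(r, t) - 1) <=
  2 * 'C(n, t) + 2 * (2 * 'C(r, t) - 1) * 'C(n, t.-1))%N.
Proof.
have hE : heavy \subset E by apply/subsetP => e /setIdP[].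
rewrite -(cardsID heavy E) (setIidPr hE) mulnDl addnC leq_add ?card_light //.
by rewrite mulnAC leq_mul2r card_heavy orbT.
Qed.

End UpperBound.

(** * Convergence of the normalised extremal number *)

Section Limit.
Variables (R : realType) (r t : nat).
Hypotheses (t_gt0 : (0 < t)%N) (t_lt_r : (t < r)%N).
Local Notation k := (2 * 'C(r, t) - 1)%N.

Lemma extremal_upper (n : nat) : (extremal r n (3 * r - 2 * t) 3 * k <=
  2 * 'C(n, t) + 2 * k * 'C(n, t.-1))%N.
Proof.
rewrite /extremal; elim/big_ind: _ => [|a b ha hb|E /andP[Eu Es]] //.
  by rewrite maxnMl geq_max ha.
by have := card_sparse t_gt0 t_lt_r Eu Es; rewrite card_ord.
Qed.

(** Passing from s to s + 1 adds an error of at most s n^s, and s^2 + s <= (s + 1)^2. *)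
Lemma exp_le_ffact (n s : nat) : (n ^ s <= n ^_ s + s ^ 2 * n ^ s.-1)%N.
Proof.
elim: s => [|s IH] //; rewrite ffactnSr expnS /=.
have h1 : (n * n ^_ s <= n ^_ s * (n - s) + s * n ^ s)%N.
  apply: (@leq_trans (n ^_ s * (n - s) + s * n ^_ s)).
    by rewrite [(s * _)%N]mulnC -mulnDr mulnC leq_mul2l; apply/orP; right; lia.
  by rewrite leq_add2l leq_mul2l ffact_le_exp orbT.
have h2 : (n * (s ^ 2 * n ^ s.-1) <= s ^ 2 * n ^ s)%N.
  by case: s {IH h1} => [|s] /=; rewrite ?exp0n ?mul0n ?muln0 // [(n ^ s.+1)%N]expnS mulnCA.
apply: leq_trans (leq_mul (leqnn n) IH) _; rewrite mulnDr.
apply: leq_trans (leq_add h1 h2) _; rewrite -addnA leq_add2l -mulnDl leq_mul2r.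
by apply/orP; right; rewrite -!mulnn; lia.
Qed.

Lemma extremal_limit (e : R) : 0 < e -> exists n0, forall n, (n0 <= n)%N ->
  `|2 / (t`!%:R * (2 * 'C(r, t)%:R - 1)) -
    n%:R ^- t * (extremal r n (3 * r - 2 * t) 3)%:R| <= e.
Proof.
move=> e0.
have kE : 2 * 'C(r, t)%:R - 1 = k%:R :> R.
  by rewrite natrB ?natrM // muln_gt0 /= bin_gt0 ltnW.
rewrite kE.
have kp : 0 < k%:R :> R by rewrite ltr0n k_gt0.
have tp : 0 < t`!%:R :> R by rewrite ltr0n fact_gt0.
have t1 : 1 <= t`!%:R :> R by rewrite ler1n fact_gt0.
have k1 : 1 <= k%:R :> R by rewrite ler1n k_gt0.
pose e1 := e / 4; have e1p : 0 < e1 by rewrite divr_gt0.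
have [n1 low] := extremal_lower t_gt0 t_lt_r e1p.
(* This collects the two errors of order n^(t - 1): heavy edges in the upper bound, and twice the
   gap between n^t and t! C(n, t). The threshold on n makes c n^(t - 1) at most e1 n^t. *)
pose c : R := 2 * k%:R + 2 * (t ^ 2)%:R.
have c0 : 0 <= c by rewrite addr_ge0 // mulr_ge0.
exists (n1 + Num.bound (c / e1)).+1 => n n_ge.
have n0 : (0 : R) < n%:R by rewrite ltr0n; apply: leq_trans n_ge.
have cn : c <= e1 * n%:R.
  rewrite mulrC -ler_pdivrMr //; apply: ltW; apply: (@lt_le_trans _ _ (Num.bound (c / e1))%:R).
    by apply: archi_boundP; apply: divr_ge0 => //; exact: ltW.
  by rewrite ler_nat; apply: leq_trans n_ge; rewrite leqW // leq_addl.
have {}low := low n (leq_trans (leqW (leq_addr _ _)) n_ge).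
have up : (extremal r n (3 * r - 2 * t) 3)%:R * k%:R <=
    2 * 'C(n, t)%:R + 2 * k%:R * 'C(n, t.-1)%:R :> R.
  by rewrite -!natrM -natrD ler_nat extremal_upper.
move: (extremal _ _ _ _)%:R low up => x low up.
set N := n%:R ^+ t : R; set N' := n%:R ^+ t.-1 : R.
have N0 : 0 < N by rewrite exprn_gt0.
have NN : N = n%:R * N' by rewrite /N /N' -exprS prednK.
have cN : c * N' <= e1 * N.
  by rewrite NN mulrA ler_wpM2r // exprn_ge0.
have C' : 'C(n, t.-1)%:R <= N' by rewrite /N' -natrX ler_nat bin_le_exp.
have Cup : 'C(n, t)%:R * t`!%:R <= N by rewrite -natrM /N -natrX ler_nat bin_ffact ffact_le_exp.
have Clow : N <= 'C(n, t)%:R * t`!%:R + (t ^ 2)%:R * N'.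
  by rewrite -natrM /N /N' -!natrX -natrM -natrD ler_nat bin_ffact exp_le_ffact.
have -> : 2 / (t`!%:R * k%:R) - n%:R ^- t * x = (2 * N - k%:R * x * t`!%:R) / (t`!%:R * k%:R * N).
  by rewrite -/N; field; rewrite !gt_eqF.
have D0 : 0 < t`!%:R * k%:R * N by rewrite !mulr_gt0.
rewrite normrM normfV (gtr0_norm D0) ler_pdivrMr //.
have N'0 : 0 <= N' by exact: exprn_ge0.
have T0 := ltW tp.
have low' := ler_wpM2r T0 low; have up' := ler_wpM2r T0 up.
have k2 : 2 * k%:R * 'C(n, t.-1)%:R * t`!%:R <= 2 * k%:R * N' * t`!%:R.
  by rewrite ler_wpM2r // ler_wpM2l // mulr_ge0.
have h1 : e1 * N <= e1 * N * t`!%:R by rewrite ler_peMr // mulr_ge0 // ltW.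
have h2 : (t ^ 2)%:R * N' <= (t ^ 2)%:R * N' * t`!%:R by rewrite ler_peMr // mulr_ge0.
have cN' := ler_wpM2r T0 cN.
have h3 : e1 * N * t`!%:R <= e1 * N * t`!%:R * k%:R.
  by rewrite ler_peMr //; nonneg.
have eE : e * (t`!%:R * k%:R * N) = 4 * (e1 * N * t`!%:R * k%:R) by rewrite /e1; field.
rewrite eE ler_norml; move: low' up' cN' k2 h2 h3 Cup Clow; rewrite /c -/N.
have g1 : 0 <= k%:R * N' * t`!%:R by nonneg.
have g2 : 0 <= (t ^ 2)%:R * N' * t`!%:R by nonneg.
have g3 : 0 <= e1 * N * t`!%:R by nonneg.
by move=> low' up' cN' k2 h2 h3 Cup Clow; apply/andP; split; lra.
Qed.

End Limit.

From mathcomp Require Import all_classical all_reals all_analysis.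
Import Order.TTheory GRing.Theory Num.Theory.
Import numFieldNormedType.Exports.
Local Open Scope classical_set_scope.
Local Open Scope ring_scope.

Theorem theorem1p3 (R : realType) (r t : nat) (ht : (2 <= t)%N) (htr : (t < r)%N) :
  (fun n : nat => n%:R ^- t * (extremal r n (3 * r - 2 * t)%N 3)%:R : R) @ \oo
    --> (2 / (t`!%:R * (2 * 'C(r, t)%:R - 1)) : R).
Proof.
apply/cvgrPdist_le => e e0.
have [n0 close] := extremal_limit (ltnW ht) htr e0.
by exists n0 => // n /= n0n; exact: close.
Qed.
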